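(* There exists $Q_0>0$ such that for every $0<Q<Q_0$ the only minimizers of $$\min\left\{P(E)+Q^2\,\mathcal I_0(E)\ :\ E\subset\mathbb R^2 \text{ convex body},\ |E|=1\right\}$$ are balls (of area $1$).
   Context: A convex body is a compact convex subset of $\mathbb R^2$ with nonempty interior; $|E|$ is its area and $P(E):=\mathcal H^1(\partial E)$ its perimeter. Letting $\mathcal P(E)$ be the set of Borel probability measures supported on the closure of $E$, $$\mathcal I_0(E):=\inf_{\mu\in\mathcal P(E)}\int_{E\times E}\log\left(\frac1{|x-y|}\right)d\mu(x)\,d\mu(y).$$ *)

(* Defs.v *)
From HB Require Import structures.
From mathcomp Require Export all_boot all_order all_algebra.
From mathcomp Require Export all_classical all_reals all_analysis.

Set Implicit Arguments.
Unset Strict Implicit.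
Unset Printing Implicit Defensive.

Import Order.TTheory GRing.Theory Num.Theory numFieldNormedType.Exports.

Local Open Scope classical_set_scope.
Local Open Scope ring_scope.
Local Open Scope ereal_scope.

(* [(R * R)%type] carries the product topology and the product sigma-algebra,
   i.e. the usual topology of the plane and its Borel sets.  The library norm
   on a product is the sup norm, so the Euclidean distance is defined here. *)
Notation plane R := (R * R)%type (only parsing).

Definition edist (R : realType) (x y : plane R) : R :=
  Num.sqrt ((x.1 - y.1) ^+ 2 + (x.2 - y.2) ^+ 2)%R.

(* The element 0 makes the diameter of the empty set equal to 0. *)
Definition ediam (R : realType) (A : set (plane R)) : \bar R :=
  ereal_sup (0 |` [set (edist z.1 z.2)%:E | z in A `*` A]).

Definition hausdorff1_delta (R : realType) (delta : R) (A : set (plane R)) :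
    \bar R :=
  ereal_inf [set \sum_(0 <= k <oo) ediam (U k) | U in
    [set U : (set (plane R))^nat |
       A `<=` \bigcup_k U k /\ forall k, ediam (U k) <= delta%:E]].

Definition hausdorff1 (R : realType) (A : set (plane R)) : \bar R :=
  ereal_sup [set hausdorff1_delta delta A | delta in [set d : R | (0 < d)%R]].

Definition convex_body (R : realType) (E : set (plane R)) : Prop :=
  [/\ compact E, convex_set E & E° !=set0].

Definition area (R : realType) (E : set (plane R)) : \bar R :=
  (lebesgue_measure \x lebesgue_measure) E.

Definition perimeter (R : realType) (E : set (plane R)) : \bar R :=
  hausdorff1 (closure E `\` E°).

(* Equals +oo on the diagonal, since 0^-1 = +oo and lne +oo = +oo. *)
Definition log_kernel (R : realType) (x y : plane R) : \bar R :=
  lne ((edist x y)%:E)^-1.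

Definition log_energy (R : realType) (E : set (plane R))
    (mu : probability (plane R) R) : \bar R :=
  \int[mu \x mu]_(z in E `*` E) log_kernel z.1 z.2.

Definition supported_on (R : realType) (E : set (plane R))
    (mu : probability (plane R) R) : Prop :=
  mu (~` closure E) = 0.

Definition I0 (R : realType) (E : set (plane R)) : \bar R :=
  ereal_inf [set log_energy E mu | mu in
    [set mu : probability (plane R) R | supported_on E mu]].

Definition functional (R : realType) (Q : R) (E : set (plane R)) : \bar R :=
  perimeter E + (Q ^+ 2)%:E * I0 E.

Definition admissible (R : realType) (E : set (plane R)) : Prop :=
  convex_body E /\ area E = 1.

Definition is_minimizer (R : realType) (Q : R) (E : set (plane R)) : Prop :=
  admissible E /\
  forall F : set (plane R), admissible F -> functional Q E <= functional Q F.

Definition is_ball (R : realType) (E : set (plane R)) : Prop :=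
  exists (c : plane R) (r : R),
    (0 < r)%R /\ E = [set x | (edist x c <= r)%R].

(* Main.v *)
(** Write [P] for the perimeter of [E] and suppose [|E| = 1].  Two sharp inequalities give the
    result: [P >= 2 sqrt pi], with equality only for discs, and [I0 E >= ln (2 pi / P)], which
    is attained on discs by the uniform measure of the boundary circle.  Hence the functional is
    at least [P + Q^2 ln (2 pi / P)], which for [Q < 1] is strictly increasing in [P] on
    [[2 sqrt pi, +oo[], so that [Q0 = 1] works.

    Energy bound: up to the constant [ln 2], [ln |x - y|] is the mean over the directions [t] of
    [ln |(x - y) . t|].  If [E] has width [w] in the direction [t], rescaling its projection to
    [[-1, 1]] turns [- ln |(x - y) . t|] into [- ln (w / 4)] plus a positive definite kernel (a
    series in products of Chebyshev polynomials), whose energy is nonnegative.  Jensen's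
    inequality and the bound [P / pi] on the mean width, which is the easy half of Cauchy's
    formula (inscribed polygons are not longer than the Hausdorff measure of the boundary curve),
    finish the estimate.  Everything is done with finitely many directions, truncated series and
    regularised kernels, so that only finite sums are integrated.

    Isoperimetric inequality: let [2 r] be the horizontal extent of [E], centred at [b].
    Bounding the height of [E] above [b + r cos t] by its tangent line of normal angle [t] and
    integrating gives [|E| <= r P - pi r^2], hence [P^2 >= 4 pi].  Using in addition a further
    tangent line above and below on a strip of width [2 c] and letting [c] tend to 0 shows that
    in the equality case [E] contains a disc of radius [r], which already has area 1. *)

Require Import Defs.
From mathcomp Require Import ring lra measurable_realfun.

Set Implicit Arguments.
Unset Strict Implicit.
Unset Printing Implicit Defensive.

Import Order.TTheory GRing.Theory Num.Theory numFieldNormedType.Exports.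

Local Open Scope ring_scope.
Local Open Scope classical_set_scope.

(** * Logarithmic kernel as a cosine series *)

(** Both halves of the argument see the perimeter only through finite sums of widths, by the
    inequalities collected in [support_sum_bound]. They hold with the perimeter as bound, and on
    every convex body with some finite bound; the latter settles the case where the perimeter is not
    known to be finite.

    The obstacle in the energy estimate is that ln |(x - y) . t| is -oo whenever x - y is orthogonal
    to t, and a measure may charge such pairs. The kernel is therefore regularised twice, by [rho]
    in the mean over directions and by [r] in the Chebyshev expansion. The first regularisation is
    absorbed by the second once 1 - rho is small against the ratio of the least width to the
    diameter, so [r] is fixed before [rho].

    The final statement is an equivalence, so area, perimeter and energy of discs have to match the
    lower bounds exactly. The value Q0 = 1 comes from the slope 1 - Q^2 / P of the lower bound:
    since P >= 2 sqrt pi > 2, it exceeds 1/2. *)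

Section LogSeries.
Context {R : realType}.
Implicit Types (r s t phi : R) (N k m : nat).

Lemma poisson_denom_ge s phi : 0 <= s -> (1 - s) ^+ 2 <= 1 - 2 * s * cos phi + s ^+ 2.
Proof. by move=> s0; have := cos_le1 phi; nra. Qed.

Lemma cos_mulSS phi k : 
  cos (k.+2%:R * phi) = 2 * cos phi * cos (k.+1%:R * phi) - cos (k%:R * phi).
Proof.
have -> : k.+2%:R * phi = k.+1%:R * phi + phi by rewrite -[in LHS]addn1 natrD; ring.
have -> : k%:R * phi = k.+1%:R * phi - phi by rewrite -addn1 natrD; ring.
rewrite cosD cosB; ring.
Qed.

Lemma geometric_cos_sum s phi N :
  (1 - 2 * s * cos phi + s ^+ 2) * \sum_(k < N) s ^+ k * cos (k.+1%:R * phi) =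
  cos phi - s - s ^+ N * cos (N.+1%:R * phi) + s ^+ N.+1 * cos (N%:R * phi).
Proof.
elim: N => [|N IH].
  by rewrite big_ord0 mulr0 expr0 expr1 !mul1r mul0r cos0; ring.
rewrite big_ord_recr /= mulrDr IH cos_mulSS !exprS; ring.
Qed.

(** Partial sums of the real part of - log (1 - z) at z = r e^(i phi), which is - ln (1 - 2 r cos
    phi + r^2) / 2. *)
Definition log_series r phi N := \sum_(k < N) r ^+ k.+1 * cos (k.+1%:R * phi) / k.+1%:R.

Lemma is_derive_exprn (n : nat) (x : R) :
  is_derive x 1 (fun y : R => y ^+ n.+1) (n.+1%:R * x ^+ n).
Proof.
have -> : (fun y : R => y ^+ n.+1) = (@id R) ^+ n.+1.
  by apply/funext => y; rewrite exprfctE.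
by apply: is_derive_eq; rewrite /GRing.scale /= mulr1 -mulr_natl.
Qed.

Lemma is_derive_log_series phi N s :
  is_derive s 1 (fun x : R => log_series x phi N) (\sum_(k < N) s ^+ k * cos (k.+1%:R * phi)).
Proof.
rewrite /log_series.
have -> : (fun x : R => \sum_(k < N) x ^+ k.+1 * cos (k.+1%:R * phi) / k.+1%:R) =
  \sum_(k < N) (fun x : R => x ^+ k.+1 * cos (k.+1%:R * phi) / k.+1%:R).
  by apply/funext => x; rewrite fct_sumE.
apply: is_derive_sum => k.
have -> : (fun x : R => x ^+ k.+1 * cos (k.+1%:R * phi) / k.+1%:R) =
   (cos (k.+1%:R * phi) / k.+1%:R) \*: (fun x : R => x ^+ k.+1).
  by apply/funext => x; rewrite /= /GRing.scale /=; ring.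
have dX := is_derive_exprn k s.
apply: is_derive_eq.
rewrite /GRing.scale /=; field.
by rewrite addrC natr1 pnatr_eq0.
Qed.

(** The difference vanishes at r = 0. By [geometric_cos_sum] its derivative consists of two terms of
    order N and N + 1 over the denominator |1 - z|^2, which is at least (1 - r)^2 up to r; the mean
    value theorem concludes. *)
Lemma log_series_remainder r phi N : 0 <= r < 1 ->
  `| - (ln (1 - 2 * r * cos phi + r ^+ 2) / 2) - log_series r phi N | <=
    2 * r ^+ N.+1 / (1 - r) ^+ 2.
Proof.
move=> /andP[r0 r1].
pose D x : R := 1 - 2 * x * cos phi + x ^+ 2.
pose g x : R := - (ln (D x) / 2) - log_series x phi N.
pose dg x : R := (x ^+ N * cos (N.+1%:R * phi) - x ^+ N.+1 * cos (N%:R * phi)) / D x.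
have D0 (x : R) : 0 <= x -> x < 1 -> 0 < D x.
  by move=> x0 x1; apply: lt_le_trans (poisson_denom_ge phi x0); rewrite exprn_gt0// subr_gt0.
have dgE (x : R) : 0 <= x -> x < 1 -> is_derive x 1 g (dg x).
  move=> x0 x1.
  have dD : is_derive x 1 D (- 2 * cos phi + 2 * x).
    have -> : D = cst 1 + (- 2 * cos phi) \*: id + (fun y : R => y ^+ 2).
      by apply/funext => y; rewrite /D !fctE /= /GRing.scale /=; ring.
    have d2 := is_derive_exprn 1 x.
    by apply: is_derive_eq; rewrite /GRing.scale /= expr1; ring.
  have dln := is_derive1_ln (D0 _ x0 x1).
  have dlnD := @is_derive1_comp _ (@ln R) D x _ _ dln dD.
  have dS := is_derive_log_series phi N x.
  have -> : g = (fun x => (- 2^-1) * ((@ln R \o D) x) - log_series x phi N).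
    by apply/funext => y; rewrite /g /=; field.
  apply: is_derive_eq.
  rewrite /GRing.scale /= /dg.
  have Dn0 : D x != 0 by rewrite gt_eqF// D0.
  have := geometric_cos_sum x phi N; rewrite -/(D x).
  set S := (\sum_(k < N) _) => HS.
  have -> : S = (D x * S) / D x by rewrite mulrAC divff// mul1r.
  rewrite HS.
  by field.
have g0 : g 0 = 0.
  have D1 : D 0 = 1 by rewrite /D; ring.
  rewrite /g D1 ln1 /log_series big1 => [|k _]; last by rewrite exprS !mul0r.
  by rewrite mul0r oppr0 addr0.
rewrite -/(D r) -/(g r).
have [->|rn0] := eqVneq r 0.
  by rewrite g0 normr0 exprS mul0r mulr0 mul0r.
have rp : 0 < r by rewrite lt_neqAle eq_sym rn0.
have [||c] := @MVT R g dg 0 r rp.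
- by move=> x /[!in_itv] /= /andP[/ltW x0 xr]; apply: dgE => //; exact: lt_trans xr r1.
- apply: derivable_within_continuous => x; rewrite in_itv /= => /andP[x0 xr].
  by case: (dgE x x0 (le_lt_trans xr r1)).
rewrite in_itv /= => /andP[c0 cr] Hc.
move: Hc; rewrite g0 !subr0 => ->.
rewrite /dg.
have c1 := lt_trans cr r1.
have Dc := D0 _ (ltW c0) c1.
rewrite normrM [`|r|]ger0_norm// normrM normfV [`|D c|]gtr0_norm//.
have H1 : `|c ^+ N * cos (N.+1%:R * phi) - c ^+ N.+1 * cos (N%:R * phi)| <= 2 * r ^+ N.
  apply: le_trans (ler_normB _ _) _; rewrite !normrM.
  have cosn x : `|cos x| <= 1 :> R by rewrite ler_norml cos_geN1 cos_le1.
  have cN : `|c ^+ N| <= r ^+ N.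
    by rewrite ger0_norm ?exprn_ge0 ?(ltW c0)// lerXn2r ?nnegrE ?(ltW c0) ?(ltW cr)//.
  have cN1 : `|c ^+ N.+1| <= r ^+ N.
    apply: le_trans cN; rewrite exprS normrM ler_piMl//.
    by rewrite ger0_norm ?(ltW c0)// (ltW c1).
  rewrite [leRHS]mulr_natl mulr2n lerD//.
    by rewrite -[leRHS]mulr1 ler_pM.
  by rewrite -[leRHS]mulr1 ler_pM.
have H2 : (D c)^-1 <= ((1 - r) ^+ 2)^-1.
  rewrite lef_pV2 ?posrE ?exprn_gt0 ?subr_gt0//.
  apply: le_trans (poisson_denom_ge phi (ltW c0)).
  by rewrite lerXn2r ?nnegrE ?subr_ge0 ?(ltW c1) ?(ltW r1)// lerD2l lerN2 ltW.
have -> : 2 * r ^+ N.+1 / (1 - r) ^+ 2 = 2 * r ^+ N * ((1 - r) ^+ 2)^-1 * r by rewrite exprSr; ring.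
by rewrite ler_wpM2r// ler_pM// invr_ge0 ltW.
Qed.

End LogSeries.

(** * Chebyshev bound for the kernel on a segment, and averages over directions *)

Section Kernels.
Context {R : realType}.
Implicit Types (r s t phi : R) (N k m : nat).

(** The recurrence gives a polynomial, continuous on the whole line and thus measurable, while
    [chebyshev_cos] recovers the trigonometric form on [-1, 1]. *)
Fixpoint chebyshev k s : R :=
  match k with
  | 0 => 1
  | k'.+1 => match k' with
             | 0 => s
             | k''.+1 => 2 * s * chebyshev k' s - chebyshev k'' s
             end
  end.

Arguments chebyshev : simpl never.

Lemma chebyshev_cos k phi : chebyshev k (cos phi) = cos (k%:R * phi).
Proof.
have [n] := ubnP k; elim: n k => // n IH [|[|k]] Hk.
- by rewrite mul0r cos0.
- by rewrite mul1r.
- rewrite cos_mulSS -!IH//; exact: ltn_trans (ltnSn _) _.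
Qed.

Lemma continuous_chebyshev k : continuous (chebyshev k).
Proof.
have [n] := ubnP k; elim: n k => // n IH [|[|k]] Hk x.
- exact: cvg_cst.
- exact: cvg_id.
- have -> : chebyshev k.+2 = fun s => 2 * s * chebyshev k.+1 s - chebyshev k s by [].
  apply: cvgB; last by apply: IH; exact: ltn_trans (ltnSn _) _.
  apply: cvgM; last exact: IH.
  by apply: cvgM; [exact: cvg_cst|exact: cvg_id].
Qed.

Definition log_error r N : R := 2 * r ^+ N.+1 / (1 - r) ^+ 2.

(* The regularised form of [ln |s - t| = - ln 2 - sum_k (2 / k) T_k(s) T_k(t)] on [[-1, 1]]:
   for [s = cos a] and [t = cos b], the difference [s - t] is, up to a factor [-2],
   [sin ((a - b) / 2) * sin ((a + b) / 2)]. *)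
Lemma reg_log_le r s t N : 0 < r < 1 -> -1 <= s <= 1 -> -1 <= t <= 1 ->
  ln ((s - t) ^+ 2 + ((1 - r) ^+ 2 / (2 * r)) ^+ 2) / 2 <=
  - ln (2 * r) + 2 * log_error r N
  - \sum_(k < N) (2 * r ^+ k.+1 / k.+1%:R) * (chebyshev k.+1 s * chebyshev k.+1 t).
Proof.
move=> /andP[r0 r1] s1 t1.
have [a sE] : exists a, s = cos a by exists (acos s); rewrite acosK// in_itv.
have [b tE] : exists b, t = cos b by exists (acos t); rewrite acosK// in_itv.
pose D x : R := 1 - 2 * r * cos x + r ^+ 2.
have D0 x : 0 < D x.
  by apply: lt_le_trans (poisson_denom_ge x (ltW r0)); rewrite exprn_gt0// subr_gt0.
set q := (s - t) ^+ 2 + _.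
have q0 : 0 < q.
  rewrite ltr_wpDl ?sqr_ge0// exprn_gt0// divr_gt0// ?exprn_gt0 ?subr_gt0//.
  by rewrite mulr_gt0.
have r20 : 0 < 2 * r by rewrite mulr_gt0.
(* Since D x = (1 - r)^2 + 2 r (1 - cos x), expanding the product gives the left-hand side plus a
   nonnegative cross term. This is where the regularisation (1 - r)^2 / (2 r) comes from. *)
have Hq : (2 * r) ^+ 2 * q <= D (a - b) * D (a + b).
  have -> : (2 * r) ^+ 2 * q = (1 - r) ^+ 4 + (2 * r) ^+ 2 * (s - t) ^+ 2.
    by rewrite /q; field; rewrite gt_eqF.
  have H1 := cos_le1 (a - b); have H2 := cos_le1 (a + b).
  have -> : (s - t) ^+ 2 = (1 - cos (a - b)) * (1 - cos (a + b)).
    rewrite sE tE cosB cosD.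
    have Ha := cos2Dsin2 a; have Hb := cos2Dsin2 b.
    have -> : (1 - (cos a * cos b + sin a * sin b)) * (1 - (cos a * cos b - sin a * sin b))
      = (1 - cos a * cos b) ^+ 2 - (sin a ^+ 2) * (sin b ^+ 2) by ring.
    have -> : sin a ^+ 2 = 1 - cos a ^+ 2 by rewrite -Ha; ring.
    have -> : sin b ^+ 2 = 1 - cos b ^+ 2 by rewrite -Hb; ring.
    by ring.
  rewrite -subr_ge0 /D.
  set c1 := cos (a - b) in H1 *; set c2 := cos (a + b) in H2 *.
  have -> : (1 - 2 * r * c1 + r ^+ 2) * (1 - 2 * r * c2 + r ^+ 2) -
      ((1 - r) ^+ 4 + (2 * r) ^+ 2 * ((1 - c1) * (1 - c2))) =
      2 * r * (1 - r) ^+ 2 * ((1 - c1) + (1 - c2)) by ring.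
  rewrite !mulr_ge0 ?sqr_ge0 ?(ltW r0)//; lra.
have Hln : 2 * ln (2 * r) + ln q <= ln (D (a - b)) + ln (D (a + b)).
  rewrite -lnM ?posrE//.
  rewrite mulr_natl -lnXn// -lnM ?posrE ?exprn_gt0// ler_ln ?posrE//.
    by rewrite mulr_gt0// exprn_gt0.
  exact: mulr_gt0.
have /ler_normlP[A1 _] := log_series_remainder (a - b) N (introT andP (conj (ltW r0) r1)).
have /ler_normlP[_ A1'] := log_series_remainder (a - b) N (introT andP (conj (ltW r0) r1)).
have /ler_normlP[_ A2'] := log_series_remainder (a + b) N (introT andP (conj (ltW r0) r1)).
have /ler_normlP[A2 _] := log_series_remainder (a + b) N (introT andP (conj (ltW r0) r1)).
rewrite -/(D _) -/(log_error r N) in A1 A2 A1' A2'.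
have -> : \sum_(k < N) (2 * r ^+ k.+1 / k.+1%:R) * (chebyshev k.+1 s * chebyshev k.+1 t)
   = log_series r (a - b) N + log_series r (a + b) N.
  rewrite /log_series -big_split /=; apply: eq_bigr => k _.
  by rewrite sE tE !chebyshev_cos !mulrDr mulrN cosB cosD; ring.
lra.
Qed.

Lemma sum_cos_arith (a d : R) n :
  2 * sin (d / 2) * \sum_(j < n) cos (a + d * j%:R) =
  sin (a + d * n%:R - d / 2) - sin (a - d / 2).
Proof.
elim: n => [|n IH]; first by rewrite big_ord0 mulr0 mulr0 addr0 subrr.
rewrite big_ord_recr /= mulrDr IH.
have -> : a + d * n.+1%:R - d / 2 = (a + d * n%:R) + d / 2 by rewrite -addn1 natrD; field.
rewrite (sinB (a + d * n%:R)) (sinD (a + d * n%:R)); ring.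
Qed.

Lemma sin_add2pin (x : R) n : sin (x + 2 * pi * n%:R) = sin x.
Proof.
elim: n => [|n IH]; first by rewrite mulr0 addr0.
have -> : x + 2 * pi * n.+1%:R = (x + 2 * pi * n%:R) + pi *+ 2.
  by rewrite -addn1 natrD -[pi *+ 2]mulr_natl; ring.
by rewrite sinD2pi.
Qed.

(** Multiplied by 2 sin (pi k / m), the sum telescopes to a difference of sines whose arguments are
    2 pi k apart; 0 < k < m keeps the factor positive. *)
Lemma sum_cos_roots (psi : R) m k : (0 < k < m)%N ->
  \sum_(j < m) cos (k%:R * (psi + 2 * pi / m%:R * j%:R)) = 0.
Proof.
move=> /andP[k0 km].
have m0 : (0 : R) < m%:R by rewrite ltr0n (ltn_trans k0).
pose d : R := 2 * pi * k%:R / m%:R.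
under eq_bigr => j _.
  have -> : k%:R * (psi + 2 * pi / m%:R * j%:R) = k%:R * psi + d * j%:R.
    by rewrite /d; field; rewrite gt_eqF.
  over.
have sd : 0 < sin (d / 2).
  have -> : d / 2 = pi * (k%:R / m%:R) by rewrite /d; field; rewrite gt_eqF.
  have kp : (0 : R) < k%:R / m%:R by rewrite divr_gt0// ltr0n.
  apply: sin_gt0_pi.
  rewrite mulr_gt0 ?pi_gt0//=.
  by rewrite gtr_pMr ?pi_gt0// ltr_pdivrMr// mul1r ltr_nat.
have H := sum_cos_arith (k%:R * psi) d m.
have E : sin (k%:R * psi + d * m%:R - d / 2) = sin (k%:R * psi - d / 2).
  have -> : k%:R * psi + d * m%:R - d / 2 = k%:R * psi - d / 2 + 2 * pi * k%:R.
    by rewrite /d; field; rewrite gt_eqF.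
  exact: sin_add2pin.
move: H; rewrite E subrr => /eqP; rewrite mulf_eq0 => /orP[|/eqP//].
by rewrite gt_eqF// mulr_gt0.
Qed.

(** The frequencies 1, ..., m - 1 average out over m equidistant angles, so truncating the series
    after m - 1 terms leaves only the remainder. *)
Lemma avg_log_poisson (rho psi : R) m : (0 < m)%N -> 0 <= rho < 1 ->
  - (m%:R * log_error rho m.-1) <=
  \sum_(j < m) ln (1 - 2 * rho * cos (psi + 2 * pi / m%:R * j%:R) + rho ^+ 2) / 2.
Proof.
move=> m0 hr.
have H j := log_series_remainder (psi + 2 * pi / m%:R * j%:R) m.-1 hr.
have S0 : \sum_(j < m) log_series rho (psi + 2 * pi / m%:R * j%:R) m.-1 = 0.
  rewrite /log_series exchange_big /= big1// => k _.
  rewrite -mulr_suml -mulr_sumr sum_cos_roots ?mulr0 ?mul0r//.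
  by rewrite /= -ltn_predRL.
have -> : - (m%:R * log_error rho m.-1) = \sum_(j < m)
    (- log_series rho (psi + 2 * pi / m%:R * j%:R) m.-1 - log_error rho m.-1).
  by rewrite big_split /= !sumrN S0 sumr_const card_ord oppr0 add0r mulr_natl.
apply: ler_sum => j _.
have /ler_normlP[_] := H j; rewrite -/(log_error _ _); lra.
Qed.

Lemma polar_coordinates (a b : R) : a ^+ 2 + b ^+ 2 = 1 ->
  exists2 t, 0 <= t <= 2 * pi & a = cos t /\ b = sin t.
Proof.
move=> ab1.
have a1 : -1 <= a <= 1 by apply/andP; split; nra.
have [t0 tpi] : 0 <= acos a /\ acos a <= pi by split; [exact: acos_ge0|exact: acos_lepi].
have cE : cos (acos a) = a by rewrite acosK// in_itv.
have sE : sin (acos a) = `|b|.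
  by rewrite sin_acos// -ab1 addrAC subrr add0r sqrtr_sqr.
have pi0 := pi_gt0 R.
have [b0|b0] := leP 0 b.
  exists (acos a); first by apply/andP; split => //; lra.
  by rewrite cE sE ger0_norm.
exists (2 * pi - acos a); first by apply/andP; split; lra.
have -> : 2 * pi - acos a = - acos a + pi *+ 2 by rewrite mulr_natl addrC.
rewrite cosD2pi sinD2pi cosN sinN cE sE ltr0_norm// opprK.
by split.
Qed.

Lemma polar_coordinates_scaled (a b : R) : 
  exists2 t, 0 <= t <= 2 * pi &
    a = Num.sqrt (a ^+ 2 + b ^+ 2) * cos t /\ b = Num.sqrt (a ^+ 2 + b ^+ 2) * sin t.
Proof.
set d := Num.sqrt _.
have dE : d ^+ 2 = a ^+ 2 + b ^+ 2 by rewrite sqr_sqrtr// addr_ge0 ?sqr_ge0.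
have [d0|dn0] := eqVneq d 0.
  have : a ^+ 2 + b ^+ 2 = 0 by rewrite -dE d0 expr0n.
  move=> /eqP; rewrite paddr_eq0 ?sqr_ge0// !sqrf_eq0 => /andP[/eqP -> /eqP ->].
  by exists 0; rewrite ?d0 ?mul0r// lexx mulr_ge0 ?pi_ge0.
have [|t ht [ca sb]] := @polar_coordinates (a / d) (b / d).
  by rewrite !expr_div_n -mulrDl -dE divff// expf_neq0.
by exists t => //; rewrite -ca -sb; split; rewrite mulrC divfK.
Qed.

(** Midpoints of m equal parts of [0, pi]. Half a turn suffices for functions of (a cos t + b sin
    t)^2; midpoints avoid 0 and pi, where tangent lines are vertical, and are exchanged by t -> pi -
    t. *)
Definition mid_angle m j : R := (j%:R + 2^-1) * (pi / m%:R).

(* The mean of [ln |a cos t + b sin t|] over all directions [t] is [ln |(a, b)| - ln 2]; a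
   parameter [rho < 1] keeps the kernel finite in the directions orthogonal to [(a, b)]. *)
Lemma ln_norm_le (a b rho : R) m : (0 < m)%N -> 0 <= rho < 1 ->
  0 < a ^+ 2 + b ^+ 2 ->
  ln (a ^+ 2 + b ^+ 2) / 2 <= log_error rho m.-1 + m%:R^-1 * \sum_(j < m)
    ln ((1 - rho) ^+ 2 * (a ^+ 2 + b ^+ 2) +
        4 * rho * (a * cos (mid_angle m j) + b * sin (mid_angle m j)) ^+ 2) / 2.
Proof.
move=> m0 hr ab0.
have mr0 : (0 : R) < m%:R by rewrite ltr0n.
have [t _ [aE bE]] := polar_coordinates_scaled a b.
set n2 := a ^+ 2 + b ^+ 2 in ab0 aE bE *.
set d := Num.sqrt n2 in aE bE.
have dE : d ^+ 2 = n2 by rewrite sqr_sqrtr// ltW.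
(* This shift makes the j-th angle equal to pi - 2 (t - mid_angle m j), so that 2 cos^2 u = 1 + cos
   (2 u) turns each summand into the logarithm of [n2 * D j]. *)
pose psi := pi / m%:R - 2 * t + pi.
pose D j := 1 - 2 * rho * cos (psi + 2 * pi / m%:R * j%:R) + rho ^+ 2.
have H := avg_log_poisson psi m0 hr.
have [r0 r1] := andP hr.
have D0 j : 0 < D j.
  by apply: lt_le_trans (poisson_denom_ge _ r0); rewrite exprn_gt0// subr_gt0.
have E (j : 'I_m) : (1 - rho) ^+ 2 * n2 +
        4 * rho * (a * cos (mid_angle m j) + b * sin (mid_angle m j)) ^+ 2 = n2 * D j.
  rewrite aE bE -!mulrA -mulrDr -cosB exprMn dE /D.
  have -> : psi + 2 * pi / m%:R * j%:R = - ((t - mid_angle m j) *+ 2) + pi.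
    by rewrite /psi /mid_angle -[_ *+ 2]mulr_natl; field; rewrite gt_eqF.
  by rewrite cosDpi cosN cos_mulr2n; ring.
under eq_bigr => j _ do rewrite E lnM ?posrE// mulrDl.
rewrite big_split /= sumr_const card_ord -(mulr_natl (_ / _)) mulrDr mulKf ?gt_eqF//.
have H2 : - log_error rho m.-1 <= m%:R^-1 * (\sum_(j < m) ln (D j) / 2).
  by rewrite mulrC ler_pdivlMr// mulNr mulrC.
lra.
Qed.

End Kernels.

(** * Euclidean distance, coverings and length of curves *)

Section EuclideanDistance.
Context {R : realType}.
Implicit Types (x y z : R * R) (A B : set (R * R)).

Lemma edist_ge0 x y : 0 <= edist x y. Proof. exact: sqrtr_ge0. Qed.

Lemma edist_sqr x y : edist x y ^+ 2 = (x.1 - y.1) ^+ 2 + (x.2 - y.2) ^+ 2.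
Proof. by rewrite sqr_sqrtr// addr_ge0 ?sqr_ge0. Qed.

Lemma edistC x y : edist x y = edist y x.
Proof. by rewrite /edist -(sqrrN (x.1 - y.1)) -(sqrrN (x.2 - y.2)) !opprB. Qed.

Lemma edist_eq0 x y : edist x y = 0 -> x = y.
Proof.
move=> /(congr1 (fun t => t ^+ 2)); rewrite edist_sqr expr0n /= => /eqP.
rewrite paddr_eq0 ?sqr_ge0// !sqrf_eq0 !subr_eq0 => /andP[/eqP h1 /eqP h2].
by case: x y h1 h2 => [x1 x2] [y1 y2] /= -> ->.
Qed.

Lemma edistxx x : edist x x = 0.
Proof. by rewrite /edist !subrr expr0n /= addr0 sqrtr0. Qed.

Lemma cauchy_schwarz2 (a b c d : R) : 
  `|a * c + b * d| <= Num.sqrt (a ^+ 2 + b ^+ 2) * Num.sqrt (c ^+ 2 + d ^+ 2).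
Proof.
rewrite -sqrtrM ?addr_ge0 ?sqr_ge0// -sqrtr_sqr ler_sqrt ?mulr_ge0 ?addr_ge0 ?sqr_ge0//.
rewrite -subr_ge0.
have -> : (a ^+ 2 + b ^+ 2) * (c ^+ 2 + d ^+ 2) - (a * c + b * d) ^+ 2 = (a * d - b * c) ^+ 2 by ring.
exact: sqr_ge0.
Qed.

Lemma edist_triangle y x z : edist x z <= edist x y + edist y z.
Proof.
rewrite -(ler_pXn2r (n := 2)) ?nnegrE ?addr_ge0 ?edist_ge0//.
rewrite sqrrD !edist_sqr.
have /ler_normlP[_] := cauchy_schwarz2 (x.1 - y.1) (x.2 - y.2) (y.1 - z.1) (y.2 - z.2).
rewrite -/(edist x y) -/(edist y z) -mulr_natr; nra.
Qed.

Lemma ediam_ge0 A : (0 <= ediam A)%E.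
Proof. by apply: ereal_sup_ubound; left. Qed.

Lemma edist_le_ediam A x y : A x -> A y -> ((edist x y)%:E <= ediam A)%E.
Proof. by move=> Ax Ay; apply: ereal_sup_ubound; right; exists (x, y). Qed.

Lemma ediam_le A (d : \bar R) : (0 <= d)%E ->
  (forall x y, A x -> A y -> ((edist x y)%:E <= d)%E) -> (ediam A <= d)%E.
Proof.
move=> d0 H; apply: ge_ereal_sup => _ [->//|[[x y] [/= Ax Ay] <-]].
exact: H.
Qed.

Lemma ediam_mono A B : A `<=` B -> (ediam A <= ediam B)%E.
Proof.
move=> AB; apply: ediam_le; first exact: ediam_ge0.
by move=> x y /AB ? /AB ?; exact: edist_le_ediam.
Qed.

Lemma ediam_set0 : ediam (@set0 (R * R)) = 0%E.
Proof. by apply/eqP; rewrite eq_le ediam_ge0 andbT; apply: ediam_le. Qed.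

(** The image lies between its infimum and supremum, at most a diameter apart. Sets of a Hausdorff
    covering may be non-measurable; these intervals are what subadditivity of the Lebesgue measure
    is applied to. *)
Lemma lipschitz_image_cover (p : R * R -> R) A :
  (forall x y, p x - p y <= edist x y) ->
  exists J : set R, [/\ measurable J, (forall x, A x -> J (p x)) & (lebesgue_measure J <= ediam A)%E].
Proof.
move=> plip.
have [->|/set0P [x0 Ax0]] := eqVneq A set0.
  by exists set0; split => //; rewrite measure0 ediam_ge0.
case E : (ediam A) => [D| |]; last first.
- by have := ediam_ge0 A; rewrite E.
- by exists setT; split => //; rewrite leey.
have pD x y : A x -> A y -> p x - p y <= D.
  move=> Ax Ay; apply: le_trans (plip x y) _.
  by rewrite -lee_fin -E edist_le_ediam.
pose S := p @` A.
have S0 : S !=set0 by exists (p x0), x0.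
have Slb s : S s -> lbound S (s - D).
  by move=> [x Ax <-] _ [y Ay <-]; have := pD _ _ Ax Ay; lra.
have Sub s : S s -> ubound S (s + D).
  by move=> [x Ax <-] _ [y Ay <-]; have := pD _ _ Ay Ax; lra.
have hinf : has_inf S by split => //; exists (p x0 - D); apply: Slb; exists x0.
have hsup : has_sup S by split => //; exists (p x0 + D); apply: Sub; exists x0.
exists `[inf S, sup S]%classic; split => //.
- move=> x Ax /=; rewrite in_itv /=; apply/andP; split.
    by apply: ge_inf; [exact: hinf.2|exists x].
  by apply: ub_le_sup; [exact: hsup.2|exists x].
- rewrite lebesgue_measure_itv /= lte_fin; case: ifPn => _; last first.
    by rewrite -E ediam_ge0.
  rewrite -EFinB lee_fin lerBlDl.
  apply: ge_sup => // s Ss; rewrite -lerBlDr.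
  by apply: lb_le_inf => //; exact: Slb.
Qed.

(** Orthogonal projection [p] on the line of the chord is 1-Lipschitz, and by the intermediate value
    theorem the projected arc covers a segment as long as the chord. The images of the covering sets
    therefore cover that segment. *)
Lemma chord_le_cover (g1 g2 : R -> R) (a b : R) (V : nat -> set (R * R)) :
  a <= b -> continuous g1 -> continuous g2 ->
  (forall t, a <= t <= b -> exists k, V k (g1 t, g2 t)) ->
  ((edist (g1 a, g2 a) (g1 b, g2 b))%:E <= \sum_(0 <= k <oo) ediam (V k))%E.
Proof.
move=> ab c1 c2 HV.
set d := edist _ _.
have [d0|dn0] := eqVneq d 0.
  by rewrite d0; apply: nneseries_ge0 => k _ _; exact: ediam_ge0.
have dp : 0 < d by rewrite lt_neqAle eq_sym dn0 edist_ge0.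
pose e1 := (g1 b - g1 a) / d; pose e2 := (g2 b - g2 a) / d.
have dsq := edist_sqr (g1 a, g2 a) (g1 b, g2 b); rewrite -/d /= in dsq.
have e1E : e1 ^+ 2 + e2 ^+ 2 = 1.
  rewrite /e1 /e2 !expr_div_n -mulrDl.
  rewrite -(sqrrN (g1 b - _)) -(sqrrN (g2 b - _)) !opprB -dsq divff//.
  by rewrite expf_neq0.
pose p (x : R * R) := (x.1 - g1 a) * e1 + (x.2 - g2 a) * e2.
have plip x y : p x - p y <= edist x y.
  have -> : p x - p y = (x.1 - y.1) * e1 + (x.2 - y.2) * e2 by rewrite /p; ring.
  apply: le_trans (ler_norm _) _; apply: le_trans (cauchy_schwarz2 _ _ _ _) _.
  by rewrite e1E sqrtr1 mulr1.
have /choice [J HJ] k := lipschitz_image_cover (V k) plip.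
pose f t := p (g1 t, g2 t).
have cf : continuous f.
  move=> t; apply: cvgD; apply: cvgM; try exact: cvg_cst.
    by apply: cvgB; [exact: c1|exact: cvg_cst].
  by apply: cvgB; [exact: c2|exact: cvg_cst].
have fa : f a = 0 by rewrite /f /p /= !subrr !mul0r addr0.
have fb : f b = d.
  rewrite /f /p /e1 /e2 /= !mulrA -mulrDl -!expr2.
  rewrite -(sqrrN (g1 b - _)) -(sqrrN (g2 b - _)) !opprB -dsq expr2 mulfK//.
have sub : `[0, d]%classic `<=` \bigcup_k J k.
  move=> v /=; rewrite in_itv /= => /andP[v0 vd].
  have [||c] := @IVT _ f a b v ab.
  - exact: continuous_subspaceT.
  - by rewrite fa fb (min_idPl (ltW dp)) (max_idPr (ltW dp)) v0.
  rewrite in_itv /= => hc <-.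
  have [k Vk] := HV _ hc; exists k => //.
  by have [_ /(_ _ Vk)] := HJ k.
have -> : d%:E = lebesgue_measure `[0, d]%classic.
  by rewrite lebesgue_measure_itv /= lte_fin dp -EFinB subr0.
apply: (@le_trans _ _ (\sum_(0 <= k <oo) lebesgue_measure (J k))%E).
  apply: measure_sigma_subadditive => // k; by case: (HJ k).
apply: lee_nneseries => [k _ _|k _]; first exact: measure_ge0.
by case: (HJ k).
Qed.

End EuclideanDistance.

(** * Inscribed polygons against the Hausdorff measure *)

Section CurveLength.
Context {R : realType}.

Lemma continuous_sum_ord (T : topologicalType) n (f : 'I_n -> T -> R) :
  (forall i, continuous (f i)) -> continuous (fun x => \sum_(i < n) f i x).
Proof.
elim: n f => [|n IH] f cf.
  under eq_fun do rewrite big_ord0.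
  by move=> x; exact: cvg_cst.
under eq_fun do rewrite big_ord_recr /=.
by move=> x; apply: cvgD; [exact: (IH (fun i => f (widen_ord (leqnSn n) i)))|exact: cf].
Qed.

Lemma continuous_edist (T : topologicalType) (a1 a2 b1 b2 : T -> R) :
  continuous a1 -> continuous a2 -> continuous b1 -> continuous b2 ->
  continuous (fun t => edist (a1 t, a2 t) (b1 t, b2 t)).
Proof.
move=> ca1 ca2 cb1 cb2 t; rewrite /edist /=.
apply: (@continuous_comp _ _ _ (fun t => (a1 t - b1 t) ^+ 2 + (a2 t - b2 t) ^+ 2) Num.sqrt); last first.
  exact: sqrt_continuous.
have sq (f : T -> R) : continuous f -> continuous (fun t => f t ^+ 2).
  move=> cf x; apply: (@continuous_comp _ _ _ f (fun y : R => y ^+ 2)); first exact: cf.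
  exact: exprn_continuous.
apply: cvgD.
  by apply: (sq (fun t => a1 t - b1 t)) => x; apply: cvgB; [exact: ca1|exact: cb1].
by apply: (sq (fun t => a2 t - b2 t)) => x; apply: cvgB; [exact: ca2|exact: cb2].
Qed.

Variables (g1 g2 : R -> R) (T : R) (S : set (R * R)).
Hypotheses (c1 : continuous g1) (c2 : continuous g2) (T0 : 0 < T)
  (inj : forall s t, 0 < s < T -> 0 < t < T -> g1 s = g1 t -> g2 s = g2 t -> s = t)
  (gS : forall t, S (g1 t, g2 t)).

Let g t := (g1 t, g2 t).

(** The distance is continuous and positive on a compact set of parameter pairs, hence bounded below
    there. Keeping away from 0 and T by [eps] allows the curve to be closed. *)
Lemma injective_curve_separation (eps : R) : 0 < eps ->
  exists2 dlt, 0 < dlt & forall s t, eps <= s <= T - eps -> eps <= t <= T - eps ->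
    2 * eps <= s - t -> dlt <= edist (g s) (g t).
Proof.
move=> eps0.
pose K := `[eps, T - eps]%classic `*` `[eps, T - eps]%classic `&`
  [set z : R * R | 2 * eps <= z.1 - z.2].
have cK : compact K.
  apply: (@subclosed_compact _ K (`[eps, T - eps]%classic `*` `[eps, T - eps]%classic)).
  - apply: closedI.
      by apply: compact_closed; [exact: norm_hausdorff|apply: compact_setX; exact: segment_compact].
    apply: (@closed_comp _ _ (fun z : R * R => z.1 - z.2) [set x | 2 * eps <= x]).
      by move=> z _; apply: cvgB; [exact: cvg_fst|exact: cvg_snd].
    exact: closed_ge.
  - by apply: compact_setX; exact: segment_compact.
  - exact: subIsetl.
have [K0|/set0P Kne] := eqVneq K set0.
  exists 1 => // s t hs ht hst; exfalso.
  have : K (s, t) by split => //; split; rewrite /= in_itv.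
  by rewrite K0.
pose f (z : R * R) := edist (g z.1) (g z.2).
have cf : continuous f.
  apply: continuous_edist => z.
  - by apply: (@continuous_comp _ _ _ fst g1); [exact: cvg_fst|exact: c1].
  - by apply: (@continuous_comp _ _ _ fst g2); [exact: cvg_fst|exact: c2].
  - by apply: (@continuous_comp _ _ _ snd g1); [exact: cvg_snd|exact: c1].
  - by apply: (@continuous_comp _ _ _ snd g2); [exact: cvg_snd|exact: c2].
have [c /set_mem Kc cmin] := compact_EVT_min Kne cK (continuous_subspaceT cf).
exists (f c).
  rewrite lt_neqAle edist_ge0 andbT eq_sym; apply/eqP => /edist_eq0.
  case: Kc => -[]; rewrite /= !in_itv /= => /andP[h1 h2] /andP[h3 h4] h5.
  move=> [e1 e2]; have := inj _ _ e1 e2; move=> E.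
  suff : c.1 = c.2 by lra.
  by apply: E; apply/andP; split; lra.
move=> s t hs ht hst; apply: (cmin (s, t)); apply/mem_set.
by split => //; split; rewrite /= in_itv.
Qed.

(** Subadditivity goes the wrong way for adding lower bounds on several arcs. Each arc is thus
    shortened by [e] at both ends, at a total cost below [eta], which puts the arcs at mutual
    distance at least [dlt]. A set of diameter at most dlt / 2 then meets at most one arc, and the
    chord bounds of [chord_le_cover] add up without counting a covering set twice. *)
Lemma inscribed_le_hausdorff1 (M : nat) : (0 < M)%N ->
  ((\sum_(j < M) edist (g (T * j%:R / M%:R)) (g (T * j.+1%:R / M%:R)))%:E <= hausdorff1 S)%E.
Proof.
move=> M0; apply/lee_addgt0Pr => eta eta0.
have Mr0 : (0 : R) < M%:R by rewrite ltr0n.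
pose al (j : nat) : R := T * j%:R / M%:R.
pose F (e : R) := \sum_(j < M) edist (g (al j + e)) (g (al j.+1 - e)).
have cF : continuous F.
  apply: continuous_sum_ord => j; apply: continuous_edist => x.
  - apply: (@continuous_comp _ _ _ (fun e => al j + e) g1); last exact: c1.
    by apply: cvgD; [exact: cvg_cst|exact: cvg_id].
  - apply: (@continuous_comp _ _ _ (fun e => al j + e) g2); last exact: c2.
    by apply: cvgD; [exact: cvg_cst|exact: cvg_id].
  - apply: (@continuous_comp _ _ _ (fun e => al j.+1 - e) g1); last exact: c1.
    by apply: cvgB; [exact: cvg_cst|exact: cvg_id].
  - apply: (@continuous_comp _ _ _ (fun e => al j.+1 - e) g2); last exact: c2.
    by apply: cvgB; [exact: cvg_cst|exact: cvg_id].
have [e e0 [eT He]] : exists2 e, 0 < e & e < T / (2 * M%:R) /\ F 0 - eta < F e.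
  have /cvgrPdist_lt /(_ _ eta0) H := cF 0.
  move: H => /nbhs_ballP [d /= d0 Hd].
  set m := Num.min d (T / (2 * M%:R)).
  have m0 : 0 < m by rewrite lt_min d0 divr_gt0// mulr_gt0.
  have md : m <= d by rewrite ge_min lexx.
  have mT : m <= T / (2 * M%:R) by rewrite ge_min lexx orbT.
  exists (m / 2); first by rewrite divr_gt0.
  split; first lra.
  have /Hd /ltr_normlP[_] : ball (0 : R) d (m / 2).
    by rewrite /ball /= sub0r normrN gtr0_norm ?divr_gt0//; lra.
  lra.
have [dlt dlt0 Hdlt] := injective_curve_separation e0.
have E0 : F 0 = \sum_(j < M) edist (g (T * j%:R / M%:R)) (g (T * j.+1%:R / M%:R)).
  by apply: eq_bigr => j _; rewrite subr0 addr0.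
rewrite -E0.
suff : ((F e)%:E <= hausdorff1 S)%E.
  move=> H; apply: (@le_trans _ _ ((F e)%:E + eta%:E)%E); last exact: leeD2r.
  by rewrite -EFinD lee_fin; lra.
apply: (@le_trans _ _ (hausdorff1_delta (dlt / 2) S)); last first.
  by apply: ereal_sup_ubound; exists (dlt / 2) => //=; rewrite divr_gt0.
apply: le_ereal_inf_tmp => _ [U [SU Ud] <-].
pose K (j : nat) := [set z | exists2 t, al j + e <= t <= al j.+1 - e & z = g t].
have alS j : al j.+1 = al j + T / M%:R by rewrite /al -addn1 natrD; field; rewrite gt_eqF.
have eTM : 2 * e < T / M%:R.
  have -> : T / M%:R = 2 * (T / (2 * M%:R)) by field; rewrite gt_eqF.
  by rewrite ltr_pM2l.
have al_mono i j : (i <= j)%N -> al i <= al j.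
  by move=> ij; rewrite /al ler_pM2r ?invr_gt0// ler_pM2l// ler_nat.
have al0 j : 0 <= al j by rewrite /al divr_ge0 ?mulr_ge0 ?(ltW T0) ?(ltW Mr0).
have alT j : (j < M)%N -> al j.+1 <= T.
  by move=> jM; rewrite /al ler_pdivrMr// ler_pM2l// ler_nat.
have sepK i j x y : (i < j)%N -> (j < M)%N -> K i x -> K j y -> dlt <= edist y x.
  move=> ij jM [s /andP[hs1 hs2] ->] [t /andP[ht1 ht2] ->].
  have h1 := al_mono _ _ ij.
  have h2 := alT _ jM; have h3 := alT _ (ltn_trans ij jM).
  have h4 := al0 i; have h5 := al0 j.
  apply: Hdlt; [| |lra]; apply/andP; split; lra.
apply: (@le_trans _ _ (\sum_(j < M) \sum_(0 <= k <oo) ediam (U k `&` K j))%E).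
  rewrite /F -sumEFin; apply: lee_sum => j _.
  apply: chord_le_cover => //; first by have := alS j; lra.
  move=> t ht; have [k _ Uk] := SU _ (gS t); exists k; split => //.
  by exists t.
rewrite -nneseries_sum; last by move=> j k _; exact: ediam_ge0.
apply: lee_nneseries => [k _ _|k _]; first by apply: sume_ge0 => j _; exact: ediam_ge0.
have [[j0 [x0 Ux0]]|none] := pselect (exists j0 : 'I_M, (U k `&` K j0) !=set0).
  rewrite (bigD1 j0)//= big1 => [|j jj0].
    by rewrite adde0; apply: ediam_mono; exact: subIsetl.
  suff -> : U k `&` K j = set0 by exact: ediam_set0.
  rewrite -subset0 => x [Ux Kx].
  have close y z : U k y -> U k z -> edist y z < dlt.
    move=> Uy Uz; have : ((edist y z)%:E <= (dlt / 2)%:E)%E.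
      by apply: le_trans (Ud k); exact: edist_le_ediam.
    by rewrite lee_fin; lra.
  have [lt|gt|e'] := ltngtP j j0.
  - have := sepK _ _ _ _ lt (ltn_ord _) Kx Ux0.2; have := close _ _ Ux0.1 Ux; lra.
  - have := sepK _ _ _ _ gt (ltn_ord _) Ux0.2 Kx; have := close _ _ Ux Ux0.1; lra.
  - by move/eqP: jj0; apply; apply/val_inj.
rewrite big1 ?ediam_ge0// => j _.
suff -> : U k `&` K j = set0 by exact: ediam_set0.
by rewrite -subset0 => x Hx; apply: none; exists j, x.
Qed.

End CurveLength.

(** * Directional widths and the perimeter *)

Section Crofton.
Context {R : realType}.

Definition dot (z : R * R) (t : R) := z.1 * cos t + z.2 * sin t.

Lemma dotB (x y : R * R) t : dot (x.1 - y.1, x.2 - y.2) t = dot x t - dot y t.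
Proof. by rewrite /dot /=; ring. Qed.

Lemma dotDpi z t : dot z (t + pi) = - dot z t.
Proof. by rewrite /dot cosDpi sinDpi; ring. Qed.

(** Discrete form of the fact that |z . t| integrates to 2 |z| over [0, pi]. As |z . t| = |z| |sin
    (c - t)|, each summand on the left is |z| times the increment of cos (c - t) over one part, in
    absolute value, and the variation of this function on [0, pi] is 2. *)
Lemma sum_norm_dot_le (z : R * R) m : (0 < m)%N ->
  2 * sin (pi / m%:R / 2) * (\sum_(j < m) `|dot z (mid_angle m j)|) <=
  2 * Num.sqrt (z.1 ^+ 2 + z.2 ^+ 2).
Proof.
move=> m0; have mr0 : (0 : R) < m%:R by rewrite ltr0n.
set n := Num.sqrt _.
have nE : n ^+ 2 = z.1 ^+ 2 + z.2 ^+ 2 by rewrite sqr_sqrtr// addr_ge0 ?sqr_ge0.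
have [n0|nn0] := eqVneq n 0.
  have : z.1 ^+ 2 + z.2 ^+ 2 = 0 by rewrite -nE n0 expr0n.
  move=> /eqP; rewrite paddr_eq0 ?sqr_ge0// !sqrf_eq0 => /andP[/eqP z1 /eqP z2].
  by rewrite n0 big1 ?mulr0// => j _; rewrite /dot z1 z2 !mul0r addr0 normr0.
have np : 0 < n by rewrite lt_neqAle eq_sym nn0 sqrtr_ge0.
pose d : R := pi / m%:R.
(* Replacing z by its opposite if necessary makes the sine of [c] nonnegative, so that [acos] yields
   the angle orthogonal to z. *)
pose sg : R := if 0 <= z.1 then 1 else -1.
have sg2 : sg ^+ 2 = 1 by rewrite /sg; case: ifP => _; rewrite ?sqrrN expr1n.
have sgn : `|sg| = 1 by rewrite /sg; case: ifP => _; rewrite ?normrN normr1.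
have sgz : sg * z.1 = `|z.1|.
  by rewrite /sg; case: ger0P => _; rewrite ?mul1r ?mulN1r.
pose c := acos (- sg * z.2 / n).
have z2b : -1 <= - sg * z.2 / n <= 1.
  rewrite -ler_norml !normrM normrN sgn mul1r normfV (gtr0_norm np) ler_pdivrMr// mul1r.
  by rewrite -sqrtr_sqr ler_sqrt ?addr_ge0 ?sqr_ge0// lerDr sqr_ge0.
have [c0 cpi] : 0 <= c /\ c <= pi by split; [exact: acos_ge0|exact: acos_lepi].
have cosc : cos c = - sg * z.2 / n by rewrite acosK// in_itv.
have sinc : sin c = sg * z.1 / n.
  rewrite sin_acos// sgz.
  have -> : 1 - (- sg * z.2 / n) ^+ 2 = (z.1 / n) ^+ 2.
    rewrite !exprMn !exprVn sqrrN sg2 mul1r nE.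
    have : z.1 ^+ 2 + z.2 ^+ 2 != 0 by rewrite -nE expf_neq0.
    by move=> ?; field.
  by rewrite sqrtr_sqr normrM normfV (gtr0_norm np).
have dotE t : `|dot z t| = n * `|sin (c - t)|.
  have -> : dot z t = (sg * n) * sin (c - t).
    rewrite /dot sinB sinc cosc.
    have -> : sg * n * (sg * z.1 / n * cos t - - sg * z.2 / n * sin t) =
      sg ^+ 2 * (z.1 * cos t + z.2 * sin t) by field.
    by rewrite sg2 mul1r.
  by rewrite !normrM sgn mul1r (gtr0_norm np).
pose F (a : R) := cos (c - a).
(* [F] rises to its maximum 1 at [c] and then falls; reflecting the falling part gives an increasing
   [G] whose increments bound those of [F]. *)
pose G (a : R) := if a <= c then F a else 2 - F a.
have FG a b : 0 <= a -> a <= b -> b <= pi -> `|F b - F a| <= G b - G a.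
  move=> a0 ab bpi.
  have cosdec (x y : R) : 0 <= x -> x <= y -> y <= pi -> cos y <= cos x.
    move=> x0 xy ypi; have [->//|xny] := eqVneq x y.
    apply/ltW; rewrite ltr_cos ?in_itv /= ?x0 ?ypi ?(le_trans x0 xy) ?(le_trans xy ypi)//.
    by rewrite lt_neqAle xny.
  have Fa : F a <= 1 by exact: cos_le1.
  have Fb : F b <= 1 by exact: cos_le1.
  rewrite /G; have [ac|ca] := leP a c; have [bc|cb] := leP b c.
  - have := cosdec (c - b) (c - a); rewrite -/(F b) -/(F a) => H.
    by rewrite ger0_norm// subr_ge0 H//; lra.
  - by rewrite ler_norml; apply/andP; split; lra.
  - lra.
  - have := cosdec (a - c) (b - c).
    rewrite -(cosN (a - c)) -(cosN (b - c)) !opprB -/(F b) -/(F a) => H.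
    have : F b <= F a by apply: H; lra.
    by move=> ?; rewrite ler0_norm; lra.
pose th (j : nat) : R := d * j%:R.
have thS j : th j.+1 = th j + d by rewrite /th -addn1 natrD; ring.
have d0 : 0 < d by rewrite divr_gt0// pi_gt0.
have sd : 0 < sin (d / 2).
  have dpi : d <= pi by rewrite /d ler_pdivrMr// ler_peMr ?pi_ge0// ler1n.
  by apply: sin_gt0_pi; apply/andP; split; lra.
have thm : th m = pi by rewrite /th /d divfK// gt_eqF.
have step (j : 'I_m) : 2 * sin (d / 2) * `|dot z (mid_angle m j)| <=
    n * (G (th j.+1) - G (th j)).
  rewrite dotE mulrCA ler_pM2l//.
  apply: le_trans (FG _ _ _ _ _); rewrite ?thS ?lerDl ?(ltW d0)//; last 2 first.
  - by rewrite mulr_ge0 ?(ltW d0).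
  - rewrite -thS -thm /th ler_pM2l// ler_nat; exact: ltn_ord.
  have -> : F (th j + d) - F (th j) = 2 * sin (d / 2) * sin (c - mid_angle m j).
    rewrite /F /mid_angle -/d.
    have -> : c - (th j + d) = (c - (j%:R + 2^-1) * d) - d / 2 by rewrite /th; field.
    have -> : c - th j = (c - (j%:R + 2^-1) * d) + d / 2 by rewrite /th; field.
    set y := c - (j%:R + 2^-1) * d.
    by rewrite (cosB y) (cosD y); ring.
  by rewrite normrM gtr0_norm ?mulr_gt0.
rewrite -/d mulr_sumr; apply: (le_trans (ler_sum _ (fun j _ => step j))).
rewrite -mulr_sumr mulrC ler_pM2r//.
have -> : \sum_(j < m) (G (th j.+1) - G (th j)) = G (th m) - G (th 0%N).
  by rewrite -(big_mkord xpredT (fun j => G (th j.+1) - G (th j))) telescope_sumr.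
rewrite thm /th mulr0 /G c0 /F subr0.
have [pc|cp] := leP pi c.
  have -> : c = pi by apply/le_anti; rewrite cpi pc.
  by rewrite subrr cos0 cospi; lra.
have -> : c - pi = - (- c + pi) by ring.
rewrite cosN cosDpi cosN; lra.
Qed.

(** A closed walk through two values joins them twice, along complementary stretches. *)
Lemma closed_walk_total_variation (v : nat -> R) M i k : v 0%N = v M ->
  (i <= M)%N -> (k <= M)%N -> 2 * (v i - v k) <= \sum_(j < M) `|v j.+1 - v j|.
Proof.
move=> v0M.
have seg a b : (a <= b)%N -> `|v b - v a| <= \sum_(a <= j < b) `|v j.+1 - v j|.
  by move=> ab; rewrite -telescope_sumr//; exact: ler_norm_sum.
wlog ik : i k / (i <= k)%N => [H iM kM|iM kM].
  have [ik|ki] := leqP i k; first exact: H.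
  have seg1 := seg _ _ (ltnW ki); have seg0 := seg _ _ (leq0n k); have seg2 := seg _ _ iM.
  rewrite -(big_mkord xpredT (fun j => `|v j.+1 - v j|)).
  rewrite (big_cat_nat (leq0n k) kM)/= (big_cat_nat (ltnW ki) iM)/=.
  move: seg0 seg1 seg2; rewrite !ler_norml => /andP[? ?] /andP[? ?] /andP[? ?]; lra.
have seg1 := seg _ _ ik; have seg0 := seg _ _ (leq0n i); have seg2 := seg _ _ kM.
rewrite -(big_mkord xpredT (fun j => `|v j.+1 - v j|)).
rewrite (big_cat_nat (leq0n i) iM)/= (big_cat_nat ik kM)/=.
move: seg0 seg1 seg2; rewrite !ler_norml => /andP[? ?] /andP[? ?] /andP[? ?]; lra.
Qed.

Lemma is_derive_MVT_lipschitz (f df : R -> R) (K : R) :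
  (forall x : R, is_derive x 1 f (df x)) -> (forall x, `|df x| <= K) ->
  forall a b, `|f b - f a| <= K * `|b - a|.
Proof.
move=> fd dfK.
have cf : continuous f.
  by move=> x; apply/differentiable_continuous/derivable1_diffP; case: (fd x).
have lt a b : a < b -> `|f b - f a| <= K * `|b - a|.
  move=> ab; have [|c _ ->] := @MVT R f df a b ab (fun x _ => fd x).
    exact: continuous_subspaceT.
  by rewrite normrM ler_wpM2r.
move=> a b; have [ab|ba|->] := ltgtP a b; first exact: lt.
  by rewrite distrC (distrC b); exact: lt.
by rewrite !subrr normr0 mulr0.
Qed.

Lemma cos_lipschitz (a b : R) : `|cos b - cos a| <= `|b - a|.
Proof.
rewrite -[leRHS]mul1r; apply: (@is_derive_MVT_lipschitz cos (fun x => - sin x)) => x.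
by rewrite normrN; exact: sin_max.
Qed.

Lemma sin_lipschitz (a b : R) : `|sin b - sin a| <= `|b - a|.
Proof.
rewrite -[leRHS]mul1r; apply: (@is_derive_MVT_lipschitz sin cos) => x.
exact: cos_max.
Qed.

End Crofton.

Section SupportFunction.
Context {R : realType}.
Implicit Types (E : set (R * R)) (x y z O : R * R).

Lemma continuous_dot t : continuous (fun x : R * R => dot x t).
Proof.
move=> x; apply: cvgD; apply: cvgM; try exact: cvg_cst; [exact: cvg_fst|exact: cvg_snd].
Qed.

Definition support E t : R := sup [set dot x t | x in E].

Lemma support_attained E t : compact E -> E !=set0 ->
  (forall x, E x -> dot x t <= support E t) /\ exists2 x, E x & dot x t = support E t.
Proof.
move=> cE E0.
have [c /set_mem Ec cmax] := compact_EVT_max E0 cE (continuous_subspaceT (@continuous_dot t)).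
have cub : ubound [set dot x t | x in E] (dot c t).
  by move=> _ [x Ex <-]; apply: cmax; exact/mem_set.
have -> : support E t = dot c t.
  apply/le_anti/andP; split.
    by apply: ge_sup => //; exists (dot c t), c.
  by apply: ub_le_sup; [exists (dot c t)|exists c].
by split; [move=> x Ex; apply: cub; exists x|exists c].
Qed.

Lemma convex_comb E x y (a b : R) : convex_set E -> 0 <= a -> 0 <= b -> a + b = 1 ->
  E x -> E y -> E (a * x.1 + b * y.1, a * x.2 + b * y.2).
Proof.
move=> cE a0 b0 ab Ex Ey.
have a1 : a <= 1 by lra.
have -> : b = 1 - a by lra.
exact: set_mem (cE x y (Itv01 a0 a1) (mem_set Ex) (mem_set Ey)).
Qed.

Lemma interior_box E O : E° O ->
  exists2 e, 0 < e & forall x, `|x.1 - O.1| < e -> `|x.2 - O.2| < e -> E x.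
Proof.
move=> /nbhs_ballP [e /= e0 He]; exists e => // x h1 h2; apply: He.
by split; rewrite /ball /= distrC.
Qed.

End SupportFunction.

(** * The boundary of a convex body as a closed curve in polar angle *)

Section RadialCurve.
Context {R : realType}.
Variables (E : set (R * R)) (O : R * R) (e : R).
Hypotheses (cE : compact E) (convE : convex_set E) (e0 : 0 < e)
  (box : forall x, `|x.1 - O.1| < e -> `|x.2 - O.2| < e -> E x).

Let clE : closed E. Proof. by apply: compact_closed => //; exact: norm_hausdorff. Qed.

Let ray t s : R * R := (O.1 + s * cos t, O.2 + s * sin t).

Let EO : E O. Proof. by apply: box; rewrite subrr normr0. Qed.

Lemma radial_exists t : exists rho, [/\ 0 < rho, E (ray t rho) & forall s, 0 <= s -> E (ray t s) -> s <= rho].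
Proof.
have ep := e0; have [Hsup _] := support_attained t cE (ex_intro _ O EO).
pose B := support E t - dot O t.
have bd s : E (ray t s) -> s <= B.
  move=> /Hsup; rewrite /B /ray /dot /=.
  have -> : (O.1 + s * cos t) * cos t + (O.2 + s * sin t) * sin t =
    (O.1 * cos t + O.2 * sin t) + s * (cos t ^+ 2 + sin t ^+ 2) by ring.
  by rewrite cos2Dsin2; lra.
have inE s : 0 <= s -> s < e -> E (ray t s).
  move=> s0 se; apply: box; rewrite /ray /= addrAC subrr add0r normrM (ger0_norm s0).
    by apply: le_lt_trans se; rewrite ler_piMr// cos_max.
  by apply: le_lt_trans se; rewrite ler_piMr// sin_max.
pose A := `[0, B]%classic `&` (ray t @^-1` E).
have cA : compact A.
  apply: (@subclosed_compact _ A `[0, B]%classic); last exact: subIsetl.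
    apply: closedI; first exact: itv_closed.
    apply: closed_comp => // s _.
    have lin (a b : R) : a + s * b @[s --> s] --> a + s * b.
      by apply: cvgD; [exact: cvg_cst|apply: cvgM; [exact: cvg_id|exact: cvg_cst]].
    exact: (cvg_pair (lin O.1 (cos t)) (lin O.2 (sin t))).
  exact: segment_compact.
have e2 : E (ray t (e / 2)) by apply: inE; lra.
have A0 : A !=set0.
  by exists (e / 2); split => //; rewrite /= in_itv /= (bd _ e2) andbT; lra.
have [rho /set_mem [hr Er] rmax] := @compact_EVT_max _ _ id A A0 cA (continuous_subspaceT (fun x : R => @cvg_id _ (nbhs x))).
have rmax' s : 0 <= s -> E (ray t s) -> s <= rho.
  move=> s0 Es; apply: rmax; apply/mem_set; split => //.
  by rewrite /= in_itv /= s0 bd.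
exists rho; split => //.
have := rmax' (e / 2); move=> /(_ _ e2); lra.
Qed.

Definition radial : R -> R := projT1 (choice radial_exists).

Lemma radialP t : [/\ 0 < radial t, E (ray t (radial t)) &
  forall s, 0 <= s -> E (ray t s) -> s <= radial t].
Proof. exact: (projT2 (choice radial_exists) t). Qed.

(** The inverse of [radial] is the gauge of E about O on unit vectors, and this is its subadditivity
    for u_b = u_a + (u_b - u_a). The box inside E bounds the gauge of the difference, since sine and
    cosine are 1-Lipschitz. *)
Lemma radial_inv_le a b : (radial b)^-1 <= (radial a)^-1 + 2 / e * `|b - a|.
Proof.
have ep := e0; have [ra Ea _] := radialP a; have [rb _ maxb] := radialP b.
have [->|ab] := eqVneq b a; first by rewrite subrr normr0 mulr0 addr0.
set k := 2 / e * `|b - a|.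
have ba0 : 0 < `|b - a| by rewrite normr_gt0 subr_eq0.
have k0 : 0 < k by rewrite mulr_gt0// divr_gt0.
set l := (radial a)^-1.
have l0 : 0 < l by rewrite invr_gt0.
have ke : `|b - a| / k < e.
  by rewrite /k invfM invf_div mulrCA divff ?gt_eqF// mulr1; lra.
have Ew : E (O.1 + (cos b - cos a) / k, O.2 + (sin b - sin a) / k).
  apply: box; rewrite /= addrAC subrr add0r normrM normfV (gtr0_norm k0);
    apply: le_lt_trans ke; rewrite ler_pM2r ?invr_gt0//.
    exact: cos_lipschitz.
  exact: sin_lipschitz.
have lk : 0 < l + k by rewrite addr_gt0.
have := @convex_comb _ E _ _ (l / (l + k)) (k / (l + k)) convE _ _ _ Ea Ew.
rewrite !divr_ge0 ?(ltW l0) ?(ltW k0) ?(ltW lk)//.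
move=> /(_ isT isT); rewrite -mulrDl divff ?gt_eqF// => /(_ erefl) /=.
have -> : l / (l + k) * (O.1 + radial a * cos a) + k / (l + k) * (O.1 + (cos b - cos a) / k)
   = O.1 + (l + k)^-1 * cos b.
  by rewrite -[radial a]invrK -/l; field; rewrite !gt_eqF.
have -> : l / (l + k) * (O.2 + radial a * sin a) + k / (l + k) * (O.2 + (sin b - sin a) / k)
   = O.2 + (l + k)^-1 * sin b.
  by rewrite -[radial a]invrK -/l; field; rewrite !gt_eqF.
move=> /maxb; rewrite invr_ge0 (ltW lk) => /(_ isT) H.
by rewrite -[leRHS]invrK lef_pV2// posrE invr_gt0.
Qed.

Lemma continuous_radial : continuous radial.
Proof.
have cq : continuous (fun t => (radial t)^-1).
  move=> t; apply/cvgrPdist_lt => eta eta0.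
  apply/nbhs_ballP; exists (eta / (2 / e)) => /=; first by rewrite !divr_gt0.
  move=> s; rewrite /ball /= => hs.
  have K0 : 0 < 2 / e by rewrite divr_gt0.
  have := hs; rewrite ltr_pdivlMr// mulrC => hs'.
  have h1 := radial_inv_le t s; have h2 := radial_inv_le s t.
  by rewrite distrC in h1; apply/ltr_normlP; split; lra.
move=> t; have [rt _ _] := radialP t.
have -> : radial = fun t => ((radial t)^-1)^-1 by apply/funext => s; rewrite invrK.
apply: cvgV; first by rewrite invr_eq0 gt_eqF.
exact: cq.
Qed.

Lemma radial_periodic : radial (2 * pi) = radial 0.
Proof.
have rE s : ray (2 * pi) s = ray 0 s.
  by rewrite /ray mulr_natl cos2pi sin2pi cos0 sin0.
have [r1 E1 m1] := radialP (2 * pi); have [r2 E2 m2] := radialP 0.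
apply/le_anti/andP; split; [apply: m2|apply: m1]; rewrite ?rE ?ltW//.
by rewrite -rE.
Qed.

Definition boundary_curve t := ray t (radial t).

Lemma boundary_curve_boundary t : (closure E `\` E°) (boundary_curve t).
Proof.
have [r0 Er maxr] := radialP t.
split; first exact: subset_closure.
move=> /interior_box [d d0 Hd].
have : E (ray t (radial t + d / 2)).
  have aux (c x : R) : `|c| <= 1 -> `|x + (radial t + d / 2) * c - (x + radial t * c)| < d.
    move=> c1; have -> : x + (radial t + d / 2) * c - (x + radial t * c) = d / 2 * c by ring.
    rewrite normrM gtr0_norm ?divr_gt0//.
    by apply: (@le_lt_trans _ _ (d / 2)); [rewrite ler_piMr// divr_ge0 ?ltW|lra].
  by apply: Hd; apply: aux; [exact: cos_max|exact: sin_max].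
move=> /maxr; have -> : 0 <= radial t + d / 2 by rewrite addr_ge0 ?divr_ge0 ?ltW.
move=> /(_ isT); lra.
Qed.

(** The radius is the distance to O, so both radii agree and then both cosines and sines. This gives
    cos (t - s) = 1, impossible for distinct angles less than 2 pi apart. *)
Lemma boundary_curve_inj s t : 0 < s < 2 * pi -> 0 < t < 2 * pi ->
  (boundary_curve s).1 = (boundary_curve t).1 -> (boundary_curve s).2 = (boundary_curve t).2 -> s = t.
Proof.
move=> /andP[s0 s2] /andP[t0 t2] /= /addrI e1 /addrI e2.
have [rs _ _] := radialP s; have [rt _ _] := radialP t.
have rE : radial s = radial t.
  apply/eqP; rewrite -(@eqrXn2 _ 2) ?ltW//.
  rewrite -[_ ^+ 2]mulr1 -(cos2Dsin2 s) mulrDr -!exprMn e1 e2 !exprMn -mulrDr cos2Dsin2 mulr1.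
  exact: eqxx.
have rn0 : radial s != 0 by rewrite gt_eqF.
have cE' : cos s = cos t by apply: (mulfI rn0); rewrite e1 rE.
have sE' : sin s = sin t by apply: (mulfI rn0); rewrite e2 rE.
wlog st : s t s0 s2 t0 t2 cE' sE' {e1 e2 rs rt rE rn0} / s <= t => [H|].
  by have [st|/ltW ts] := leP s t; [exact: H|apply/esym/H].
apply/eqP; rewrite eq_le st leNgt; apply/negP => lt.
have sin_pos : 0 < sin ((t - s) / 2) by apply: sin_gt0_pi; apply/andP; split; lra.
have : cos (((t - s) / 2) *+ 2) = 1.
  by rewrite -mulr_natr divfK// cosB cE' sE' -!expr2 cos2Dsin2.
rewrite cos_mulr2n cos2sin2; nra.
Qed.

(** Beyond such a point on its ray from O the product with the direction t would exceed the support
    value, so the ray leaves E there. *)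
Lemma support_point_boundary t x : E x -> dot x t = support E t ->
  exists2 b, 0 <= b <= 2 * pi & x = boundary_curve b.
Proof.
move=> Ex xt; have ep := e0.
have [Hsup _] := support_attained t cE (ex_intro _ O EO).
have [b hb [h1 h2]] := polar_coordinates_scaled (x.1 - O.1) (x.2 - O.2).
exists b => //.
set s := Num.sqrt _ in h1 h2.
have s0 : 0 <= s by exact: sqrtr_ge0.
have xE : x = ray b s by rewrite /ray -h1 -h2 !subrKC; case: (x).
have [rb Eb maxb] := radialP b.
have le : s <= radial b by apply: maxb => //; rewrite -xE.
rewrite xE /boundary_curve; congr ray; apply/le_anti; rewrite le /=.
(* direction b has a positive component along t since x lies strictly beyond O *)
have pos : 0 < s * (cos b * cos t + sin b * sin t).
  have : E (ray t (e / 2)).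
    apply: box; rewrite /ray /= addrAC subrr add0r normrM gtr0_norm ?divr_gt0//.
      by apply: (@le_lt_trans _ _ (e / 2)); [rewrite ler_piMr ?cos_max// divr_ge0 ?ltW|lra].
    by apply: (@le_lt_trans _ _ (e / 2)); [rewrite ler_piMr ?sin_max// divr_ge0 ?ltW|lra].
  move=> /Hsup; rewrite -xt xE /ray /dot /=.
  have -> : (O.1 + e / 2 * cos t) * cos t + (O.2 + e / 2 * sin t) * sin t =
     O.1 * cos t + O.2 * sin t + e / 2 * (cos t ^+ 2 + sin t ^+ 2) by ring.
  rewrite cos2Dsin2; nra.
have c0 : 0 < cos b * cos t + sin b * sin t.
  by rewrite ltNge; apply/negP => c0; move: pos; rewrite ltNge mulr_ge0_le0.
have := Hsup _ Eb; rewrite -xt xE /ray /dot /= => H.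
have : radial b * (cos b * cos t + sin b * sin t) <= s * (cos b * cos t + sin b * sin t) by lra.
by rewrite ler_pM2r.
Qed.

End RadialCurve.

(** * Sums of widths against the perimeter *)

Section PerimeterLowerBound.
Context {R : realType}.

Lemma cvg_sum_ord (T : Type) (F : set_system T) (FF : Filter F) n (f : 'I_n -> T -> R) (l : 'I_n -> R) :
  (forall i, f i x @[x --> F] --> l i) -> \sum_(i < n) f i x @[x --> F] --> \sum_(i < n) l i.
Proof.
elim: n f l => [|n IH] f l fl.
  rewrite big_ord0; under eq_fun do rewrite big_ord0; exact: cvg_cst.
rewrite big_ord_recr /=; under eq_fun do rewrite big_ord_recr /=.
by apply: cvgD; [exact: (IH (fun i => f (widen_ord (leqnSn n) i)))|exact: fl].
Qed.

Definition grid_index (b : R) (M : nat) := Num.truncn (b * M%:R / (2 * pi)).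

Lemma grid_index_le b M : 0 <= b <= 2 * pi -> (grid_index b M <= M)%N.
Proof.
move=> /andP[b0 b2]; have p0 : 0 < 2 * pi :> R by rewrite mulr_gt0 ?pi_gt0.
have : 0 <= b * M%:R / (2 * pi) by rewrite divr_ge0 ?(ltW p0)// mulr_ge0.
move=> /truncn_itv /andP[+ _]; rewrite -/(grid_index b M) -(ler_nat R) => /le_trans; apply.
by rewrite ler_pdivrMr// mulrC ler_wpM2l.
Qed.

Lemma cvg_grid b : 0 <= b ->
  2 * pi * (grid_index b M.+1)%:R / M.+1%:R @[M --> \oo] --> b.
Proof.
move=> b0; have p0 : 0 < 2 * pi :> R by rewrite mulr_gt0 ?pi_gt0.
have lo : b - 2 * pi * M.+1%:R^-1 @[M --> \oo] --> b.
  rewrite -[X in _ --> X]subr0 -[X in _ - X](mulr0 (2 * pi)).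
  apply: cvgB; first exact: cvg_cst.
  by apply: cvgM; [exact: cvg_cst|exact: cvg_harmonic].
apply: (squeeze_cvgr _ lo (cvg_cst b)).
near=> M.
have M0 : (0 : R) < M.+1%:R by rewrite ltr0n.
have : 0 <= b * M.+1%:R / (2 * pi) by rewrite divr_ge0 ?(ltW p0)// mulr_ge0.
move=> /truncn_itv /andP[]; rewrite -/(grid_index b M.+1) => h1 h2.
apply/andP; split.
  rewrite ler_pdivlMr// mulrBl divfK ?gt_eqF//.
  by move: h2; rewrite ltr_pdivrMr// -addn1 natrD => /ltW; lra.
by rewrite ler_pdivrMr//; move: h1; rewrite ler_pdivlMr//; lra.
Unshelve. all: by end_near.
Qed.

(** Projected on a direction, a closed inscribed polygon with vertices near both support points has
    variation at least about twice the width. Summing over the m directions and applying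
    [sum_norm_dot_le] edge by edge bounds the width sum by the length of the polygon. With m fixed
    the polygon is refined, and the grid vertices tend to the support points. *)
Lemma perimeter_ge_sum_support (E : set (R * R)) m : convex_body E -> (0 < m)%N ->
  ((2 * sin (pi / m%:R / 2) * \sum_(j < m)
     (support E (mid_angle m j) + support E (mid_angle m j + pi)))%:E <= perimeter E)%E.
Proof.
move=> [cE convE [x0 oint]] m0; have [e e0 box] := interior_box oint.
have p0 : 0 < 2 * pi :> R by rewrite mulr_gt0 ?pi_gt0.
have mr0 : (0 : R) < m%:R by rewrite ltr0n.
pose g := boundary_curve cE e0 box.
have cg1 : continuous (fun t => (g t).1).
  move=> t; apply: cvgD; first exact: cvg_cst.
  by apply: cvgM; [exact: continuous_radial|exact: continuous_cos].
have cg2 : continuous (fun t => (g t).2).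
  move=> t; apply: cvgD; first exact: cvg_cst.
  by apply: cvgM; [exact: continuous_radial|exact: continuous_sin].
have g_closed : g (2 * pi) = g 0.
  by rewrite /g /boundary_curve radial_periodic// mulr_natl cos2pi sin2pi cos0 sin0.
have E0 : E !=set0 by exists x0; exact: interior_subset oint.
have HP M := @inscribed_le_hausdorff1 R (fun t => (g t).1) (fun t => (g t).2) (2 * pi) (closure E `\` E°)
   cg1 cg2 p0 (fun s t hs ht => @boundary_curve_inj _ _ _ _ cE e0 box s t hs ht) (boundary_curve_boundary cE e0 box) M.+1 (ltn0Sn _).
have sup_pt t : exists b : R, 0 <= b <= 2 * pi /\ dot (g b) t = support E t.
  have [_ [x Ex xt]] := support_attained t cE E0.
  have [b hb xE] := support_point_boundary cE e0 box Ex xt.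
  by exists b; split => //; rewrite /g -xE.
have [b Hb] := choice sup_pt.
pose f (j : 'I_m) (t : R) := dot (g t) (mid_angle m j).
have cf j : continuous (f j).
  by move=> t; apply: cvgD; apply: cvgM; try exact: cvg_cst; [exact: cg1|exact: cg2].
pose bp (j : 'I_m) := b (mid_angle m j); pose bm (j : 'I_m) := b (mid_angle m j + pi).
pose al M (t : R) : R := 2 * pi * (grid_index t M.+1)%:R / M.+1%:R.
pose u M : R := 2 * sin (pi / m%:R / 2) * \sum_(j < m) (f j (al M (bp j)) - f j (al M (bm j))).
have s0 : 0 <= 2 * sin (pi / m%:R / 2) :> R.
  rewrite mulr_ge0// sin_ge0_pi// !divr_ge0 ?pi_ge0//=.
  rewrite ler_pdivrMr// ler_pdivrMr//.
  have : (1 : R) <= m%:R by rewrite ler1n.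
  have := pi_ge0 R; nra.
have chords (x y : R * R) : 2 * sin (pi / m%:R / 2) *
    (\sum_(j < m) `|dot x (mid_angle m j) - dot y (mid_angle m j)|) <= 2 * edist x y.
  under eq_bigr => j _ do rewrite -dotB.
  exact: (sum_norm_dot_le (x.1 - y.1, x.2 - y.2) m0).
have uP M : ((u M)%:E <= perimeter E)%E.
  apply: le_trans (HP M); rewrite lee_fin -(ler_pM2l (ltr0n R 2)).
  pose v (j : 'I_m) (k : nat) := f j (2 * pi * k%:R / M.+1%:R).
  have vle j : 2 * (f j (al M (bp j)) - f j (al M (bm j))) <= \sum_(k < M.+1) `|v j k.+1 - v j k|.
    apply: (closed_walk_total_variation (v := v j)).
    - rewrite /v mulr0 mul0r mulfK ?pnatr_eq0// /f g_closed//.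
    - by apply: grid_index_le; case: (Hb (mid_angle m j)).
    - by apply: grid_index_le; case: (Hb (mid_angle m j + pi)).
  rewrite /u mulrCA mulr_sumr.
  apply: (le_trans (ler_wpM2l s0 (ler_sum _ (fun j _ => vle j)))).
  rewrite exchange_big /= mulr_sumr mulr_sumr; apply: ler_sum => k _.
  rewrite edistC.
  exact: (chords (g (2 * pi * k.+1%:R / M.+1%:R)) (g (2 * pi * k%:R / M.+1%:R))).
have ucvg : u M @[M --> \oo] --> 2 * sin (pi / m%:R / 2) * \sum_(j < m)
     (support E (mid_angle m j) + support E (mid_angle m j + pi)).
  apply: cvgM; first exact: cvg_cst.
  apply: cvg_sum_ord => j.
  have [/andP[hp _] fp] := Hb (mid_angle m j); have [/andP[hm _] fm] := Hb (mid_angle m j + pi).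
  have -> : support E (mid_angle m j) + support E (mid_angle m j + pi) = f j (bp j) - f j (bm j).
    by rewrite -fp -fm dotDpi.
  apply: cvgB.
    by apply: (@cvg_comp _ _ _ (al ^~ (bp j)) (f j)); [exact: cvg_grid|exact: cf].
  by apply: (@cvg_comp _ _ _ (al ^~ (bm j)) (f j)); [exact: cvg_grid|exact: cf].
case PE : (perimeter E) uP => [p| |] uP; last 2 first.
- by rewrite leey.
- by have := uP 0%N.
rewrite lee_fin -(cvg_lim (@Rhausdorff R) ucvg).
apply: limr_le; first exact: (cvgP _ ucvg).
by apply: nearW => M; rewrite -lee_fin.
Qed.

End PerimeterLowerBound.

(** * Area below graphs *)

Section PlaneMeasurability.
Context {R : realType}.

(** An open set is the union of the countably many boxes it contains that have a rational centre and
    a radius 1 / (n + 1); boxes belong to the product sigma-algebra. *)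
Lemma open_measurable_plane (U : set (R * R)) : open U -> measurable U.
Proof.
move=> oU.
pose B (q : rat * rat * nat) : set (R * R) :=
  ball (ratr q.1.1 : R) (q.2.+1%:R^-1) `*` ball (ratr q.1.2 : R) (q.2.+1%:R^-1).
pose F q := if `[< B q `<=` U >] then B q else set0.
have mB q : measurable (B q).
  by apply: measurableX; apply: open_measurable; apply: ball_open; rewrite invr_gt0.
have -> : U = \bigcup_q F q.
  apply/seteqP; split => [x Ux|x [q _]]; last first.
    by rewrite /F; case: asboolP => // BU /BU.
  have /nbhs_ballP [e /= e0 He] : nbhs x U by exact: open_nbhs_nbhs.
  have [n [d [dE d0 de]]] : exists (n : nat) (d : R), [/\ d = n.+1%:R^-1, 0 < d & d < e / 2].
    exists (Num.truncn (e / 2)^-1), (Num.truncn (e / 2)^-1).+1%:R^-1; split=> //.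
    by rewrite invf_plt ?posrE ?divr_gt0// truncnS_gt.
  have appr (t : R) : exists q : rat, `|ratr q - t| < d.
    have [|q] := @rat_in_itvoo R (t - d) (t + d); first lra.
    by rewrite in_itv /= => /andP[h1 h2]; exists q; rewrite ltr_norml; apply/andP; split; lra.
  have [q1 h1] := appr x.1; have [q2 h2] := appr x.2.
  exists (q1, q2, n) => //; rewrite /F; case: asboolP => [_|].
    by split; rewrite /ball /= -dE.
  case => y [/ltr_normlP[a1 b1] /ltr_normlP[a2 b2]]; rewrite /= -dE in a1 b1 a2 b2.
  move: h1 h2 => /ltr_normlP[c1 d1] /ltr_normlP[c2 d2].
  by apply: He; split; apply/ltr_normlP; split; lra.
apply: countable_bigcupT_measurable; first exact: countableP.
by move=> q; rewrite /F; case: asboolP.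
Qed.

Lemma closed_measurable_plane (A : set (R * R)) : closed A -> measurable A.
Proof.
by move=> cA; rewrite -(setCK A); apply: measurableC; apply: open_measurable_plane; exact: closed_openC.
Qed.

Lemma compact_measurable_plane (A : set (R * R)) : compact A -> measurable A.
Proof.
by move=> cA; apply: closed_measurable_plane; apply: compact_closed => //; exact: norm_hausdorff.
Qed.

End PlaneMeasurability.

Section IntervalIntegrals.
Context {R : realType}.
Notation leb := (@lebesgue_measure R).
Implicit Types (f G F : R -> R) (a b c : R).

Lemma continuous_integrable f a b : continuous f -> leb.-integrable `[a, b] (EFin \o f).
Proof.
by move=> cf; apply: continuous_compact_integrable; [exact: segment_compact|exact: continuous_subspaceT].
Qed.

Lemma Rintegral_point f a : \int[leb]_(x in `[a, a]) f x = 0.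
Proof. by rewrite set_itv1 /Rintegral integral_set1. Qed.

Lemma Rintegral_primitive f F a b : a <= b -> continuous f ->
  (forall x : R, a <= x <= b -> is_derive x 1 F (f x)) ->
  \int[leb]_(x in `[a, b]) f x = F b - F a.
Proof.
move=> ab cf dF; have [<-|anb] := eqVneq a b; first by rewrite Rintegral_point subrr.
have altb : a < b by rewrite lt_neqAle anb.
have dF' x : a <= x <= b -> derivable F x 1 by move=> /dF[].
have cF x : a <= x <= b -> {for x, continuous F}.
  by move=> /dF' h; apply/differentiable_continuous/derivable1_diffP.
rewrite /Rintegral (continuous_FTC2 altb (F := F)) //.
- exact: continuous_subspaceT.
- split => [x||].
  + by rewrite in_itv /= => /andP[/ltW h1 /ltW h2]; apply: dF'; rewrite h1.
  + by apply: cvg_at_right_filter; apply: cF; rewrite lexx.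
  + by apply: cvg_at_left_filter; apply: cF; rewrite lexx ab.
- move=> x; rewrite in_itv /= => /andP[/ltW h1 /ltW h2].
  by rewrite derive1E; case: (dF x); rewrite ?h1.
Qed.

Lemma Rintegral_affine (p q a b : R) : a <= b ->
  \int[leb]_(x in `[a, b]) (p + q * x) = (b - a) * (p + q * (a + b) / 2).
Proof.
move=> ab.
pose f x := p + q * x; pose F x := p * x + q / 2 * x ^+ 2.
have cf : continuous f.
  move=> x; apply: cvgD; first exact: cvg_cst.
  by apply: cvgM; [exact: cvg_cst|exact: cvg_id].
have dF (x : R) : a <= x <= b -> is_derive x 1 F (f x).
  move=> _.
  have d2 := is_derive_exprn 1 x.
  have -> : F = p \*: id + (q / 2) \*: (fun x : R => x ^+ 2).
    by apply/funext => y; rewrite !fctE /= /GRing.scale /=.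
  by apply: is_derive_eq; rewrite /GRing.scale /= expr1 /f; field.
by rewrite (Rintegral_primitive ab cf dF) /F; field.
Qed.

Lemma le_Rintegral_affine G (p q a b : R) : a <= b -> continuous G ->
  (forall x, a <= x <= b -> G x <= p + q * x) ->
  \int[leb]_(x in `[a, b]) G x <= (b - a) * (p + q * (a + b) / 2).
Proof.
move=> ab cG H; rewrite -Rintegral_affine//; apply: le_Rintegral => //.
- exact: continuous_integrable.
- apply: continuous_integrable => x; apply: cvgD; first exact: cvg_cst.
  by apply: cvgM; [exact: cvg_cst|exact: cvg_id].
Qed.

Lemma Rintegral_cat f a b c : continuous f -> a <= c -> c <= b ->
  \int[leb]_(x in `[a, b]) f x = \int[leb]_(x in `[a, c]) f x + \int[leb]_(x in `[c, b]) f x.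
Proof.
move=> cf ac cb.
have H := @Rintegral_itvB R f (BLeft a) (BRight b) c (continuous_integrable a b cf).
have -> : \int[leb]_(x in `[c, b]) f x = \int[leb]_(x in `]c, b]) f x.
  rewrite Rintegral_itv_obnd_cbnd//.
  apply: (integrableS _ _ _ (continuous_integrable c b cf)) => //.
  by move=> x; rewrite /= !in_itv /= => /andP[/ltW -> ->].
by rewrite -H ?bnd_simp// subrKC.
Qed.

Lemma area_le (E : set (R * R)) (lo hi : R -> R) a b : measurable E -> a <= b ->
  continuous lo -> continuous hi ->
  (forall x y, E (x, y) -> a <= x <= b /\ lo x <= y <= hi x) ->
  (forall x, a <= x <= b -> lo x <= hi x) ->
  (area E <= (\int[leb]_(x in `[a, b]) (hi x - lo x))%:E)%E.
Proof.
move=> mE ab clo chi HE lohi.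
have cd : continuous (fun x => hi x - lo x) by move=> x; apply: cvgB; [exact: chi|exact: clo].
have iE := continuous_integrable a b cd.
rewrite /area /Rintegral fineK; last exact: integrable_fin_num.
have mS : measurable_fun setT (leb \o xsection E) by exact: measurable_fun_xsection.
rewrite /product_measure1 -(setUv `[a, b]%classic) ge0_integral_setU//=; last 3 first.
- exact: measurableC.
- by rewrite setUv.
- exact/disj_setPCl.
rewrite [X in (_ + X)%E]integral0_eq ?adde0 => [|x xab]; last first.
  suff -> : xsection E x = set0 by rewrite measure0.
  rewrite -subset0 => y /xsectionP /HE [h _].
  by apply: xab; rewrite /= in_itv.
apply: ge0_le_integral => //.
- exact: measurable_funTS.
- apply: measurableT_comp => //.
  by apply: measurable_funTS; exact: continuous_measurable_fun.
move=> x xab.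
have {}xab : a <= x <= b by move: xab; rewrite /= in_itv.
have -> : (hi x - lo x)%:E = leb `[lo x, hi x]%classic.
  rewrite lebesgue_measure_itv /= lte_fin.
  by have := lohi _ xab; rewrite le_eqVlt => /orP[/eqP ->|->]; rewrite ?ltxx ?subrr// EFinB.
apply: le_measure; rewrite ?inE//; first exact: measurable_xsection.
by move=> y /xsectionP /HE [_]; rewrite /= in_itv.
Qed.

Lemma area_ge (E : set (R * R)) (lo hi : R -> R) a b : measurable E ->
  continuous lo -> continuous hi ->
  (forall x, a <= x <= b -> lo x <= hi x) ->
  (forall x y, a <= x <= b -> lo x <= y <= hi x -> E (x, y)) ->
  ((\int[leb]_(x in `[a, b]) (hi x - lo x))%:E <= area E)%E.
Proof.
move=> mE clo chi lohi HE.
have cd : continuous (fun x => hi x - lo x) by move=> x; apply: cvgB; [exact: chi|exact: clo].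
have iE := continuous_integrable a b cd.
rewrite /area /Rintegral fineK; last exact: integrable_fin_num.
have mS : measurable_fun setT (leb \o xsection E) by exact: measurable_fun_xsection.
rewrite /product_measure1.
apply: (@le_trans _ _ (\int[leb]_(x in `[a, b]) (leb \o xsection E) x)%E); last first.
  by apply: ge0_subset_integral.
apply: ge0_le_integral => //.
- by move=> x /=; rewrite in_itv /= => xab; rewrite lee_fin subr_ge0 lohi.
- apply: measurableT_comp => //.
  by apply: measurable_funTS; exact: continuous_measurable_fun.
- exact: measurable_funTS.
move=> x xab.
have {}xab : a <= x <= b by move: xab; rewrite /= in_itv.
have -> : (hi x - lo x)%:E = leb `[lo x, hi x]%classic.
  rewrite lebesgue_measure_itv /= lte_fin.
  by have := lohi _ xab; rewrite le_eqVlt => /orP[/eqP ->|->]; rewrite ?ltxx ?subrr// EFinB.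
apply: le_measure; rewrite ?inE//; first exact: measurable_xsection.
by move=> y; rewrite /= in_itv => /HE H; apply/xsectionP; exact: H.
Qed.

End IntervalIntegrals.

(** * A Bonnesen-type inequality *)

Section TangentBound.
Context {R : realType}.
Notation leb := (@lebesgue_measure R).

(** The lower envelope of finitely many tangent lines stands for the upper boundary of the body: it
    lies above it and is continuous by construction. *)
Fixpoint min_upto (L : nat -> R -> R) n (x : R) : R :=
  match n with
  | 0 => L 0%N x
  | n'.+1 => Num.min (min_upto L n' x) (L n x)
  end.

Lemma continuous_min_upto L n : (forall i, continuous (L i)) -> continuous (min_upto L n).
Proof.
move=> cL; elim: n => [|n IH]; first exact: cL.
have -> : min_upto L n.+1 = fun x => (min_upto L n x + L n.+1 x - `|min_upto L n x - L n.+1 x|) / 2.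
  by apply/funext => x /=; rewrite minr_absE.
move=> x; apply: cvgM; last exact: cvg_cst.
apply: cvgB; first by apply: cvgD; [exact: IH|exact: cL].
by apply: cvg_norm; apply: cvgB; [exact: IH|exact: cL].
Qed.

Lemma min_upto_le L n i x : (i <= n)%N -> min_upto L n x <= L i x.
Proof.
elim: n => [|n IH]; first by rewrite leqn0 => /eqP ->.
rewrite leq_eqVlt => /orP[/eqP ->|]; first by rewrite /= ge_min lexx orbT.
by rewrite ltnS => /IH h; rewrite /= ge_min h.
Qed.

Lemma le_min_upto L n x y : (forall i, (i <= n)%N -> y <= L i x) -> y <= min_upto L n x.
Proof.
elim: n => [|n IH] H /=; first exact: H.
rewrite le_min H// andbT; apply: IH => i /leqW; exact: H.
Qed.

Variables (k : R -> R) (b r c phi : R) (m i0 : nat).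
Hypotheses (c0 : 0 <= c) (cr : c <= r) (m0 : (0 < m)%N) (i0m : (i0 <= m)%N)
  (phi0 : 0 < phi < pi).

(* The line of normal angle [t] at support distance [k t], as a graph over the first axis. *)
Definition tangent t x : R := (k t + b * cos t) / sin t + - (cos t / sin t) * x.

Lemma continuous_tangent t : continuous (tangent t).
Proof.
move=> x; apply: cvgD; first exact: cvg_cst.
by apply: cvgM; [exact: cvg_cst|exact: cvg_id].
Qed.

Let d : R := pi / m%:R.
Let th (j : nat) : R := d * j%:R.
Let rho := r - c.

Let d_gt0 : 0 < d. Proof. by rewrite divr_gt0 ?pi_gt0 ?ltr0n. Qed.

Let th_le_pi j : (j <= m)%N -> 0 <= th j <= pi.
Proof.
have mr0 : (0 : R) < m%:R by rewrite ltr0n.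
move=> jm; rewrite mulr_ge0 ?(ltW d_gt0)//= /th /d -mulrA ler_piMr ?pi_ge0//.
by rewrite mulrC ler_pdivrMr// mul1r ler_nat.
Qed.

Let midE j : mid_angle m j = th j + d / 2.
Proof. by rewrite /mid_angle /th -/d; ring. Qed.

Let midSE j : mid_angle m j = th j.+1 - d / 2.
Proof. by rewrite midE /th -addn1 natrD; field. Qed.

Let sin_mid j : (j < m)%N -> 0 < sin (mid_angle m j : R).
Proof.
have dp := d_gt0.
move=> jm; have /andP[h1 h2] := th_le_pi (ltnW jm); have /andP[h3 h4] := th_le_pi jm.
by apply: sin_gt0_pi; apply/andP; split; [rewrite midE|rewrite midSE]; lra.
Qed.

(** Abscissa at angle [th j] of a circle of radius r - c centred over b + s. The shifts c and - c
    push two such arcs to the ends b + r and b - r, which frees a strip of width 2 c between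
    them. *)
Let X s j : R := b + s + rho * cos (th j).

Let diff_cos j : cos (th j) - cos (th j.+1) = 2 * sin (d / 2) * sin (mid_angle m j).
Proof.
have -> : th j = mid_angle m j - d / 2 by rewrite midE addrK.
have -> : th j.+1 = mid_angle m j + d / 2 by rewrite midSE subrK.
by rewrite cosB cosD; ring.
Qed.

Let sum_cos j : cos (th j) + cos (th j.+1) = 2 * cos (d / 2) * cos (mid_angle m j).
Proof.
have -> : th j = mid_angle m j - d / 2 by rewrite midE addrK.
have -> : th j.+1 = mid_angle m j + d / 2 by rewrite midSE subrK.
by rewrite cosB cosD; ring.
Qed.

Let diff_sin j : sin (th j.+1) - sin (th j) = 2 * sin (d / 2) * cos (mid_angle m j).
Proof.
have -> : th j = mid_angle m j - d / 2 by rewrite midE addrK.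
have -> : th j.+1 = mid_angle m j + d / 2 by rewrite midSE subrK.
by rewrite sinB sinD; ring.
Qed.

Let diff_sin2 j : sin (2 * th j.+1) - sin (2 * th j) =
  2 * sin d * (2 * cos (mid_angle m j) ^+ 2 - 1).
Proof.
have -> : 2 * th j = (mid_angle m j) *+ 2 - d by rewrite midE -mulr_natl; field.
have -> : 2 * th j.+1 = (mid_angle m j) *+ 2 + d by rewrite midSE -mulr_natl; field.
rewrite sinB sinD cos_mulr2n -mulr_natl; ring.
Qed.

Let sin_d : sin d = 2 * sin (d / 2) * cos (d / 2).
Proof.
have := sin_mulr2n (d / 2); rewrite -[(d / 2) *+ 2]mulr_natr divfK// => ->.
by rewrite -mulr_natl; ring.
Qed.

(** Discrete form of rho times the integral of k t - s cos t - rho cos^2 t over [th p, th q]. This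
    is the integral of the height of the tangent line of normal angle t, taken above x = b + s + rho
    cos t. *)
Let V p q s := rho * (2 * sin (d / 2)) * (\sum_(p <= j < q) k (mid_angle m j))
  - rho ^+ 2 * ((q%:R - p%:R) * sin d / 2 + (sin (2 * th q) - sin (2 * th p)) / 4)
  - rho * s * (sin (th q) - sin (th p)).

Lemma integral_arc_le (G : R -> R) s p q : continuous G ->
  (forall j x, (j < m)%N -> G x <= tangent (mid_angle m j) x) ->
  (p <= q)%N -> (q <= m)%N ->
  \int[leb]_(x in `[X s q, X s p]) G x <= V p q s.
Proof.
have rho0 : 0 <= rho by rewrite subr_ge0.
have Xle j : (j < m)%N -> X s j.+1 <= X s j.
  move=> jm; rewrite lerD2l ler_wpM2l// -subr_ge0 diff_cos !mulr_ge0 ?(ltW (sin_mid jm))//.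
  apply: sin_ge0_pi; have dp := d_gt0; have /andP[_] := th_le_pi (leqnn m).
  have := th_le_pi (ltn_trans jm (ltnSn _)); have /andP[_] := th_le_pi m0.
  by rewrite /th mulr1 => h _ _; apply/andP; split; lra.
move=> cG HG; elim: q => [|q IH] pq qm.
  move: pq; rewrite leqn0 => /eqP ->; rewrite Rintegral_point /V big_geq// !subrr.
  by rewrite !(mulr0, mul0r, addr0, subr0).
move: pq; rewrite leq_eqVlt => /orP[/eqP <-|pq].
  by rewrite Rintegral_point /V big_geq// !subrr !(mulr0, mul0r, addr0, subr0).
rewrite ltnS in pq.
have Xqp : X s q <= X s p.
  elim: (q) pq (ltnW qm) => [|q' IH'] pq' qm'.
    by move: pq'; rewrite leqn0 => /eqP ->.
  move: pq'; rewrite leq_eqVlt => /orP[/eqP <-//|pq'].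
  by apply: le_trans (Xle _ qm') _; apply: IH'; [|exact: ltnW].
rewrite (Rintegral_cat (c := X s q))//; last exact: Xle.
have sm := sin_mid qm.
have := le_Rintegral_affine (Xle _ qm) cG (fun x _ => HG q x qm).
have -> : X s q - X s q.+1 = rho * (2 * sin (d / 2) * sin (mid_angle m q)).
  by rewrite -diff_cos /X; ring.
have -> : (k (mid_angle m q) + b * cos (mid_angle m q)) / sin (mid_angle m q) +
    - (cos (mid_angle m q) / sin (mid_angle m q)) * (X s q.+1 + X s q) / 2 =
    (k (mid_angle m q) - s * cos (mid_angle m q)
     - rho * cos (d / 2) * cos (mid_angle m q) ^+ 2) / sin (mid_angle m q).
  have -> : X s q.+1 + X s q = 2 * (b + s) + rho * (2 * cos (d / 2) * cos (mid_angle m q)).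
    by rewrite -sum_cos /X; ring.
  by field; rewrite gt_eqF.
move=> piece; have IHq := IH pq (ltnW qm).
have -> : V p q.+1 s = V p q s + rho * (2 * sin (d / 2)) *
    (k (mid_angle m q) - s * cos (mid_angle m q) - rho * cos (d / 2) * cos (mid_angle m q) ^+ 2).
  rewrite /V big_nat_recr//=.
  have -> : sin (th q.+1) = sin (th q) + 2 * sin (d / 2) * cos (mid_angle m q).
    by rewrite -diff_sin; ring.
  have -> : sin (2 * th q.+1) = sin (2 * th q) + 2 * sin d * (2 * cos (mid_angle m q) ^+ 2 - 1).
    by rewrite -diff_sin2; ring.
  by rewrite sin_d -addn1 natrD; field.
rewrite addrC; apply: lerD => //; apply: le_trans piece _.
by rewrite le_eqVlt; apply/orP; left; apply/eqP; field; rewrite gt_eqF.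
Qed.

(** The right arc runs from [th 0] to [th i0], the left one from [th i0] to [th m], and the tangent
    line of angle [phi] bounds G on the strip between them. The shifts of the two arcs contribute -
    2 c rho sin (th i0), which completes the cosine product of the strip to cos (phi - th i0). *)
Lemma integral_upper_le (G : R -> R) : continuous G ->
  (forall j x, (j < m)%N -> G x <= tangent (mid_angle m j) x) ->
  (forall x, G x <= tangent phi x) ->
  \int[leb]_(x in `[b - r, b + r]) G x <=
    rho * (2 * sin (d / 2)) * (\sum_(j < m) k (mid_angle m j)) - rho ^+ 2 * (m%:R * sin d / 2)
    + 2 * c * (k phi - rho * cos (phi - th i0)) / sin phi.
Proof.
have cc0 := c0; have ccr := cr; have dp := d_gt0.
move=> cG HG Hphi.
have sphi : 0 < sin phi by exact: sin_gt0_pi.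
have thm : th m = pi by rewrite /th /d divfK// gt_eqF// ltr0n.
have th0 : th 0 = 0 by rewrite /th mulr0.
have X0 : b + r = X c 0 by rewrite /X th0 cos0 /rho; ring.
have Xm : b - r = X (- c) m by rewrite /X thm cospi /rho; ring.
have Xi : X (- c) i0 <= X c i0 by rewrite /X; lra.
have ci := cos_le1 (th i0); have ci' := cos_geN1 (th i0).
have Xi1 : X c i0 <= X c 0 by rewrite -X0 /X /rho; nra.
have Xi2 : X (- c) m <= X (- c) i0 by rewrite -Xm /X /rho; nra.
rewrite X0 Xm (Rintegral_cat cG (le_trans Xi2 Xi) Xi1) (Rintegral_cat cG Xi2 Xi).
have A1 := integral_arc_le c cG HG (leq0n i0) i0m.
have A2 := integral_arc_le (- c) cG HG i0m (leqnn m).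
have A3 := le_Rintegral_affine Xi cG (fun x _ => Hphi x).
have -> : rho * (2 * sin (d / 2)) * (\sum_(j < m) k (mid_angle m j)) - rho ^+ 2 * (m%:R * sin d / 2)
    + 2 * c * (k phi - rho * cos (phi - th i0)) / sin phi =
    V i0 m (- c) + 2 * c * (k phi - rho * cos (th i0) * cos phi) / sin phi + V 0 i0 c.
  rewrite /V -(big_mkord xpredT (fun j => k (mid_angle m j))) (big_cat_nat (leq0n i0) i0m) /=.
  rewrite thm th0 !mulr0 sin0 sinpi cosB.
  have -> : sin (2 * pi) = 0 :> R by rewrite mulr_natl sin2pi.
  by field; rewrite gt_eqF.
apply: lerD => //; apply: lerD => //; apply: le_trans A3 _.
rewrite le_eqVlt; apply/orP; left; apply/eqP; rewrite /X.
by field; rewrite gt_eqF.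
Qed.

End TangentBound.

(** * From tangent lines to a bound for the area *)

Section Bonnesen.
Context {R : realType}.
Notation leb := (@lebesgue_measure R).
Implicit Types (E : set (R * R)).

Lemma support2pi E t : support E (t + 2 * pi) = support E t.
Proof.
rewrite /support; congr sup; apply: eq_imagel => x _.
by rewrite /dot mulr_natl cosD2pi sinD2pi.
Qed.

Lemma mid_angle_rev m (j : 'I_m) : mid_angle m (rev_ord j) = pi - mid_angle m j :> R.
Proof.
have m0 : (0 : R) < m%:R by rewrite ltr0n; case: (m) j => // -[].
rewrite /mid_angle /= natrB ?ltn_ord// -addn1 natrD; field.
by rewrite gt_eqF.
Qed.

Lemma sum_cos_mid_angle m : \sum_(j < m) cos (mid_angle m j) = 0 :> R.
Proof.
suff : \sum_(j < m) cos (mid_angle m j) = - \sum_(j < m) cos (mid_angle m j) :> R by lra.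
rewrite [LHS](reindex_inj rev_ord_inj) /= -sumrN; apply: eq_bigr => j _.
by rewrite mid_angle_rev addrC cosDpi cosN.
Qed.

Lemma sum_support_reflect E m :
  \sum_(j < m) support E (- mid_angle m j) = \sum_(j < m) support E (mid_angle m j + pi).
Proof.
rewrite [RHS](reindex_inj rev_ord_inj) /=; apply: eq_bigr => j _.
rewrite mid_angle_rev -[LHS]support2pi; congr support; ring.
Qed.

Lemma mid_angle_itv m j : (j < m)%N -> 0 < (mid_angle m j : R) < pi.
Proof.
move=> jm; have m0 : (0 : R) < m%:R by rewrite ltr0n (leq_ltn_trans _ jm).
have j0 : (0 : R) < j%:R + 2^-1 by rewrite ltr_wpDl// invr_gt0.
rewrite /mid_angle mulr_gt0 ?divr_gt0 ?pi_gt0//= mulrCA gtr_pMr ?pi_gt0//.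
rewrite ltr_pdivrMr// mul1r; have : (j.+1%:R : R) <= m%:R by rewrite ler_nat.
by rewrite -addn1 natrD; lra.
Qed.

(** The lower boundary is treated as the upper boundary of the mirror image, whose support function
    is t -> support E (- t). Up to order and full turns, the reflected directions are the
    [mid_angle m j + pi]; the terms in b cancel because the cosines of the midpoints sum to 0. *)
Lemma area_le_support E (b r c phi psi : R) (m i i' : nat) :
  compact E -> convex_set E -> 0 < r ->
  (forall x, E x -> b - r <= x.1 <= b + r) ->
  (exists2 x, E x & x.1 = b - r) -> (exists2 x, E x & x.1 = b + r) ->
  0 <= c -> c <= r -> (0 < m)%N -> (i <= m)%N -> (i' <= m)%N ->
  0 < phi < pi -> 0 < psi < pi ->
  (area E <= ((r - c) * (2 * sin (pi / m%:R / 2) *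
       \sum_(j < m) (support E (mid_angle m j) + support E (mid_angle m j + pi)))
     - (r - c) ^+ 2 * (m%:R * sin (pi / m%:R))
     + 2 * c * (support E phi - b * cos phi - (r - c) * cos (phi - pi / m%:R * i%:R)) / sin phi
     + 2 * c * (support E (- psi) - b * cos psi - (r - c) * cos (psi - pi / m%:R * i'%:R)) / sin psi)%:E)%E.
Proof.
move=> cE convE r0 Eb [xl El xlE] [xr Er xrE] c0 cr m0 im im' hphi hpsi.
have E0 : E !=set0 by exists xl.
pose k1 t := support E t - b * cos t.
pose k2 t := support E (- t) - b * cos t.
(* The last index m of the envelope carries the additional tangent line. *)
pose a (t : R) j := if (j < m)%N then mid_angle m j else t.
have ha t j : 0 < t < pi -> 0 < a t j < pi.
  by rewrite /a; case: ifP => // jm _; exact: mid_angle_itv.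
pose L1 j := tangent k1 b (a phi j); pose L2 j := tangent k2 b (a psi j).
pose G1 := min_upto L1 m; pose G2 := min_upto L2 m.
have cG1 : continuous G1 by apply: continuous_min_upto => j; exact: continuous_tangent.
have cG2 : continuous G2 by apply: continuous_min_upto => j; exact: continuous_tangent.
have le1 x y : E (x, y) -> y <= G1 x.
  move=> Exy; apply: le_min_upto => j _; rewrite /L1 /tangent /k1.
  have [H _] := support_attained (a phi j) cE E0.
  have := H _ Exy; rewrite /dot /= => {}H.
  have s0 := sin_gt0_pi (ha phi j hphi).
  by rewrite subrK mulNr mulrAC -mulrBl ler_pdivlMr//; lra.
have le2 x y : E (x, y) -> - y <= G2 x.
  move=> Exy; apply: le_min_upto => j _; rewrite /L2 /tangent /k2.
  have [H _] := support_attained (- a psi j) cE E0.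
  have := H _ Exy; rewrite /dot /= cosN sinN => {}H.
  have s0 := sin_gt0_pi (ha psi j hpsi).
  by rewrite subrK mulNr mulrAC -mulrBl ler_pdivlMr//; lra.
(* By convexity every vertical line over the horizontal extent meets E, so the lower envelope stays
   below the upper one. *)
have sect x : b - r <= x <= b + r -> exists y, E (x, y).
  move=> /andP[h1 h2].
  exists ((b + r - x) / (2 * r) * xl.2 + (x - (b - r)) / (2 * r) * xr.2).
  have := @convex_comb _ E xl xr ((b + r - x) / (2 * r)) ((x - (b - r)) / (2 * r)) convE.
  rewrite xlE xrE !divr_ge0 ?mulr_ge0 ?(ltW r0) ?subr_ge0// -mulrDl.
  have -> : (b + r - x + (x - (b - r))) / (2 * r) = 1 by field; rewrite gt_eqF.
  move=> /(_ isT isT erefl El Er).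
  have -> // : (b + r - x) / (2 * r) * (b - r) + (x - (b - r)) / (2 * r) * (b + r) = x.
  by field; rewrite gt_eqF.
apply: le_trans (area_le (a := b - r) (b := b + r) (lo := fun x => - G2 x) (hi := G1) (compact_measurable_plane cE) _ _ cG1 _ _) _.
- by lra.
- by move=> x; apply: cvgN; exact: cG2.
- move=> x y Exy; split; first exact: Eb _ Exy.
  by rewrite le1// andbT lerNl le2.
- by move=> x /sect [y Exy]; have := le1 _ _ Exy; have := le2 _ _ Exy; lra.
under eq_Rintegral => x _ do rewrite opprK.
rewrite RintegralD//; try exact: continuous_integrable.
have t1 j x : (j < m)%N -> G1 x <= tangent k1 b (mid_angle m j) x.
  by move=> jm; have := min_upto_le L1 x (ltnW jm); rewrite /L1 /a jm.
have t2 j x : (j < m)%N -> G2 x <= tangent k2 b (mid_angle m j) x.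
  by move=> jm; have := min_upto_le L2 x (ltnW jm); rewrite /L2 /a jm.
have t1' x : G1 x <= tangent k1 b phi x.
  by have := min_upto_le L1 x (leqnn m); rewrite /L1 /a ltnn.
have t2' x : G2 x <= tangent k2 b psi x.
  by have := min_upto_le L2 x (leqnn m); rewrite /L2 /a ltnn.
have I1 := integral_upper_le c0 cr m0 im hphi cG1 t1 t1'.
have I2 := integral_upper_le c0 cr m0 im' hpsi cG2 t2 t2'.
rewrite lee_fin; apply: le_trans (lerD I1 I2) _.
rewrite le_eqVlt; apply/orP; left; apply/eqP.
rewrite /k1 /k2 !sumrB -!mulr_sumr sum_cos_mid_angle sum_support_reflect big_split /=.
have s1 := sin_gt0_pi hphi; have s2 := sin_gt0_pi hpsi.
by field; rewrite !gt_eqF.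
Qed.

Lemma sin_ge_quadratic (x : R) : 0 <= x -> x * (1 - x) <= sin x.
Proof.
move=> x0; have [->|xn0] := eqVneq x 0; first by rewrite mul0r sin0.
have xp : 0 < x by rewrite lt_neqAle eq_sym xn0.
have [|t] := @MVT R sin cos 0 x xp (fun y _ => is_derive_sin y).
  exact: continuous_subspaceT (@continuous_sin R).
rewrite in_itv /= sin0 !subr0 => /andP[t0 tx] ->.
rewrite mulrC ler_wpM2r//.
have := cos_lipschitz 0 t; rewrite cos0 subr0 (gtr0_norm t0) => /ler_normlP[]; lra.
Qed.

Lemma le_of_le_harmonic (x y K : R) : (forall m, (0 < m)%N -> x <= y + K / m%:R) -> x <= y.
Proof.
move=> H; rewrite leNgt; apply/negP => yx.
have d0 : 0 < x - y by rewrite subr_gt0.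
pose m := (Num.truncn (`|K| / (x - y))).+1.
have m0 : (0 : R) < m%:R by rewrite ltr0n.
have := truncnS_gt (`|K| / (x - y)); rewrite -/m ltr_pdivrMr// => h.
have := H m (ltn0Sn _); have : K / m%:R < x - y.
  by rewrite ltr_pdivrMr//; apply: le_lt_trans (ler_norm _) _; rewrite mulrC.
lra.
Qed.

Lemma grid_approx (phi : R) m : (0 < m)%N -> 0 < phi < pi ->
  exists2 i, (i <= m)%N & 1 - pi / m%:R <= cos (phi - pi / m%:R * i%:R).
Proof.
move=> m0 /andP[p0 ppi]; have mr0 : (0 : R) < m%:R by rewrite ltr0n.
have d0 : 0 < pi / m%:R :> R by rewrite divr_gt0// pi_gt0.
have : 0 <= phi / (pi / m%:R) by rewrite divr_ge0 ?ltW.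
move=> /truncn_itv /andP[]; set i := Num.truncn _ => h1 h2.
rewrite ler_pdivlMr// in h1; rewrite ltr_pdivrMr// -addn1 natrD in h2.
exists i.
  rewrite -(ler_nat R) -(ler_pM2r d0); apply: le_trans h1 _.
  by rewrite mulrC divfK ?gt_eqF// ltW.
have := cos_lipschitz 0 (phi - pi / m%:R * i%:R).
have h0 : 0 <= phi - pi / m%:R * i%:R by rewrite mulrC subr_ge0.
rewrite cos0 subr0 (ger0_norm h0) distrC => /ler_normlP[_].
by rewrite [_ * i%:R]mulrC; lra.
Qed.

(** Limit of [area_le_support] as m grows: m sin (pi / m) tends to pi and the grid angles nearest to
    phi and psi tend to them, with errors of order 1 / m. For c = 0 this is the inequality A <= r p
    - pi r^2; the other terms compare E with a disc in the directions phi and - psi. *)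
Lemma bonnesen E (A p b r c phi psi : R) :
  compact E -> convex_set E -> 0 < r ->
  (forall x, E x -> b - r <= x.1 <= b + r) ->
  (exists2 x, E x & x.1 = b - r) -> (exists2 x, E x & x.1 = b + r) ->
  0 <= c -> c <= r -> 0 < phi < pi -> 0 < psi < pi ->
  (A%:E <= area E)%E -> 
  (forall m, (0 < m)%N -> 2 * sin (pi / m%:R / 2) *
       \sum_(j < m) (support E (mid_angle m j) + support E (mid_angle m j + pi)) <= p) ->
  A <= (r - c) * p - pi * (r - c) ^+ 2
     + 2 * c * (support E phi - b * cos phi - (r - c)) / sin phi
     + 2 * c * (support E (- psi) - b * cos psi - (r - c)) / sin psi.
Proof.
move=> cE convE r0 Eb El Er c0 cr hphi hpsi AE Hp.
have s1 := sin_gt0_pi hphi; have s2 := sin_gt0_pi hpsi.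
have rc0 : 0 <= r - c by rewrite subr_ge0.
apply: (@le_of_le_harmonic _ _ (pi * (pi * (r - c) ^+ 2 + 2 * c * (r - c) / sin phi + 2 * c * (r - c) / sin psi))) => m m0.
have mr0 : (0 : R) < m%:R by rewrite ltr0n.
have d0 : 0 < pi / m%:R :> R by rewrite divr_gt0// pi_gt0.
have [i im hi] := grid_approx m0 hphi; have [i' im' hi'] := grid_approx m0 hpsi.
have := le_trans AE (area_le_support cE convE r0 Eb El Er c0 cr m0 im im' hphi hpsi).
rewrite lee_fin => /le_trans; apply.
have h1 := ler_wpM2l rc0 (Hp m m0).
have hs : pi * (1 - pi / m%:R) <= m%:R * sin (pi / m%:R) :> R.
  have := ler_wpM2l (ltW mr0) (sin_ge_quadratic (ltW d0)).
  by rewrite mulrA [m%:R * (_ / _)]mulrC divfK ?gt_eqF.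
have h2 := ler_wpM2l (sqr_ge0 (r - c)) hs.
have tr (k t u : R) : 0 < sin t -> 1 - pi / m%:R <= u ->
    2 * c * (k - (r - c) * u) / sin t <= 2 * c * (k - (r - c)) / sin t + (2 * c * (r - c) / sin t) * (pi / m%:R).
  move=> st hu; rewrite [X in _ <= _ + X]mulrAC -mulrDl ler_pM2r ?invr_gt0//.
  have c2 : 0 <= 2 * c by rewrite mulr_ge0.
  have := ler_wpM2l (mulr_ge0 c2 rc0) hu; lra.
have h3 := tr (support E phi - b * cos phi) phi _ s1 hi.
have h4 := tr (support E (- psi) - b * cos psi) psi _ s2 hi'.
have -> : pi * (pi * (r - c) ^+ 2 + 2 * c * (r - c) / sin phi + 2 * c * (r - c) / sin psi) / m%:R =
   (r - c) ^+ 2 * (pi * (pi / m%:R)) + 2 * c * (r - c) / sin phi * (pi / m%:R) + 2 * c * (r - c) / sin psi * (pi / m%:R).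
  by field; rewrite !gt_eqF.
lra.
Qed.

End Bonnesen.

(** * Discs *)

Section Discs.
Context {R : realType}.
Notation leb := (@lebesgue_measure R).
Implicit Types (c : R * R) (r : R).

Definition disc c r : set (R * R) := [set x | edist x c <= r].

Lemma edist_le_sqr x c r : 0 <= r ->
  (edist x c <= r) = ((x.1 - c.1) ^+ 2 + (x.2 - c.2) ^+ 2 <= r ^+ 2).
Proof. by move=> r0; rewrite -edist_sqr ler_pXn2r// nnegrE edist_ge0. Qed.

Lemma continuous_edist_left c : continuous (fun x => edist x c).
Proof.
move=> x; have := @continuous_edist R (R * R)%type fst snd (fun=> c.1) (fun=> c.2).
move=> /(_ (fun z => @cvg_fst _ _ _ _ _) (fun z => @cvg_snd _ _ _ _ _) (fun z => @cvg_cst _ _ _ _ _) (fun z => @cvg_cst _ _ _ _ _)).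
by under eq_fun do rewrite -surjective_pairing -surjective_pairing; exact.
Qed.

Lemma closed_disc c r : closed (disc c r).
Proof.
apply: (@closed_comp _ _ (fun x => edist x c) [set t | t <= r]); last exact: closed_le.
by move=> x _; exact: continuous_edist_left.
Qed.

Lemma compact_disc c r : 0 <= r -> compact (disc c r).
Proof.
move=> r0; apply: (@subclosed_compact _ _ (`[c.1 - r, c.1 + r]%classic `*` `[c.2 - r, c.2 + r]%classic)).
- exact: closed_disc.
- by apply: compact_setX; exact: segment_compact.
move=> x; rewrite /disc /= edist_le_sqr// => H.
split; rewrite /= in_itv /=.
  have : `|x.1 - c.1| <= r.
    by rewrite -(ler_pXn2r (n := 2)) ?nnegrE// real_normK ?num_real//; have := sqr_ge0 (x.2 - c.2); lra.
  by move=> /ler_normlP[h1 h2]; apply/andP; split; lra.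
have : `|x.2 - c.2| <= r.
  by rewrite -(ler_pXn2r (n := 2)) ?nnegrE// real_normK ?num_real//; have := sqr_ge0 (x.1 - c.1); lra.
by move=> /ler_normlP[h1 h2]; apply/andP; split; lra.
Qed.

Lemma edist_convex x y c (a b : R) : 0 <= a -> 0 <= b -> a + b = 1 ->
  edist (a * x.1 + b * y.1, a * x.2 + b * y.2) c <= a * edist x c + b * edist y c.
Proof.
move=> a0 b0 ab.
rewrite -(ler_pXn2r (n := 2)) ?nnegrE ?edist_ge0 ?addr_ge0 ?mulr_ge0 ?edist_ge0//.
rewrite sqrrD !exprMn !edist_sqr /=.
have /ler_normlP[_] := cauchy_schwarz2 (x.1 - c.1) (x.2 - c.2) (y.1 - c.1) (y.2 - c.2).
rewrite -/(edist x c) -/(edist y c).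
set X := (x.1 - c.1) * (y.1 - c.1) + _ => H.
have -> : (a * x.1 + b * y.1 - c.1) = a * (x.1 - c.1) + b * (y.1 - c.1).
  by rewrite -[c.1 in LHS]mul1r -ab; ring.
have -> : (a * x.2 + b * y.2 - c.2) = a * (x.2 - c.2) + b * (y.2 - c.2).
  by rewrite -[c.2 in LHS]mul1r -ab; ring.
have := ler_wpM2l (mulr_ge0 a0 b0) H; rewrite /X -mulr_natr; lra.
Qed.

Lemma convex_set_intro (E : set (R * R)) :
  (forall x y (a b : R), 0 <= a -> 0 <= b -> a + b = 1 -> E x -> E y ->
     E (a * x.1 + b * y.1, a * x.2 + b * y.2)) -> convex_set E.
Proof.
move=> H x y l /set_mem Ex /set_mem Ey; apply/mem_set.
apply: (H x y l%:num (1 - l%:num)) => //.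
by rewrite subrKC.
Qed.

Lemma convex_disc c r : convex_set (disc c r).
Proof.
apply: convex_set_intro => x y a b a0 b0 ab Ex Ey.
apply: le_trans (edist_convex _ _ _ a0 b0 ab) _.
rewrite -[r in leRHS]mul1r -ab mulrDl; apply: lerD; exact: ler_wpM2l.
Qed.

Lemma interior_disc c r x : edist x c < r -> (disc c r)° x.
Proof.
move=> h; have hn : nbhs (edist x c) [set t | t < r] by exact: lt_nbhsl.
have H : nbhs x [set y | edist y c < r] := continuous_edist_left hn.
by apply: filterS H => y /= /ltW.
Qed.

Lemma convex_body_disc c r : 0 < r -> convex_body (disc c r).
Proof.
move=> r0; split; [exact: compact_disc (ltW r0)|exact: convex_disc|].
by exists c; apply: interior_disc; rewrite edistxx.
Qed.

Definition circle_point c r t : R * R := (c.1 + r * cos t, c.2 + r * sin t).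

Lemma circle_point_edist c r s t : 0 <= r ->
  edist (circle_point c r s) (circle_point c r t) <= r * `|s - t|.
Proof.
move=> r0; rewrite edist_le_sqr ?mulr_ge0//=.
have -> : c.1 + r * cos s - (c.1 + r * cos t) = r * (cos s - cos t) by ring.
have -> : c.2 + r * sin s - (c.2 + r * sin t) = r * (sin s - sin t) by ring.
rewrite !exprMn -mulrDr ler_wpM2l ?sqr_ge0// real_normK ?num_real//.
have -> : (cos s - cos t) ^+ 2 + (sin s - sin t) ^+ 2 = (2 * sin ((s - t) / 2)) ^+ 2.
  have : cos (s - t) = 1 - 2 * sin ((s - t) / 2) ^+ 2.
    have -> : cos (s - t) = cos (((s - t) / 2) *+ 2) by rewrite -mulr_natr divfK.
    by rewrite cos_mulr2n cos2sin2 -mulr_natl; ring.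
  rewrite cosB => h.
  have h1 := cos2Dsin2 s; have h2 := cos2Dsin2 t; nra.
have := sin_lipschitz 0 ((s - t) / 2); rewrite sin0 !subr0 => h.
have n2 : `|2 : R| = 2 by rewrite ger0_norm.
rewrite -[leLHS]real_normK ?num_real// -[leRHS]real_normK ?num_real// ler_pXn2r ?nnegrE//.
rewrite normrM normfV n2 in h; rewrite normrM n2; lra.
Qed.

(** The circle is covered by n arcs of angle 2 pi / n, with n so large that the arc length 2 pi r /
    n, which bounds the diameter, is at most the given scale. *)
Lemma perimeter_disc_le c r : 0 < r -> (perimeter (disc c r) <= (2 * pi * r)%:E)%E.
Proof.
move=> r0; apply: ge_ereal_sup => _ [dl /= dl0 <-].
have tp : 0 < 2 * pi :> R by rewrite mulr_gt0 ?pi_gt0.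
pose n := (Num.truncn (2 * pi * r / dl)).+1.
have nr0 : (0 : R) < n%:R by rewrite ltr0n.
pose d := 2 * pi * r / n%:R.
have d0 : 0 < d by rewrite divr_gt0// mulr_gt0.
have ddl : d <= dl.
  have := truncnS_gt (2 * pi * r / dl); rewrite -/n ltr_pdivrMr// /d ler_pdivrMr// => h.
  by rewrite ltW// [dl * _]mulrC.
pose U k := if (k < n)%N then
   [set circle_point c r t | t in `[2 * pi * k%:R / n%:R, 2 * pi * k.+1%:R / n%:R]%classic] else set0.
have Ud k : (ediam (U k) <= (if (k < n)%N then d else 0)%:E)%E.
  rewrite /U; case: ifP => _; last by rewrite ediam_set0.
  apply: ediam_le; first by rewrite lee_fin ltW.
  move=> _ _ [s hs <-] [t ht <-]; rewrite lee_fin.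
  apply: le_trans (circle_point_edist _ _ _ (ltW r0)) _.
  rewrite /d [_ * r]mulrC -mulrA ler_pM2l//.
  move: hs ht; rewrite /= !in_itv /= => /andP[h1 h2] /andP[h3 h4].
  have E : 2 * pi * k.+1%:R / n%:R = 2 * pi * k%:R / n%:R + 2 * pi / n%:R :> R.
    by rewrite -addn1 natrD; field; rewrite gt_eqF.
  by apply/ler_normlP; split; lra.
apply: (@le_trans _ _ (\sum_(0 <= k <oo) ediam (U k))%E).
  apply: ereal_inf_lbound; exists U => //; split; last first.
    move=> k; apply: le_trans (Ud k) _; rewrite lee_fin; case: ifP => // _; exact: ltW.
  move=> x [clx nintx].
  have Dx : disc c r x by apply: closed_disc.
  have xr : edist x c = r.
    by apply/le_anti; rewrite Dx /= leNgt; apply/negP => /interior_disc.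
  have [t /andP[t0 t2] [h1 h2]] := polar_coordinates_scaled (x.1 - c.1) (x.2 - c.2).
  rewrite -/(edist x c) xr in h1 h2.
  have xE : x = circle_point c r t by rewrite /circle_point -h1 -h2 !subrKC; case: (x).
  (* The angle 2 pi belongs to the last arc; truncation would assign it the index n. *)
  have [tE|tlt] := eqVneq t (2 * pi).
    exists n.-1 => //; rewrite /U ltnSn; exists t => //=.
    rewrite in_itv /= tE ler_pdivrMr// ler_pM2l// ler_nat leqnSn /=.
    by rewrite mulfK ?gt_eqF// lexx.
  have {}t2 : t < 2 * pi by rewrite lt_neqAle tlt.
  have : 0 <= t * n%:R / (2 * pi) by rewrite divr_ge0 ?(ltW tp)// mulr_ge0.
  move=> /truncn_itv /andP[]; set k := Num.truncn _ => k1 k2.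
  rewrite ler_pdivlMr// in k1; rewrite ltr_pdivrMr// in k2.
  have kn : (k < n)%N.
    rewrite -(ltr_nat R) -(ltr_pM2r tp); apply: le_lt_trans k1 _.
    by rewrite mulrC ltr_pM2l.
  exists k => //; rewrite /U kn; exists t => //=.
  rewrite in_itv /= ler_pdivrMr// ler_pdivlMr// [2 * pi * _]mulrC k1 /=.
  by rewrite [2 * pi * _]mulrC ltW.
have part N : (\sum_(0 <= k < N) ediam (U k) <= (2 * pi * r)%:E)%E.
  have H : (\sum_(0 <= k < N) ediam (U k) <= \sum_(0 <= k < N) (if (k < n)%N then d else 0)%:E)%E.
    by apply: lee_sum => k _; exact: Ud.
  apply: le_trans H _; rewrite sumEFin lee_fin.
  apply: (@le_trans _ _ (\sum_(0 <= k < n + N) (if (k < n)%N then d else 0))).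
    rewrite [leRHS](big_cat_nat (leq0n N) (leq_addl n N)) /= lerDl sumr_ge0// => k _.
    by case: ifP => // _; exact: ltW.
  have tail : \sum_(n <= k < n + N) (if (k < n)%N then d else 0) = 0.
    by rewrite big_nat big1// => k /andP[nk _]; rewrite ltnNge nk.
  rewrite (big_cat_nat (leq0n n) (leq_addr N n)) /= tail addr0 big_mkord.
  rewrite (eq_bigr (fun=> d)) => [|k _]; last by rewrite ltn_ord.
  by rewrite sumr_const card_ord -/n -[d *+ n]mulr_natr /d divfK ?gt_eqF.
apply: lime_le; last by apply: nearW => N; exact: part.
by apply: is_cvg_nneseries => k _ _; exact: ediam_ge0.
Qed.

(** The vertical strip of half-width r sin t with t < pi / 2 stays away from the ends of the
    diameter, where the square root and [asin] are not differentiable. Dropping two nonnegative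
    terms of the primitive leaves 2 t r^2, and t tends to pi / 2. *)
Lemma area_disc_ge c r : 0 < r -> ((pi * r ^+ 2)%:E <= area (disc c r))%E.
Proof.
move=> r0.
pose s (x : R) : R := Num.sqrt (r ^+ 2 - (x - c.1) ^+ 2).
have cs : continuous s.
  move=> x; rewrite /s.
  apply: (@continuous_comp _ _ _ (fun x : R => r ^+ 2 - (x - c.1) ^+ 2) Num.sqrt); last exact: sqrt_continuous.
  apply: cvgB; first exact: cvg_cst.
  apply: (@continuous_comp _ _ _ (fun x : R => x - c.1) (fun y : R => y ^+ 2)); last exact: exprn_continuous.
  by apply: cvgB; [exact: cvg_id|exact: cvg_cst].
have step t : 0 < t < pi / 2 -> ((2 * t * r ^+ 2)%:E <= area (disc c r))%E.
  move=> ht; have /andP[t0 tp] := ht; have pi0 := pi_gt0 R.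
  have st0 : 0 < sin t by apply: sin_gt0_pihalf.
  have ct0 : 0 < cos t by apply: cos_gt0_pihalf; apply/andP; split; lra.
  have st1 : sin t < 1.
    by rewrite ltNge; apply/negP => h; have := cos2Dsin2 t; nra.
  pose a := r * sin t.
  have a0 : 0 < a by rewrite mulr_gt0.
  have ar : a < r by rewrite /a gtr_pMr.
  have absa (x : R) : c.1 - a <= x <= c.1 + a -> (x - c.1) ^+ 2 < r ^+ 2.
    by move=> /andP[h1 h2]; nra.
  have sp (x : R) : c.1 - a <= x <= c.1 + a -> 0 < s x.
    by move=> /absa h; rewrite sqrtr_gt0 subr_gt0.
  have sq (x : R) : c.1 - a <= x <= c.1 + a -> s x ^+ 2 = r ^+ 2 - (x - c.1) ^+ 2.
    by move=> /absa h; rewrite sqr_sqrtr// subr_ge0 ltW.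
  pose F (x : R) : R := (x - c.1) * s x + r ^+ 2 * asin ((x - c.1) / r).
  have ab : c.1 - a <= c.1 + a by lra.
  have c2 : continuous (fun x => (c.2 + s x) - (c.2 - s x)).
    move=> x; apply: cvgB; first by apply: cvgD; [exact: cvg_cst|exact: cs].
    by apply: cvgB; [exact: cvg_cst|exact: cs].
  have dF (x : R) : c.1 - a <= x <= c.1 + a -> is_derive x 1 F ((c.2 + s x) - (c.2 - s x)).
    move=> hx; have sx := sp _ hx; have sqx := sq _ hx.
    have d1 : is_derive x 1 (fun x : R => x - c.1) 1.
      have -> : (fun x : R => x - c.1) = id - cst c.1 by apply/funext.
      by apply: is_derive_eq; rewrite subr0.
    have d2 : is_derive x 1 (fun x : R => r ^+ 2 - (x - c.1) ^+ 2) (- (2 * (x - c.1))).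
      have dsq := is_derive_exprn 1 (x - c.1).
      have dc := @is_derive1_comp _ (fun y : R => y ^+ 2) (fun x : R => x - c.1) x _ _ dsq d1.
      have -> : (fun x : R => r ^+ 2 - (x - c.1) ^+ 2) = cst (r ^+ 2) - ((fun y : R => y ^+ 2) \o (fun x : R => x - c.1)) by apply/funext.
      by apply: is_derive_eq; rewrite expr1; ring.
    have ps : 0 < r ^+ 2 - (x - c.1) ^+ 2 by rewrite subr_gt0 absa.
    have d3 := @is_derive1_comp _ Num.sqrt (fun x : R => r ^+ 2 - (x - c.1) ^+ 2) x _ _ (is_derive1_sqrt ps) d2.
    have d4 : is_derive x 1 (fun x : R => (x - c.1) / r) r^-1.
      have -> : (fun x : R => (x - c.1) / r) = r^-1 \*: (fun x : R => x - c.1).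
        by apply/funext => y; rewrite /= /GRing.scale /= mulrC.
      by apply: is_derive_eq; rewrite /GRing.scale /= mulr1.
    have xr : -1 < (x - c.1) / r < 1.
      rewrite ltr_pdivlMr// ltr_pdivrMr//; move: hx => /andP[h1 h2].
      by apply/andP; split; lra.
    have d5 := @is_derive1_comp _ asin (fun x : R => (x - c.1) / r) x _ _ (is_derive1_asin xr) d4.
    have -> : F = (fun x => x - c.1) * (Num.sqrt \o (fun x : R => r ^+ 2 - (x - c.1) ^+ 2)) +
                (r ^+ 2) \*: (asin \o (fun x : R => (x - c.1) / r)).
      by apply/funext.
    have sE : Num.sqrt (1 - ((x - c.1) / r) ^+ 2) = s x / r.
      rewrite -[RHS]ger0_norm ?divr_ge0 ?(ltW sx) ?(ltW r0)// -sqrtr_sqr; congr Num.sqrt.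
      by rewrite !expr_div_n sqx; field; rewrite gt_eqF.
    apply: is_derive_eq; rewrite /GRing.scale /= sE -/(s x).
    have sn0 : s x != 0 by rewrite gt_eqF.
    have rn0 : r != 0 by rewrite gt_eqF.
    have -> : c.2 + s x - (c.2 - s x) = 2 * s x ^+ 2 / s x by field.
    rewrite sqx; have -> : (x - c.1) ^+ 2 = r ^+ 2 - s x ^+ 2 by rewrite sqx; ring.
    have e : (x - c.1) * (x - c.1) = r ^+ 2 - s x ^+ 2 by rewrite sqx; ring.
    have -> : (x - c.1) * ((2 * s x)^-1 * - (2 * (x - c.1))) = - ((x - c.1) * (x - c.1)) / s x by field.
    by rewrite e; field; rewrite sn0 rn0.
  have := area_ge (lo := fun x => c.2 - s x) (hi := fun x => c.2 + s x) (a := c.1 - a) (b := c.1 + a)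
     (closed_measurable_plane (@closed_disc c r)).
  rewrite (Rintegral_primitive ab c2 dF) => H.
  apply: le_trans (H _ _ _ _).
  - rewrite lee_fin /F; have -> : (c.1 + a - c.1) = a by ring.
    have -> : (c.1 - a - c.1) = - a by ring.
    have -> : asin (a / r) = t.
      rewrite /a mulrAC divff ?gt_eqF// mul1r sinK// in_itv /=; apply/andP; split; lra.
    have -> : asin (- a / r) = - t.
      rewrite /a mulNr mulrAC divff ?gt_eqF// mul1r -sinN sinK// in_itv /=; apply/andP; split; lra.
    have := sqrtr_ge0 (r ^+ 2 - (c.1 + a - c.1) ^+ 2); rewrite -/(s _).
    have := sqrtr_ge0 (r ^+ 2 - (c.1 - a - c.1) ^+ 2); rewrite -/(s _).
    move=> h1 h2; nra.
  - by move=> x; apply: cvgB; [exact: cvg_cst|exact: cs].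
  - by move=> x; apply: cvgD; [exact: cvg_cst|exact: cs].
  - by move=> x /sp; lra.
  - move=> x y hx /andP[h1 h2]; rewrite /disc /= edist_le_sqr ?(ltW r0)//=.
    have := sq _ hx; have := sp _ hx => h3 h4; nra.
case E : (area (disc c r)) step => [A| |] step.
- rewrite lee_fin leNgt; apply/negP => AE.
  have p0 := pi_gt0 R; have r20 : 0 < r ^+ 2 by rewrite exprn_gt0.
  have A0 : 0 <= A by rewrite -lee_fin -E /area; exact: measure_ge0.
  pose t := (A / (2 * r ^+ 2) + pi / 2) / 2.
  have A1 : A / (2 * r ^+ 2) < pi / 2.
    by rewrite ltr_pdivrMr ?mulr_gt0//; have -> : pi / 2 * (2 * r ^+ 2) = pi * r ^+ 2 by field.
  have A2 : 0 <= A / (2 * r ^+ 2) by rewrite divr_ge0// mulr_ge0// ltW.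
  have ht : 0 < t < pi / 2 by apply/andP; rewrite /t; split; lra.
  have := step _ ht; rewrite lee_fin.
  have -> : 2 * t * r ^+ 2 = t * (2 * r ^+ 2) by ring.
  rewrite -ler_pdivlMr ?mulr_gt0// /t; lra.
- by rewrite leey.
- have : (0 <= area (disc c r))%E by exact: measure_ge0.
  by rewrite E.
Qed.

End Discs.

(** * Equality in the isoperimetric inequality *)

Section EqualityCase.
Context {R : realType}.
Notation leb := (@lebesgue_measure R).
Implicit Types (E : set (R * R)).

Lemma separation E x : compact E -> convex_set E -> E !=set0 -> ~ E x ->
  exists2 t, 0 <= t <= 2 * pi & support E t < dot x t.
Proof.
move=> cE convE E0 nEx.
have [q /set_mem Eq qmin] := compact_EVT_min E0 cE (continuous_subspaceT (@continuous_edist_left _ x)).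
have [t ht [h1 h2]] := polar_coordinates_scaled (x.1 - q.1) (x.2 - q.2).
rewrite -/(edist x q) edistC in h1 h2; exists t => //.
have [_ [y Ey <-]] := support_attained t cE E0.
set d := edist q x in h1 h2.
have d0 : 0 < d.
  rewrite lt_neqAle edist_ge0 andbT eq_sym; apply/eqP => /edist_eq0 qx.
  by apply: nEx; rewrite -qx.
pose k := (y.1 - q.1) * (x.1 - q.1) + (y.2 - q.2) * (x.2 - q.2).
(* First-order optimality of the nearest point [q] along the segment towards [y]. *)
have k0 : k <= 0.
  rewrite leNgt; apply/negP => kp.
  pose n := edist y q ^+ 2.
  have n0 : 0 <= n by exact: sqr_ge0.
  (* Moving from q to y by the fraction l lowers the squared distance to x by l (2 k - l n). This
     choice gives l <= 1 and l n <= k, so the gain is positive. *)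
  pose l := k / (k + n).
  have kn : 0 < k + n by rewrite ltr_wpDr.
  have l0 : 0 < l by rewrite divr_gt0.
  have l1 : l <= 1 by rewrite ler_pdivrMr// mul1r lerDl.
  have Ez := @convex_comb _ E y q l (1 - l) convE (ltW l0) _ _ Ey Eq.
  rewrite subr_ge0 l1 subrKC in Ez; have {}Ez := Ez isT erefl.
  have := qmin _ (mem_set Ez).
  rewrite -(ler_pXn2r (n := 2)) ?nnegrE ?edist_ge0// !edist_sqr /= leNgt => /negP; apply.
  rewrite -subr_gt0.
  have -> : (q.1 - x.1) ^+ 2 + (q.2 - x.2) ^+ 2 -
     ((l * y.1 + (1 - l) * q.1 - x.1) ^+ 2 + (l * y.2 + (1 - l) * q.2 - x.2) ^+ 2) =
     l * (2 * k - l * n) by rewrite /n edist_sqr /k; ring.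
  rewrite mulr_gt0//.
  have : l * n <= k.
    rewrite /l mulrAC ler_pdivrMr// ler_pM2l//; lra.
  lra.
have E1 : dot x t - dot y t = dot q t - dot y t + d.
  have -> : dot x t = dot q t + d * (cos t ^+ 2 + sin t ^+ 2).
    rewrite /dot; have -> : x.1 = q.1 + d * cos t by lra.
    have -> : x.2 = q.2 + d * sin t by lra.
    by ring.
  by rewrite cos2Dsin2; ring.
have E2 : d * (dot y t - dot q t) = k.
  by rewrite /k h1 h2 /dot; ring.
have : dot y t - dot q t <= 0.
  by rewrite -(ler_pM2l d0) mulr0 E2.
lra.
Qed.

Lemma horizontal_extent E : convex_body E -> exists b r, [/\ 0 < r,
  forall x, E x -> b - r <= x.1 <= b + r,
  exists2 x, E x & x.1 = b - r & exists2 x, E x & x.1 = b + r].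
Proof.
move=> [cE convE [x0 x0int]]; have [e e0 box] := interior_box x0int.
have E0 : E !=set0 by exists x0; exact: interior_subset.
have cf : continuous (fst : R * R -> R) by move=> x; exact: cvg_fst.
have [xl /set_mem El lmin] := compact_EVT_min E0 cE (continuous_subspaceT cf).
have [xr /set_mem Er rmax] := compact_EVT_max E0 cE (continuous_subspaceT cf).
have lr : xl.1 < xr.1.
  have h1 := lmin x0 (mem_set (interior_subset x0int)).
  have : E (x0.1 + e / 2, x0.2).
    apply: box; rewrite /= ?subrr ?normr0//.
    by rewrite addrAC subrr add0r gtr0_norm ?divr_gt0//; lra.
  move=> /mem_set /rmax /=; lra.
exists ((xl.1 + xr.1) / 2), ((xr.1 - xl.1) / 2); split.
- by rewrite divr_gt0// subr_gt0.
- move=> x Ex; have h1 := lmin x (mem_set Ex); have h2 := rmax x (mem_set Ex).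
  by apply/andP; split; lra.
- by exists xl => //; lra.
- by exists xr => //; lra.
Qed.

(* By Cauchy's formula the left-hand side tends to the perimeter of [E] as [m] grows. *)
Definition support_sum_bound E (p : R) := forall m, (0 < m)%N -> 2 * sin (pi / m%:R / 2) *
  \sum_(j < m) (support E (mid_angle m j) + support E (mid_angle m j + pi)) <= p.

Lemma isoperimetric_inequality E (p : R) : convex_body E -> area E = 1%E ->
  support_sum_bound E p -> 0 <= p -> 2 * Num.sqrt pi <= p.
Proof.
move=> bE AE Hp p0; have [cE convE _] := bE.
have [b [r [r0 Eb El Er]]] := horizontal_extent bE.
have pi2 : 0 < (pi / 2 : R) < pi by have p1 := pi_gt0 R; apply/andP; split; lra.
have AE' : ((1 : R)%:E <= area E)%E by rewrite AE.
have := bonnesen cE convE r0 Eb El Er (lexx 0) (ltW r0) pi2 pi2 AE' Hp.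
rewrite subr0 !mulr0 !mul0r !addr0 => H.
have sp : 0 < Num.sqrt pi :> R by rewrite sqrtr_gt0 pi_gt0.
have sq : Num.sqrt pi ^+ 2 = pi :> R by rewrite sqr_sqrtr// pi_ge0.
rewrite -(ler_pXn2r (n := 2)) ?nnegrE ?mulr_ge0 ?(ltW sp)// exprMn sq.
(* Multiplied by 4 pi, the inequality 1 <= r p - pi r^2 reads 4 pi <= p^2 - (p - 2 pi r)^2. *)
have : 0 <= (p - 2 * pi * r) ^+ 2 by exact: sqr_ge0.
have := ler_wpM2l (pi_ge0 R) H; nra.
Qed.

Lemma le_of_forall_small (a K r : R) : 0 < r -> (forall c, 0 < c -> c <= r -> 0 <= a + K * c) -> 0 <= a.
Proof.
move=> r0 H; rewrite leNgt; apply/negP => a0.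
pose c := Num.min r (- a / (2 * (`|K| + 1))).
have K0 : 0 < 2 * (`|K| + 1) by rewrite mulr_gt0// ltr_wpDl.
have c0 : 0 < c by rewrite lt_min r0 divr_gt0// oppr_gt0.
have cr : c <= r by rewrite ge_min lexx.
have cK : c * (2 * (`|K| + 1)) <= - a by rewrite -ler_pdivlMr// ge_min lexx orbT.
have := H c c0 cr; have := ler_norm K; have := normr_ge0 K; nra.
Qed.

Lemma isoperimetric_equality E : convex_body E -> area E = 1%E ->
  support_sum_bound E (2 * Num.sqrt pi) -> exists c r, 0 < r /\ E = disc c r.
Proof.
move=> bE AE Hp; have [cE convE _] := bE.
have [b [r [r0 Eb El Er]]] := horizontal_extent bE.
have p0 := pi_gt0 R.
have pi2 : 0 < (pi / 2 : R) < pi by apply/andP; split; lra.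
have AE' : ((1 : R)%:E <= area E)%E by rewrite AE.
have B := fun c phi psi h1 h2 h3 h4 => @bonnesen _ E 1 (2 * Num.sqrt pi) b r c phi psi cE convE r0 Eb El Er h1 h2 h3 h4 AE' Hp.
have sp : 0 < Num.sqrt pi :> R by rewrite sqrtr_gt0 pi_gt0.
have sq : Num.sqrt pi ^+ 2 = pi :> R by rewrite sqr_sqrtr// pi_ge0.
set s := Num.sqrt pi in sp sq B.
(* For p = 2 s and pi = s^2 the case c = 0 is (s r - 1)^2 <= 0. *)
have sr : s * r = 1.
  have := B 0 (pi / 2) (pi / 2) (lexx 0) (ltW r0) pi2 pi2.
  rewrite subr0 !mulr0 !mul0r !addr0 -sq => H.
  have : (s * r - 1) ^+ 2 <= 0 by nra.
  by rewrite -[X in _ <= X](expr0n R 2) => h; apply/eqP; rewrite -subr_eq0 -sqrf_eq0 eq_le sqr_ge0 andbT (le_trans h)// expr0n.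
have pr1 : pi * r ^+ 2 = 1 by rewrite -sq -exprMn sr expr1n.
(* At c = 0 the inequality is an equality, and its main part 1 - s^2 c^2 has no linear term. What
   remains, divided by 2 c, must be nonnegative as c tends to 0. *)
have key phi psi : 0 < phi < pi -> 0 < psi < pi ->
   0 <= (support E phi - b * cos phi - r) / sin phi + (support E (- psi) - b * cos psi - r) / sin psi.
  move=> hphi hpsi; have s1 := sin_gt0_pi hphi; have s2 := sin_gt0_pi hpsi.
  apply: (@le_of_forall_small _ ((sin phi)^-1 + (sin psi)^-1) r r0) => c c0 cr.
  have := B c phi psi (ltW c0) cr hphi hpsi.
  set x := support E phi - b * cos phi; set y := support E (- psi) - b * cos psi.
  have -> : (r - c) * (2 * s) - pi * (r - c) ^+ 2 = 1 - s ^+ 2 * c ^+ 2.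
    rewrite -sq; have -> : (r - c) * (2 * s) - s ^+ 2 * (r - c) ^+ 2 =
      2 * (s * r) - (s * r) ^+ 2 - 2 * s * c * (1 - s * r) - s ^+ 2 * c ^+ 2 by ring.
    by rewrite sr; ring.
  have -> : 2 * c * (x - (r - c)) / sin phi = (2 * c) * ((x - r) / sin phi + (sin phi)^-1 * c) by ring.
  have -> : 2 * c * (y - (r - c)) / sin psi = (2 * c) * ((y - r) / sin psi + (sin psi)^-1 * c) by ring.
  move=> H; have : 0 <= s ^+ 2 * c ^+ 2 by rewrite -exprMn sqr_ge0.
  move=> H2; rewrite -(pmulr_rge0 _ (mulr_gt0 (ltr0n R 2) c0)); lra.
(* By [key] no element of S exceeds any of the quotients (support E phi - b cos phi - r) / sin phi.
   The supremum of S separates the two families and is the height of the centre of the disc. *)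
pose S := [set - ((support E (- psi) - b * cos psi - r) / sin psi) | psi in [set psi | 0 < psi < pi]].
have S0 : S !=set0 by exists (- ((support E (- (pi / 2)) - b * cos (pi / 2) - r) / sin (pi / 2))), (pi / 2).
have Sub phi : 0 < phi < pi -> ubound S ((support E phi - b * cos phi - r) / sin phi).
  by move=> hphi _ [psi hpsi <-]; have := key _ _ hphi hpsi; lra.
pose c0 := sup S.
have up phi : 0 < phi < pi -> b * cos phi + c0 * sin phi + r <= support E phi.
  move=> hphi; have := sin_gt0_pi hphi => sphi.
  have : c0 <= (support E phi - b * cos phi - r) / sin phi by apply: ge_sup => //; exact: Sub.
  by rewrite ler_pdivlMr//; lra.
have down psi : 0 < psi < pi -> b * cos psi - c0 * sin psi + r <= support E (- psi).
  move=> hpsi; have := sin_gt0_pi hpsi => spsi.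
  have : - ((support E (- psi) - b * cos psi - r) / sin psi) <= c0.
    apply: ub_le_sup; last by exists psi.
    by exists ((support E (pi / 2) - b * cos (pi / 2) - r) / sin (pi / 2)); exact: Sub.
  by rewrite lerNl ler_pdivlMr//; lra.
have E0 : E !=set0 by case: El => x Ex _; exists x.
(* The directions 0 and pi, where the sine vanishes, are covered by the horizontal extent. *)
have all t : 0 <= t <= 2 * pi -> b * cos t + c0 * sin t + r <= support E t.
  move=> /andP[t0 t2].
  have at0 : b * cos 0 + c0 * sin 0 + r <= support E 0.
    have [H _] := support_attained 0 cE E0; case: Er => x Ex xE.
    by have := H _ Ex; rewrite /dot cos0 sin0 xE; lra.
  have [<-//|tn0] := eqVneq 0 t.
  have [tpi|pit|->] := ltgtP t pi.
  - by apply: up; rewrite tpi andbT lt_neqAle tn0.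
  - have [->|tn2] := eqVneq t (2 * pi).
      by rewrite mulr_natl cos2pi sin2pi -[pi *+ 2]add0r -[pi *+ 2]mulr_natl support2pi -[X in _ <= X]/(support E 0); move: at0; rewrite cos0 sin0.
    have := down (2 * pi - t).
    have -> : - (2 * pi - t) = t - 2 * pi by ring.
    rewrite -(support2pi E (t - 2 * pi)) subrK.
    have -> : 2 * pi - t = - t + pi *+ 2 by rewrite -[pi *+ 2]mulr_natl addrC.
    rewrite cosD2pi sinD2pi cosN sinN mulrN opprK; apply.
    have : t < 2 * pi by rewrite lt_neqAle tn2.
    by rewrite -mulr_natl; lra.
  - have [H _] := support_attained pi cE E0; case: El => x Ex xE.
    by have := H _ Ex; rewrite /dot cospi sinpi xE; lra.
pose o := (b, c0).
have DE : disc o r `<=` E.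
  move=> x Dx; apply: contrapT => nEx.
  have [t ht] := separation cE convE E0 nEx; rewrite ltNge => /negP; apply.
  apply: le_trans (all _ ht).
  have /ler_normlP[_] := cauchy_schwarz2 (x.1 - o.1) (x.2 - o.2) (cos t) (sin t).
  rewrite cos2Dsin2 sqrtr1 mulr1 -/(edist x o) /dot /= => h.
  by move: Dx; rewrite /disc /=; lra.
exists o, r; split => //; apply/seteqP; split => // p Ep; apply: contrapT => nDp.
(* A point of [E] outside the disc spans with it a box of positive area disjoint from the disc. *)
have {nDp} rp : r < edist p o by rewrite ltNge; apply/negP.
set dp := edist p o in rp.
(* The homothety of centre p and ratio l maps the disc into E, to the disc of radius l r about q.
   Its distance to o is at least (1 - l) dp - l r = (dp + r) / 2 > r, so it misses the disc; the
   half-side w = l r / 2 keeps the box inside it. *)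
pose l := (dp - r) / (2 * (dp + r)).
have dpr : 0 < 2 * (dp + r) by lra.
have l0 : 0 < l by rewrite divr_gt0// subr_gt0.
have lE : l * (2 * (dp + r)) = dp - r by rewrite divfK// gt_eqF.
have l1 : l < 1 by rewrite ltr_pdivrMr//; lra.
pose q : R * R := (l * o.1 + (1 - l) * p.1, l * o.2 + (1 - l) * p.2).
pose w := l * r / 2.
have w0 : 0 < w by rewrite divr_gt0// mulr_gt0.
pose Q : set (R * R) := `[q.1 - w, q.1 + w]%classic `*` `[q.2 - w, q.2 + w]%classic.
have mQ : measurable Q by apply: measurableX.
have sqb (u v : R) : `|u| <= w -> `|v| <= w -> u ^+ 2 + v ^+ 2 <= (l * r) ^+ 2.
  move=> hu hv; rewrite -(real_normK (num_real u)) -(real_normK (num_real v)).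
  have := normr_ge0 u; have := normr_ge0 v; have : l * r = 2 * w by rewrite /w; field.
  by move=> ->; nra.
have Qnear z : Q z -> edist z q <= l * r.
  case => /=; rewrite !in_itv /= => /andP[h1 h2] /andP[h3 h4].
  rewrite edist_le_sqr; last by rewrite mulr_ge0// ltW.
  by apply: sqb; apply/ler_normlP; rewrite /q /=; split; lra.
have QE : Q `<=` E.
  move=> z /Qnear hz.
  pose y : R * R := (o.1 + (z.1 - q.1) / l, o.2 + (z.2 - q.2) / l).
  have Ey : E y.
    apply: DE; rewrite /disc /= edist_le_sqr ?(ltW r0)//=.
    have -> : b + (z.1 - q.1) / l - b = (z.1 - q.1) / l by ring.
    have -> : c0 + (z.2 - q.2) / l - c0 = (z.2 - q.2) / l by ring.
    have -> : ((z.1 - q.1) / l) ^+ 2 + ((z.2 - q.2) / l) ^+ 2 =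
        ((z.1 - q.1) ^+ 2 + (z.2 - q.2) ^+ 2) / l ^+ 2 by field; rewrite gt_eqF.
    rewrite ler_pdivrMr ?exprn_gt0//.
    have -> : r ^+ 2 * l ^+ 2 = (l * r) ^+ 2 by ring.
    by rewrite -edist_le_sqr// mulr_ge0// ltW.
  have := @convex_comb _ E y p l (1 - l) convE (ltW l0) _ _ Ey Ep.
  rewrite subr_ge0 (ltW l1) subrKC => /(_ isT erefl) /=.
  have -> : l * (b + (z.1 - q.1) / l) + (1 - l) * p.1 = z.1 by rewrite /q /=; field; rewrite gt_eqF.
  have -> : l * (c0 + (z.2 - q.2) / l) + (1 - l) * p.2 = z.2 by rewrite /q /=; field; rewrite gt_eqF.
  by case: (z).
have Qdisj : disc o r `&` Q = set0.
  rewrite -subset0 => z [Dz /Qnear hz].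
  have e1 : dp = edist q o / (1 - l).
    have -> : edist q o = (1 - l) * dp.
      rewrite -[RHS]ger0_norm ?mulr_ge0 ?subr_ge0 ?(ltW l1)//; last by lra.
      rewrite -sqrtr_sqr exprMn edist_sqr /edist /q /=; congr Num.sqrt; ring.
    by rewrite mulrAC mulfV ?mul1r// subr_eq0 gt_eqF.
  have e2 : edist q o = (1 - l) * dp by rewrite e1 mulrC divfK// subr_eq0 gt_eqF.
  have := edist_triangle z q o; rewrite e2 edistC.
  by move: Dz; rewrite /disc /= => Dz; nra.
have mD := closed_measurable_plane (@closed_disc _ o r).
have : (area (disc o r `|` Q) <= area E)%E.
  apply: le_measure; rewrite ?inE; first exact: measurableU.
    exact: compact_measurable_plane.
  by move=> z [/DE|/QE].
rewrite AE /area measureU// => H.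
have := area_disc_ge o r0; rewrite pr1 /area => H1.
have ww (u : R) : ((u + w)%:E + (- (u - w))%:E)%E = (w *+ 2)%:E.
  by rewrite -EFinD mulr2n; congr EFin; lra.
have : ((leb \x leb) Q = (w *+ 2 * (w *+ 2))%:E)%E.
  rewrite /Q product_measure1E; [|exact: measurable_itv|exact: measurable_itv].
  rewrite [X in (X * _)%E]lebesgue_measure_itv [X in (_ * X)%E]lebesgue_measure_itv /= !lte_fin.
  have -> : q.1 - w < q.1 + w by lra.
  have -> : q.2 - w < q.2 + w by lra.
  by rewrite !ww -EFinM.
have {}H : ((leb \x leb)%E (disc o r) + (leb \x leb)%E Q <= 1)%E := H.
move=> HQ; rewrite HQ in H.
have : ((1 + w *+ 2 * (w *+ 2))%:E <= 1)%E by apply: le_trans H; rewrite EFinD leeD2r.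
by rewrite lee_fin gerDl leNgt mulr_gt0// mulrn_wgt0.
Qed.

End EqualityCase.

(** * Logarithmic energy of a convex body *)

Section LogKernel.
Context {R : realType}.

Lemma log_kernelE (x y : R * R) :
  log_kernel x y = if edist x y == 0 then +oo%E else (- ln (edist x y))%:E.
Proof.
rewrite /log_kernel inver; case: ifPn => // d0.
have dp : 0 < edist x y by rewrite lt_neqAle eq_sym d0 edist_ge0.
by rewrite lneV// lne_EFin// EFinN.
Qed.

Lemma measurable_edist :
  measurable_fun setT (fun z : (R * R) * (R * R) => edist z.1 z.2).
Proof.
rewrite /edist; apply: (@measurableT_comp _ _ _ _ _ _ (@Num.sqrt R) _
  (fun z : (R * R) * (R * R) => (z.1.1 - z.2.1) ^+ 2 + (z.1.2 - z.2.2) ^+ 2)).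
  by apply: continuous_measurable_fun; exact: sqrt_continuous.
apply: measurable_funD; apply: measurable_funX; apply: measurable_funB.
- exact: (measurableT_comp measurable_fst measurable_fst).
- exact: (measurableT_comp measurable_fst measurable_snd).
- exact: (measurableT_comp measurable_snd measurable_fst).
- exact: (measurableT_comp measurable_snd measurable_snd).
Qed.

Lemma measurable_log_kernel :
  measurable_fun setT (fun z : (R * R) * (R * R) => log_kernel z.1 z.2).
Proof.
under eq_fun do rewrite log_kernelE.
apply: measurable_fun_ifT => //.
  by apply: measurable_fun_eqr => //; exact: measurable_edist.
apply: measurableT_comp => //; apply: measurableT_comp => //.
by apply: measurableT_comp; [exact: measurable_ln|exact: measurable_edist].
Qed.

End LogKernel.

(** * Integrals of product kernels *)

Section PositiveDefiniteEnergy.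
Context {R : realType} (mu : probability (R * R)%type R) (E : set (R * R)).
Hypotheses (mE : measurable E) (mu1 : mu E = 1%E).

Local Notation M := (mu \x mu)%E.

Lemma prod_probability_finite (A : set ((R * R) * (R * R))) : measurable A -> (M A < +oo)%E.
Proof.
move=> mA; apply: (@le_lt_trans _ _ (M setT)); first by apply: le_measure; rewrite ?inE.
have -> : [set: (R * R) * (R * R)] = setT `*` setT by rewrite setXTT.
have -> : M (setT `*` setT) = (mu setT * mu setT)%E by exact: product_measure1E.
by rewrite probability_setT mule1 ltry.
Qed.

Lemma bounded_integrable d (T : measurableType d) (nu : {measure set T -> \bar R}) (f : T -> R) (A : set T) (B : R) :
  measurable A -> (nu A < +oo)%E -> measurable_fun setT f -> (forall x, A x -> `|f x| <= B) ->
  nu.-integrable A (EFin \o f).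
Proof.
move=> mA fA mf fB; apply: measurable_bounded_integrable => //; first exact: measurable_funTS.
exists B; split; first exact: num_real.
by move=> K BK x Ax; apply: le_trans (fB _ Ax) (ltW BK).
Qed.

Variables (f : R * R -> R) (B : R).
Hypotheses (mf : measurable_fun setT f) (fB : forall x, E x -> `|f x| <= B).

Lemma measurable_tensor : measurable_fun setT (fun z : (R * R) * (R * R) => f z.1 * f z.2).
Proof.
by apply: measurable_funM; apply: measurableT_comp mf _; [exact: measurable_fst|exact: measurable_snd].
Qed.

Lemma integrable_tensor : M.-integrable (E `*` E) (EFin \o (fun z => f z.1 * f z.2)).
Proof.
apply: (@bounded_integrable _ _ M _ _ (B * B)); first exact: measurableX.
- by apply: prod_probability_finite; exact: measurableX.
- exact: measurable_tensor.
- by move=> [x y] [/= Ex Ey]; rewrite normrM ler_pM ?fB.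
Qed.

(** By Fubini this is the square of the integral of f over E. As f is bounded on E only, it is first
    multiplied by the indicator of E. *)
Lemma integral_tensor_ge0 : (0 <= \int[M]_(z in E `*` E) (f z.1 * f z.2)%:E)%E.
Proof.
pose g x := f x * \1_E x.
have mg : measurable_fun setT g by apply: measurable_funM => //; exact: measurable_indic.
have gB x : `|g x| <= `|B|.
  rewrite /g indicE; have [/set_mem Ex|_] := boolP (x \in E).
    by rewrite mulr1; apply: le_trans (fB Ex) (ler_norm _).
  by rewrite mulr0 normr0.
have ig : mu.-integrable setT (EFin \o g).
  apply: (bounded_integrable (B := `|B|)) => //.
  exact: le_lt_trans (probability_le1 _ _) (ltry _).
have igg : M.-integrable setT (fun z => (g z.1 * g z.2)%:E).
  apply: (@bounded_integrable _ _ M (fun z => g z.1 * g z.2) _ (`|B| * `|B|)) => //.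
  - exact: prod_probability_finite.
  - by apply: measurable_funM; apply: measurableT_comp mg _; [exact: measurable_fst|exact: measurable_snd].
  - by move=> z _; rewrite normrM ler_pM.
have -> : (\int[M]_(z in E `*` E) (f z.1 * f z.2)%:E = \int[M]_z (g z.1 * g z.2)%:E)%E.
  rewrite integral_mkcond; apply: eq_integral => -[x y] _; rewrite patchE /g !indicE /=.
  have -> : ((x, y) \in E `*` E) = (x \in E) && (y \in E).
    by apply/idP/andP => [/set_mem[/= ? ?]|[/set_mem ? /set_mem ?]]; [split; exact/mem_set|exact/mem_set].
  by case: (x \in E); case: (y \in E); rewrite ?mulr1 ?mulr0 ?mul0r.
rewrite -(integral12_prod_meas1 igg) /fubini_F /=.
pose G := fine (\int[mu]_y (g y)%:E)%E.
have GE : (\int[mu]_y (g y)%:E)%E = G%:E by rewrite fineK//; exact: integrable_fin_num ig.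
have -> : (\int[mu]_x \int[mu]_y (g x * g y)%:E = \int[mu]_x (G%:E * (g x)%:E))%E.
  apply: eq_integral => x _.
  under eq_integral do rewrite EFinM.
  by rewrite integralZl//= GE muleC.
by rewrite integralZl// GE -EFinM lee_fin -expr2 sqr_ge0.
Qed.

End PositiveDefiniteEnergy.

Section EnergyLowerBound.
Context {R : realType} (mu : probability (R * R)%type R) (E : set (R * R)).
Local Notation M := (mu \x mu)%E.

(** The finite kernel integrates to at least C, since its product terms have nonnegative energy. The
    logarithmic kernel may have infinite energy, so positive and negative parts are compared
    separately. *)
Lemma log_energy_ge (I : finType) (C B : R) (c : I -> R) (f : I -> R * R -> R) :
  measurable E -> mu E = 1%E ->
  (forall i, 0 <= c i) -> (forall i, measurable_fun setT (f i)) ->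
  (forall i x, E x -> `|f i x| <= B) ->
  (forall x y, E x -> E y -> ((C + \sum_i c i * (f i x * f i y))%:E <= log_kernel x y)%E) ->
  (C%:E <= log_energy E mu)%E.
Proof.
move=> mE mu1 c0 mf fB Hk.
have mEE : measurable (E `*` E) by exact: measurableX.
have MEE : M (E `*` E) = 1%E by rewrite product_measure1E// -[RHS]mule1; congr (_ * _)%E.
have it i : M.-integrable (E `*` E) (fun z => (f i z.1 * f i z.2)%:E).
  exact: (integrable_tensor mu mE (mf i) (fB i)).
pose h i (z : (R * R) * (R * R)) := ((c i)%:E * (f i z.1 * f i z.2)%:E)%E.
have ih i : M.-integrable (E `*` E) (h i) by apply: integrableZl.
pose K z := (cst C%:E z + \sum_i h i z)%E.
have iC : M.-integrable (E `*` E) (cst C%:E).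
  apply: (@bounded_integrable _ _ _ M (cst C) _ `|C|) => //.
  exact: prod_probability_finite.
have iS : M.-integrable (E `*` E) (fun z => \sum_i h i z)%E.
  by apply: integrable_sum.
have iK : M.-integrable (E `*` E) K by apply: integrableD.
have KE z : K z = (C + \sum_i c i * (f i z.1 * f i z.2))%:E.
  by rewrite /K EFinD -sumEFin; congr (_ + _)%E; apply: eq_bigr => i _; rewrite EFinM.
have IK : (C%:E <= \int[M]_(z in E `*` E) K z)%E.
  have IC : (\int[M]_(z in E `*` E) (cst C%:E) z)%E = C%:E.
    by transitivity (C%:E * M (E `*` E))%E; [exact: integral_cst|rewrite MEE mule1].
  rewrite integralD// IC leeDl//.
  rewrite integral_sum//; apply: sume_ge0 => i _.
  rewrite integralZl//; apply: mule_ge0; first by rewrite lee_fin.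
  exact: (integral_tensor_ge0 mu mE (mf i) (fB i)).
apply: (le_trans IK); rewrite /log_energy integralE [leRHS]integralE.
have mk := measurable_funTS (D := E `*` E) (@measurable_log_kernel R).
have mK : measurable_fun (E `*` E) K by case/integrableP : iK.
have Kle : {in E `*` E, forall z, (K z <= log_kernel z.1 z.2)%E}.
  by move=> z /set_mem [? ?]; rewrite KE; exact: Hk.
apply: leeB.
- apply: ge0_le_integral => //; try exact: measurable_funepos.
  by move=> z Ez; apply: (funepos_le Kle); exact/mem_set.
- apply: ge0_le_integral => //; try exact: measurable_funeneg.
  by move=> z Ez; apply: (funeneg_le Kle); exact/mem_set.
Qed.

End EnergyLowerBound.

(** * Energy bound through the widths *)

Section EnergyOfConvexBody.
Context {R : realType}.
Implicit Types (E : set (R * R)).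

Definition width E t : R := support E t + support E (t + pi).

Lemma width_lower_bound E : convex_body E -> exists2 w, 0 < w & forall t, w <= width E t.
Proof.
move=> [cE _ [z zint]]; have [e e0 box] := interior_box zint.
have Ez : E z by exact: interior_subset.
exists (e / 2); first by rewrite divr_gt0.
move=> t; have [H _] := support_attained t cE (ex_intro _ z Ez).
have [H' _] := support_attained (t + pi) cE (ex_intro _ z Ez).
have := H' z Ez; rewrite dotDpi /width.
have sm (u : R) : `|u| <= 1 -> `|e / 2 * u| < e.
  move=> u1; rewrite normrM gtr0_norm ?divr_gt0//.
  have : e / 2 * `|u| <= e / 2 * 1 by rewrite ler_wpM2l// ltW// divr_gt0.
  by lra.
have := H (z.1 + e / 2 * cos t, z.2 + e / 2 * sin t).
have -> : dot (z.1 + e / 2 * cos t, z.2 + e / 2 * sin t) t =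
   dot z t + e / 2 * (cos t ^+ 2 + sin t ^+ 2) by rewrite /dot /=; ring.
rewrite cos2Dsin2 mulr1 => h1 h2.
have h3 : E (z.1 + e / 2 * cos t, z.2 + e / 2 * sin t).
  by apply: box; rewrite /= addrAC subrr add0r; apply: sm; [exact: cos_max|exact: sin_max].
have := h1 h3; lra.
Qed.

Lemma compact_edist_bounded E : compact E -> exists2 D, 0 < D &
  forall x y, E x -> E y -> edist x y <= D.
Proof.
move=> cE; have [E0|/nonemptyPn E0] := pselect (E !=set0); last first.
  by exists 1 => // x y; rewrite E0.
case: (E0) => z Ez.
have [q /set_mem Eq qmax] := compact_EVT_max E0 cE (continuous_subspaceT (@continuous_edist_left _ z)).
exists (edist q z + edist q z + 1); first by rewrite ltr_wpDl// addr_ge0// edist_ge0.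
move=> x y Ex Ey; have := edist_triangle z x y; rewrite [edist z y]edistC.
have := qmax x (mem_set Ex); have := qmax y (mem_set Ey); lra.
Qed.

(** Widths are at most the diameter bound D, and 2 m sin (pi / (2 m)) <= pi. This keeps the energy
    away from -oo when the perimeter is infinite. *)
Lemma support_sum_bound_exists E : convex_body E -> exists p, support_sum_bound E p.
Proof.
move=> [cE _ [z zint]]; have Ez : E z by exact: interior_subset.
have [D D0 HD] := compact_edist_bounded cE.
exists (pi * D) => m m0; have mr0 : (0 : R) < m%:R by rewrite ltr0n.
have wD t : support E t + support E (t + pi) <= D.
  have [_ [x Ex <-]] := support_attained t cE (ex_intro _ z Ez).
  have [_ [y Ey <-]] := support_attained (t + pi) cE (ex_intro _ z Ez).
  rewrite dotDpi -dotB /dot /=.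
  have /ler_normlP[_] := cauchy_schwarz2 (x.1 - y.1) (x.2 - y.2) (cos t) (sin t).
  rewrite cos2Dsin2 sqrtr1 mulr1 -/(edist x y) => h.
  exact: le_trans h (HD _ _ Ex Ey).
have d0 : 0 < pi / m%:R / 2 :> R by rewrite !divr_gt0// pi_gt0.
have s1 : sin (pi / m%:R / 2) <= pi / m%:R / 2 :> R.
  have := sin_lipschitz (0 : R) (pi / m%:R / 2).
  by rewrite (sin0 R) !subr0 (gtr0_norm d0) => /ler_normlP[].
have s0 : 0 <= sin (pi / m%:R / 2) :> R.
  apply: sin_ge0_pi; rewrite ltW//= ler_pdivrMr// ler_pdivrMr//.
  rewrite -mulrA ler_peMr ?pi_ge0//.
  have : (1 : R) <= m%:R by rewrite ler1n.
  lra.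
apply: le_trans (_ : 2 * sin (pi / m%:R / 2) * (m%:R * D) <= _).
  rewrite ler_wpM2l ?mulr_ge0//.
  have -> : m%:R * D = \sum_(j < m) D by rewrite sumr_const card_ord mulr_natl.
  exact: ler_sum.
have -> : pi * D = 2 * (pi / m%:R / 2) * (m%:R * D) by field; rewrite gt_eqF.
by rewrite ler_wpM2r ?mulr_ge0 ?ler0n ?(ltW D0)// ler_wpM2l.
Qed.

Lemma mean_le_affine m (c : R) (f g h : 'I_m -> R) : (0 < m)%N -> (forall j, f j <= c + g j - h j) ->
  m%:R^-1 * \sum_(j < m) f j <= c + m%:R^-1 * \sum_(j < m) g j - m%:R^-1 * \sum_(j < m) h j.
Proof.
move=> m0 H; have mr0 : (0 : R) < m%:R by rewrite ltr0n.
apply: le_trans (_ : m%:R^-1 * \sum_(j < m) (c + g j - h j) <= _).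
  by rewrite ler_pM2l ?invr_gt0//; apply: ler_sum.
rewrite sumrB big_split /= sumr_const card_ord -[c *+ m]mulr_natl !(mulrBr, mulrDr).
by rewrite mulrA mulVf ?mul1r// gt_eqF.
Qed.

Section KernelBound.
Variables (E : set (R * R)) (D w0 r rho : R).
Hypotheses (cE : compact E) (E0 : E !=set0)
  (HD : forall x y, E x -> E y -> edist x y <= D)
  (w0p : 0 < w0) (Hw : forall t, w0 <= width E t)
  (hr : 0 < r < 1) (hrho : 0 <= rho < 1)
  (hrD : (1 - rho) * D <= (1 - r) ^+ 2 / (2 * r) * w0).

(** The affine coordinate in which the projection of E on the direction t becomes [-1, 1]. *)
Definition slab t x : R := 2 * (dot x t - (support E t - support E (t + pi)) / 2) / width E t.

Lemma width_gt0 t : 0 < width E t. Proof. exact: lt_le_trans w0p (Hw t). Qed.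

Lemma slab_itv t x : E x -> -1 <= slab t x <= 1.
Proof.
move=> Ex; have wp := width_gt0 t.
have [H _] := support_attained t cE E0; have [H' _] := support_attained (t + pi) cE E0.
have := H _ Ex; have := H' _ Ex; rewrite dotDpi /slab => h1 h2.
rewrite ler_pdivlMr// ler_pdivrMr//; rewrite /width in wp *.
by apply/andP; split; lra.
Qed.

Lemma slabB t x y : dot x t - dot y t = width E t / 2 * (slab t x - slab t y).
Proof. by have wp := width_gt0 t; rewrite /slab; field; rewrite gt_eqF. Qed.

(** [ln_norm_le] averages over directions, and [reg_log_le] is applied in each direction to the
    coordinates [slab]. The double sum is a finite combination of products, as [log_energy_ge]
    requires. *)
Lemma log_edist_le m N x y : (0 < m)%N -> E x -> E y -> edist x y != 0 ->
  ln (edist x y) <= log_error rho m.-1 - ln (2 * r) + 2 * log_error r N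
    + m%:R^-1 * \sum_(j < m) ln (width E (mid_angle m j))
    - \sum_(i : 'I_m * 'I_N) (2 * r ^+ i.2.+1 / i.2.+1%:R / m%:R) *
        (chebyshev i.2.+1 (slab (mid_angle m i.1) x) * chebyshev i.2.+1 (slab (mid_angle m i.1) y)).
Proof.
move=> m0 Ex Ey d0; have mr0 : (0 : R) < m%:R by rewrite ltr0n.
have dp : 0 < edist x y by rewrite lt_neqAle eq_sym d0 edist_ge0.
have n2 := edist_sqr x y.
have np : 0 < (x.1 - y.1) ^+ 2 + (x.2 - y.2) ^+ 2 by rewrite -n2 exprn_gt0.
have -> : ln (edist x y) = ln ((x.1 - y.1) ^+ 2 + (x.2 - y.2) ^+ 2) / 2.
  by rewrite -n2 lnXn// -[_ *+ 2]mulr_natr mulfK.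
apply: le_trans (ln_norm_le m0 hrho np) _.
have hrD' := hrD; set eps := (1 - r) ^+ 2 / (2 * r) in hrD'.
have /andP[rho0 rho1] := hrho; have /andP[r0 r1] := hr.
have rp : 0 < 1 - rho by rewrite subr_gt0.
have term (j : 'I_m) :
  ln ((1 - rho) ^+ 2 * ((x.1 - y.1) ^+ 2 + (x.2 - y.2) ^+ 2) +
    4 * rho * ((x.1 - y.1) * cos (mid_angle m j) + (x.2 - y.2) * sin (mid_angle m j)) ^+ 2) / 2
  <= (- ln (2 * r) + 2 * log_error r N) + ln (width E (mid_angle m j)) -
     \sum_(k < N) (2 * r ^+ k.+1 / k.+1%:R) *
        (chebyshev k.+1 (slab (mid_angle m j) x) * chebyshev k.+1 (slab (mid_angle m j) y)).
  set t := mid_angle m j; have wp := width_gt0 t.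
  have := reg_log_le N hr (slab_itv t Ex) (slab_itv t Ey); rewrite -/eps.
  set s := slab t x; set u := slab t y; move=> H.
  have dE : (x.1 - y.1) * cos t + (x.2 - y.2) * sin t = width E t / 2 * (s - u).
    by rewrite -slabB -dotB.
  rewrite dE -n2.
  have e0 : 0 < eps by rewrite divr_gt0 ?exprn_gt0 ?subr_gt0// mulr_gt0.
  set w := width E t in wp dE *.
  (* The factor 4 cancels the halved width, rho is bounded by 1, and [hrD] with the diameter bound
     absorbs the first summand into [eps]. *)
  have A : (1 - rho) ^+ 2 * edist x y ^+ 2 + 4 * rho * (w / 2 * (s - u)) ^+ 2 <=
     w ^+ 2 * ((s - u) ^+ 2 + eps ^+ 2).
    have -> : 4 * rho * (w / 2 * (s - u)) ^+ 2 = rho * (w * (s - u)) ^+ 2 by field.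
    have a1 : (1 - rho) * edist x y <= eps * w.
      apply: le_trans (ler_wpM2l (ltW rp) (HD Ex Ey)) (le_trans hrD' _).
      by rewrite ler_wpM2l ?Hw// ltW.
    have a2 : ((1 - rho) * edist x y) ^+ 2 <= (eps * w) ^+ 2.
      by rewrite ler_pXn2r ?nnegrE// mulr_ge0 ?edist_ge0// ltW.
    have a3 : rho * (w * (s - u)) ^+ 2 <= (w * (s - u)) ^+ 2 by rewrite ler_piMl ?sqr_ge0// ltW.
    rewrite !exprMn in a2 a3 *; lra.
  have P1 : 0 < (1 - rho) ^+ 2 * edist x y ^+ 2 + 4 * rho * (w / 2 * (s - u)) ^+ 2.
    by rewrite ltr_wpDr ?mulr_gt0 ?exprn_gt0// mulr_ge0 ?sqr_ge0// mulr_ge0.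
  have P2 : 0 < (s - u) ^+ 2 + eps ^+ 2 by rewrite ltr_wpDl ?sqr_ge0// exprn_gt0.
  have wp2 : 0 < w ^+ 2 by rewrite exprn_gt0.
  have : ln ((1 - rho) ^+ 2 * edist x y ^+ 2 + 4 * rho * (w / 2 * (s - u)) ^+ 2) <=
         ln (w ^+ 2) + ln ((s - u) ^+ 2 + eps ^+ 2).
    by rewrite -lnM// ler_ln// ?posrE ?mulr_gt0//.
  rewrite lnXn// -mulr_natr; lra.
pose G (j : 'I_m) (k : 'I_N) := (2 * r ^+ k.+1 / k.+1%:R) *
  (chebyshev k.+1 (slab (mid_angle m j) x) * chebyshev k.+1 (slab (mid_angle m j) y)).
have -> : \sum_(i : 'I_m * 'I_N) 2 * r ^+ i.2.+1 / i.2.+1%:R / m%:R *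
    (chebyshev i.2.+1 (slab (mid_angle m i.1) x) * chebyshev i.2.+1 (slab (mid_angle m i.1) y)) =
  m%:R^-1 * \sum_(j < m) \sum_(k < N) G j k.
  transitivity (\sum_(j < m) \sum_(k < N) m%:R^-1 * G j k).
    rewrite (pair_bigA _ (fun j k => m%:R^-1 * G j k)).
    by apply: eq_bigr => -[j k] _; rewrite /G; ring.
  by rewrite mulr_sumr; apply: eq_bigr => j _; rewrite mulr_sumr.
by have := mean_le_affine m0 term; rewrite -/(G _ _); lra.
Qed.

Lemma chebyshev_le1 k s : -1 <= s <= 1 -> `|chebyshev k s : R| <= 1.
Proof.
move=> hs; have -> : s = cos (acos s) by rewrite acosK// in_itv.
by rewrite chebyshev_cos; exact: cos_max.
Qed.

Lemma log_energy_ge_width m N (mu : probability (R * R)%type R) : (0 < m)%N -> mu E = 1%E ->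
  ((- (log_error rho m.-1 - ln (2 * r) + 2 * log_error r N
    + m%:R^-1 * \sum_(j < m) ln (width E (mid_angle m j))))%:E <= log_energy E mu)%E.
Proof.
move=> m0 mu1; have /andP[r0 r1] := hr.
apply: (@log_energy_ge _ mu E ('I_m * 'I_N)%type _ 1
  (fun i => 2 * r ^+ i.2.+1 / i.2.+1%:R / m%:R)
  (fun i x => chebyshev i.2.+1 (slab (mid_angle m i.1) x))) => //.
- exact: compact_measurable_plane.
- by move=> i; rewrite !divr_ge0 ?mulr_ge0 ?exprn_ge0// ltW.
- move=> i; apply: measurableT_comp.
    by apply: continuous_measurable_fun; exact: continuous_chebyshev.
  rewrite /slab /dot; apply: measurable_funM; last exact: measurable_cst.
  apply: measurable_funM; first exact: measurable_cst.
  apply: measurable_funB; last exact: measurable_cst.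
  apply: measurable_funD; apply: measurable_funM; try exact: measurable_cst.
    exact: measurable_fst.
  exact: measurable_snd.
- by move=> i x Ex; apply: chebyshev_le1; exact: slab_itv.
- move=> x y Ex Ey; rewrite log_kernelE; case: ifPn => [_|d0]; first exact: leey.
  rewrite lee_fin; have := log_edist_le N m0 Ex Ey d0; lra.
Qed.

End KernelBound.

Lemma ln_le_tangent (a x : R) : 0 < a -> 0 < x -> ln x <= x / a - 1 + ln a.
Proof.
move=> a0 x0; have xa : 0 < x / a by rewrite divr_gt0.
have := @le_ln1Dx R (x / a - 1).
rewrite subrKC ln_div ?posrE//.
have -> : -1 < x / a - 1 by lra.
by move=> /(_ isT); lra.
Qed.

(** Jensen's inequality, by the tangent line of ln at a. *)
Lemma mean_ln_le (a : R) m (w : 'I_m -> R) : (0 < m)%N -> 0 < a -> (forall j, 0 < w j) ->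
  \sum_(j < m) w j <= m%:R * a -> m%:R^-1 * \sum_(j < m) ln (w j) <= ln a.
Proof.
move=> m0 a0 wp H; have mr0 : (0 : R) < m%:R by rewrite ltr0n.
rewrite mulrC ler_pdivrMr//.
apply: le_trans (ler_sum _ (fun j _ => ln_le_tangent a0 (wp j))) _.
rewrite (eq_bigr (fun j => w j / a + (ln a - 1))); last by move=> j _; ring.
rewrite big_split /= sumr_const card_ord -mulr_suml -[_ *+ m]mulr_natl.
have h : (\sum_(j < m) w j) / a <= m%:R by rewrite ler_pdivrMr.
lra.
Qed.

Lemma log_error_small (r d : R) : 0 <= r < 1 -> 0 < d ->
  exists n0, forall n, (n0 <= n)%N -> log_error r n <= d.
Proof.
move=> /andP[r0 r1] d0; have q0 : 0 < (1 - r) ^+ 2 by rewrite exprn_gt0// subr_gt0.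
have := @cvg_expr R r; rewrite ger0_norm// => /(_ r1) /cvgr0Pnorm_lt.
move=> /(_ (d * (1 - r) ^+ 2 / 2)); rewrite divr_gt0 ?mulr_gt0 ?exprn_gt0// ?subr_gt0// => /(_ isT).
move=> [n0 _ H]; exists n0 => n hn; rewrite /log_error ler_pdivrMr//.
have := H n.+1 (leq_trans hn (leqnSn _)); rewrite ger0_norm ?exprn_ge0//; lra.
Qed.

Lemma log_energy_ge_perimeter E (p : R) (mu : probability (R * R)%type R) :
  convex_body E -> support_sum_bound E p -> mu E = 1%E ->
  ((ln (2 * pi / p))%:E <= log_energy E mu)%E.
Proof.
move=> bE Hp mu1; have [cE _ [z zint]] := bE.
have E0 : E !=set0 by exists z; exact: interior_subset.
have [D D0 HD] := compact_edist_bounded cE.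
have [w0 w0p Hw] := width_lower_bound bE.
have p0 := pi_gt0 R.
have pp : 0 < p.
  apply: lt_le_trans (Hp 1%N isT); rewrite big_ord1 divr1 sin_pihalf mulr1 mulr_gt0//.
  exact: lt_le_trans w0p (Hw _).
apply/lee_subgt0Pr => d d0.
have d4 : 0 < d / 4 by rewrite divr_gt0.
(* The loss d is spent in four equal parts: - ln r in the Chebyshev bound, - ln r again because [a]
   exceeds p / pi by the factor 1 / r, one [log_error] for rho, and twice the [log_error] for r. *)
pose r := expR (- (d / 4)).
have r0 : 0 < r by exact: expR_gt0.
have r1 : r < 1 by rewrite expR_lt1 oppr_lt0.
have hr : 0 < r < 1 by rewrite r0.
pose eps := (1 - r) ^+ 2 / (2 * r).
have e0 : 0 < eps by rewrite divr_gt0 ?exprn_gt0 ?subr_gt0// mulr_gt0.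
pose eta := Num.min (1 / 2) (eps * w0 / D).
have eta0 : 0 < eta by rewrite lt_min divr_gt0//= divr_gt0// mulr_gt0.
have eta1 : eta <= 1 / 2 by rewrite ge_min lexx.
have etaD : eta * D <= eps * w0 by rewrite -ler_pdivlMr// ge_min lexx orbT.
pose rho := 1 - eta.
have hrho : 0 <= rho < 1 by rewrite /rho; apply/andP; split; lra.
have hrD : (1 - rho) * D <= (1 - r) ^+ 2 / (2 * r) * w0 by rewrite /rho opprB addrC subrK.
have [n1 H1] := log_error_small hrho d4.
have d8 : 0 < d / 8 by rewrite divr_gt0.
have [N /(_ _ (leqnn _)) H2] := log_error_small (r := r) (d := d / 8) (introT andP (conj (ltW r0) r1)) d8.
have [m [m0 mn1 hm]] : exists m, [/\ (0 < m)%N, (n1 <= m.-1)%N & pi / m%:R / 2 <= 1 - r].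
  exists (maxn n1 (Num.truncn (pi / (2 * (1 - r)))).+1).+1; split => //.
    by rewrite /= leq_maxl.
  have r1' : 0 < 2 * (1 - r) by rewrite mulr_gt0// subr_gt0.
  have := truncnS_gt (pi / (2 * (1 - r))); set n2 := (Num.truncn _).+1 => h.
  set m := (maxn _ _).+1.
  have n2m : n2%:R <= (m%:R : R) by rewrite ler_nat /m ltnW// ltnS leq_maxr.
  have := lt_le_trans h n2m; rewrite ltr_pdivrMr// => h'.
  by rewrite ler_pdivrMr// ler_pdivrMr ?ltr0n//; lra.
have mr0 : (0 : R) < m%:R by rewrite ltr0n.
have ang0 : 0 <= pi / m%:R / 2 :> R by rewrite !divr_ge0// ltW.
have sin_low : pi / m%:R / 2 * r <= sin (pi / m%:R / 2).
  apply: le_trans (sin_ge_quadratic ang0); rewrite ler_wpM2l//; lra.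
have Hwp j : 0 < width E (mid_angle m j) by exact: lt_le_trans w0p (Hw _).
pose a := p / (pi * r).
have a0 : 0 < a by rewrite divr_gt0 ?mulr_gt0.
have mean : \sum_(j < m) width E (mid_angle m j) <= m%:R * a.
  have S0 : 0 <= \sum_(j < m) width E (mid_angle m j) by apply: sumr_ge0 => j _; exact: ltW.
  have := Hp m m0; rewrite -/(\sum_(j < m) width E (mid_angle m j)) => h1.
  have h2 := ler_wpM2r S0 sin_low.
  have h3 : pi * r / m%:R * \sum_(j < m) width E (mid_angle m j) <= p by lra.
  have pr : 0 < pi * r / m%:R by rewrite divr_gt0 ?mulr_gt0.
  have -> : m%:R * a = p / (pi * r / m%:R) by rewrite /a invf_div mulrCA.
  by rewrite ler_pdivlMr// mulrC.
have H3 := mean_ln_le m0 a0 (fun j => Hwp j) mean.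
have := @log_energy_ge_width E D w0 r rho cE E0 HD w0p Hw hr hrho hrD m N mu m0 mu1.
apply: le_trans; rewrite -EFinB lee_fin.
have := H1 _ mn1.
have lr : ln r = - (d / 4) by rewrite expRK.
have -> : ln (2 * pi / p) = ln 2 + ln pi - ln p by rewrite ln_div ?posrE ?mulr_gt0// lnM ?posrE.
have -> : ln (2 * r) = ln 2 + ln r by rewrite lnM ?posrE.
have la : ln a = ln p - (ln pi + ln r) by rewrite ln_div ?posrE ?mulr_gt0// lnM ?posrE.
rewrite la lr in H3; rewrite lr; lra.
Qed.

Lemma I0_ge E (p : R) : convex_body E -> support_sum_bound E p -> ((ln (2 * pi / p))%:E <= I0 E)%E.
Proof.
move=> bE Hp; have [cE _ _] := bE.
have clE : closed E by apply: compact_closed => //; exact: norm_hausdorff.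
apply: le_ereal_inf_tmp => _ [mu smu <-]; apply: log_energy_ge_perimeter => //.
have mE := compact_measurable_plane cE.
have := smu; rewrite /supported_on /= -(closure_id _).1// => h.
have := probability_setC mu mE; rewrite [LHS]h => h1.
have := fin_num_measure mu E mE.
by move: h1; case: (mu E) => // e [h1] _; congr EFin; lra.
Qed.

End EnergyOfConvexBody.

(** * Energy of the uniform measure on a circle *)

Section PoissonLogMean.
Context {R : realType}.
Notation leb := (@lebesgue_measure R).

Lemma Rintegral_log_series (r s : R) N : \int[leb]_(t in `[0, 2 * pi]) log_series r (t - s) N = 0.
Proof.
pose F (t : R) := \sum_(k < N) r ^+ k.+1 * sin (k.+1%:R * (t - s)) / k.+1%:R ^+ 2.
have p0 : 0 <= 2 * pi :> R by rewrite mulr_ge0 ?pi_ge0.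
have d1 (k : R) (t : R) : is_derive t 1 (fun t : R => k * (t - s)) k.
  have -> : (fun t : R => k * (t - s)) = k \*: (id - cst s) by apply/funext.
  by apply: is_derive_eq; rewrite subr0 /GRing.scale /= mulr1.
have cf : continuous (fun t => log_series r (t - s) N).
  rewrite /log_series => t; apply: cvg_sum_ord => k.
  apply: cvgM; last exact: cvg_cst.
  apply: cvgM; first exact: cvg_cst.
  apply: (@continuous_comp _ _ _ (fun t : R => k.+1%:R * (t - s)) cos); last exact: continuous_cos.
  apply: cvgM; first exact: cvg_cst.
  by apply: cvgB; [exact: cvg_id|exact: cvg_cst].
have dF (t : R) : is_derive t 1 F (log_series r (t - s) N).
  rewrite /F /log_series.
  have -> : (fun t : R => \sum_(k < N) r ^+ k.+1 * sin (k.+1%:R * (t - s)) / k.+1%:R ^+ 2) =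
    \sum_(k < N) (fun t : R => r ^+ k.+1 * sin (k.+1%:R * (t - s)) / k.+1%:R ^+ 2).
    by apply/funext => x; rewrite fct_sumE.
  apply: is_derive_sum => k.
  have -> : (fun t : R => r ^+ k.+1 * sin (k.+1%:R * (t - s)) / k.+1%:R ^+ 2) =
     (r ^+ k.+1 / k.+1%:R ^+ 2) \*: (sin \o (fun t : R => k.+1%:R * (t - s))).
    by apply/funext => x; rewrite /= /GRing.scale /=; ring.
  have d2 := @is_derive1_comp _ sin (fun t : R => k.+1%:R * (t - s)) t _ _ (is_derive_sin _) (d1 k.+1%:R t).
  have k0 : k.+1%:R != 0 :> R by rewrite pnatr_eq0.
  by apply: is_derive_eq; rewrite /GRing.scale /=; field; rewrite addrC natr1.
rewrite (Rintegral_primitive p0 cf (fun t _ => dF t)) /F -sumrB big1// => k _.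
have -> : k.+1%:R * (2 * pi - s) = k.+1%:R * (0 - s) + 2 * pi * k.+1%:R by ring.
by rewrite sin_add2pin subrr.
Qed.

(** Minus the logarithm of |1 - r e^(i (t - s))|: continuous in t for r < 1, and for r -> 1 the
    logarithmic kernel of the unit circle. *)
Definition poisson_log (r s t : R) : R := - (ln (1 - 2 * r * cos (t - s) + r ^+ 2) / 2).

Lemma continuous_poisson_log (r s : R) : 0 <= r < 1 -> continuous (poisson_log r s).
Proof.
move=> /andP[r0 r1] t.
have c1 : {for t, continuous (fun t : R => 1 - 2 * r * cos (t - s) + r ^+ 2)}.
  apply: cvgD; last exact: cvg_cst.
  apply: cvgB; first exact: cvg_cst.
  apply: cvgM; first exact: cvg_cst.
  apply: (@continuous_comp _ _ _ (fun t : R => t - s) cos); last exact: continuous_cos.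
  by apply: cvgB; [exact: cvg_id|exact: cvg_cst].
have D0 : 0 < 1 - 2 * r * cos (t - s) + r ^+ 2.
  by apply: lt_le_trans (poisson_denom_ge _ r0); rewrite exprn_gt0// subr_gt0.
have c2 := continuous_comp c1 (continuous_ln D0).
rewrite /poisson_log; apply: cvgN.
by apply: cvgM; [exact: c2|exact: cvg_cst].
Qed.

Lemma Rintegral_poisson_log_le0 (r s : R) : 0 <= r < 1 ->
  \int[leb]_(t in `[0, 2 * pi]) poisson_log r s t <= 0.
Proof.
move=> hr; apply/ler_addgt0Pr => e e0; rewrite add0r.
have p0 : 0 < 2 * pi :> R by rewrite mulr_gt0 ?pi_gt0.
have [N /(_ _ (leqnn _)) HN] := log_error_small hr (divr_gt0 e0 p0).
have cS : continuous (fun t => log_series r (t - s) N).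
  move=> t; rewrite /log_series; apply: cvg_sum_ord => k.
  apply: cvgM; last exact: cvg_cst.
  apply: cvgM; first exact: cvg_cst.
  apply: (@continuous_comp _ _ _ (fun t : R => k.+1%:R * (t - s)) cos); last exact: continuous_cos.
  apply: cvgM; first exact: cvg_cst.
  by apply: cvgB; [exact: cvg_id|exact: cvg_cst].
have cC : continuous (fun _ : R => log_error r N) by move=> t; exact: cvg_cst.
apply: (@le_trans _ _ (\int[leb]_(t in `[0, 2 * pi]) (log_series r (t - s) N + log_error r N))).
  apply: le_Rintegral => //.
  - by apply: continuous_integrable; exact: continuous_poisson_log.
  - by apply: continuous_integrable => t; apply: cvgD; [exact: cS|exact: cC].
  - move=> t _; have /ler_normlP[_] := log_series_remainder (t - s) N hr.
    by rewrite /poisson_log -/(log_error r N); lra.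
rewrite RintegralD//; try exact: continuous_integrable.
rewrite Rintegral_log_series add0r.
have := @Rintegral_affine R (log_error r N) 0 0 (2 * pi) (ltW p0).
under eq_Rintegral => t _ do rewrite mul0r addr0.
move=> ->; rewrite !mul0r addr0 subr0 mulrC.
by rewrite -ler_pdivlMr.
Qed.

End PoissonLogMean.

Section CircleEnergy.
Context {R : realType}.
Notation leb := (@lebesgue_measure R).
Variables (c : R * R) (r : R).
Hypothesis r0 : 0 < r.

Lemma edist_circle_point s t :
  edist (circle_point c r s) (circle_point c r t) = r * Num.sqrt (2 - 2 * cos (t - s)).
Proof.
have rp := r0; rewrite -[X in X * _]gtr0_norm// -sqrtr_sqr -sqrtrM ?sqr_ge0//.
rewrite /edist /circle_point /= cosB; congr Num.sqrt.
have h1 := cos2Dsin2 s; have h2 := cos2Dsin2 t.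
have -> : 2 - 2 * (cos t * cos s + sin t * sin s) =
  (cos s ^+ 2 + sin s ^+ 2) + (cos t ^+ 2 + sin t ^+ 2) - 2 * (cos t * cos s + sin t * sin s).
  by rewrite h1 h2; ring.
ring.
Qed.

(** Chords are at most 2 r long, so adding ln (2 r) makes the kernel nonnegative. Writing it as a
    lower limit of nonnegative continuous kernels, on the diagonal too, prepares for Fatou's
    lemma. *)
Lemma log_kernel_circleE s t :
  (log_kernel (circle_point c r s) (circle_point c r t) + (ln (2 * r))%:E =
   limn_einf (fun n => (ln 2 + poisson_log (1 - n.+1%:R^-1) s t)%:E))%E.
Proof.
have rp := r0.
have hn (n : nat) : 0 < n.+1%:R^-1 :> R by rewrite invr_gt0.
have cn : (n.+1%:R^-1 : R) @[n --> \oo] --> (0 : R) by exact: cvg_harmonic.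
have c1 : (1 - n.+1%:R^-1 : R) @[n --> \oo] --> (1 : R).
  by rewrite -[X in _ --> X](subr0 (1 : R)); apply: cvgB => //; exact: cvg_cst.
rewrite log_kernelE edist_circle_point mulf_eq0 (gt_eqF rp) /=.
set q := 2 - 2 * cos (t - s).
have q0 : 0 <= q by have := cos_le1 (t - s); rewrite /q; lra.
case: ifPn => [/eqP/eqP|]; rewrite sqrtr_eq0 => hq.
  have cE : cos (t - s) = 1 by move: hq q0; rewrite /q; lra.
  have : (ln 2 + poisson_log (1 - n.+1%:R^-1) s t)%:E @[n --> \oo] --> +oo%E.
    apply/cvgeryP/cvgryPge => A; near=> n.
    rewrite /poisson_log cE.
    have -> : 1 - 2 * (1 - n.+1%:R^-1) * 1 + (1 - n.+1%:R^-1) ^+ 2 = n.+1%:R^-1 ^+ 2 :> R by ring.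
    have -> : ln (n.+1%:R^-1 ^+ 2) = - (2 * ln n.+1%:R) :> R.
      by rewrite lnXn ?invr_gt0// lnV ?posrE ?ltr0n// -mulr_natr; ring.
    rewrite mulNr opprK mulrAC mulfV ?mul1r//.
    apply: le_trans (_ : ln (n.+1%:R) <= _); last by rewrite lerDr ln_ge0 ?ler1n.
    rewrite -ler_expR lnK ?posrE//; near: n.
    exists (Num.truncn (expR A)) => // n /= hn'.
    by apply: ltW; apply: lt_le_trans (truncnS_gt _) _; rewrite ler_nat.
  by move=> /cvg_limn_einf_sup [-> _].
rewrite -ltNge in hq.
have cq : (1 - 2 * (1 - n.+1%:R^-1) * cos (t - s) + (1 - n.+1%:R^-1) ^+ 2 : R) @[n --> \oo] --> q.
  have -> : q = 1 - 2 * 1 * cos (t - s) + 1 * 1 by rewrite /q; ring.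
  apply: cvgD; last by under eq_fun do rewrite expr2; exact: cvgM.
  apply: cvgB; first exact: cvg_cst.
  apply: cvgM; last exact: cvg_cst.
  by apply: cvgM; [exact: cvg_cst|].
have cl := cvg_comp _ _ cq (continuous_ln hq).
have : (ln 2 + poisson_log (1 - n.+1%:R^-1) s t)%:E @[n --> \oo] --> (ln 2 - ln q / 2)%:E.
  apply/fine_cvgP; split; first by near=> n.
  apply: cvgB; first exact: cvg_cst.
  by apply: cvgM; [exact: cl|exact: cvg_cst].
move=> /cvg_limn_einf_sup [-> _]; rewrite -EFinD; congr EFin.
rewrite !lnM ?posrE ?sqrtr_gt0//.
have -> : ln (Num.sqrt q) = ln q / 2.
  have {2}-> : q = Num.sqrt q ^+ 2 by rewrite sqr_sqrtr// ltW.
  by rewrite lnXn ?sqrtr_gt0// -[_ *+ 2]mulr_natr mulfK.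
lra.
Unshelve. all: by end_near.
Qed.

Lemma poisson_log_ge (rho s t : R) : 0 <= rho < 1 -> 0 <= ln 2 + poisson_log rho s t.
Proof.
move=> /andP[h0 h1]; rewrite /poisson_log.
have D0 : 0 < 1 - 2 * rho * cos (t - s) + rho ^+ 2.
  by apply: lt_le_trans (poisson_denom_ge _ h0); rewrite exprn_gt0// subr_gt0.
have D4 : 1 - 2 * rho * cos (t - s) + rho ^+ 2 <= 2 ^+ 2.
  by have := cos_geN1 (t - s); nra.
have : ln (1 - 2 * rho * cos (t - s) + rho ^+ 2) <= ln (2 ^+ 2) by rewrite ler_ln ?posrE.
rewrite lnXn// -mulr_natr; lra.
Qed.

Lemma measurable_circle_point : measurable_fun setT (circle_point c r).
Proof.
apply: measurable_fun_pair; apply: continuous_measurable_fun => t.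
  apply: cvgD; first exact: cvg_cst.
  by apply: cvgM; [exact: cvg_cst|exact: continuous_cos].
apply: cvgD; first exact: cvg_cst.
by apply: cvgM; [exact: cvg_cst|exact: continuous_sin].
Qed.

(** Fatou's lemma gives exactly the inequality wanted, since the approximating [poisson_log] have
    nonpositive integral over a period. *)
Lemma integral_log_kernel_circle_le s :
  (\int[leb]_(t in `[0%R, (2 * pi)%R])
     (log_kernel (circle_point c r s) (circle_point c r t) + (ln (2 * r))%:E) <=
   (2 * pi * ln 2)%:E)%E.
Proof.
have p0 : 0 < 2 * pi :> R by rewrite mulr_gt0 ?pi_gt0.
have hrho (n : nat) : 0 <= (1 : R) - n.+1%:R^-1 < 1.
  by rewrite subr_ge0 invf_le1 ?ler1n//= ltrBlDr ltrDl invr_gt0.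
pose f (n : nat) (t : R) : \bar R := (ln 2 + poisson_log (1 - n.+1%:R^-1) s t)%:E.
have cf n : continuous (fun t => ln 2 + poisson_log (1 - n.+1%:R^-1) s t).
  by move=> t; apply: cvgD; [exact: cvg_cst|exact: continuous_poisson_log].
have If n : (\int[leb]_(t in `[0%R, (2 * pi)%R]) f n t <= (2 * pi * ln 2)%:E)%E.
  have iF := continuous_integrable 0 (2 * pi) (cf n).
  rewrite -[X in (X <= _)%E]fineK ?integrable_fin_num// lee_fin.
  rewrite -/(Rintegral _ _ _) RintegralD//.
  - have := Rintegral_poisson_log_le0 s (hrho n).
    have := @Rintegral_affine R (ln 2) 0 0 (2 * pi) (ltW p0).
    under eq_Rintegral => t _ do rewrite mul0r addr0.
    by move=> ->; lra.
  - by apply: (@continuous_integrable _ (fun=> ln 2)) => t; exact: cvg_cst.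
  - by apply: continuous_integrable; exact: continuous_poisson_log.
have mf n : measurable_fun `[0%R, (2 * pi)%R] (f n).
  apply/measurable_EFinP; apply: measurable_funTS; apply: continuous_measurable_fun; exact: cf.
under eq_integral => t _ do rewrite log_kernel_circleE.
apply: (le_trans (fatou leb (measurable_itv _) mf _)).
  by move=> n t _; rewrite lee_fin poisson_log_ge.
rewrite limn_einf_lim; apply: lime_le; first exact: is_cvg_einfs.
near=> n; apply: le_trans (If n); apply: ereal_inf_lbound; exists n => //=.
Unshelve. all: by end_near.
Qed.


(* [uniform_prob] is a measure on [measurableTypeR R], whose display differs from that of [R]. *)
Let measurable_circle_pointR :
  measurable_fun [set: measurableTypeR R] (circle_point c r : measurableTypeR R -> (R * R)%type).
Proof. exact: measurable_circle_point. Qed.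

Definition circle_mfun : {mfun measurableTypeR R >-> (R * R)%type} :=
  @mfun_Sub _ _ (measurableTypeR R) (R * R)%type _ (mem_set measurable_circle_pointR).

Lemma two_pi_gt0 : 0 < 2 * pi :> R. Proof. by rewrite mulr_gt0 ?pi_gt0. Qed.

Definition circle_prob : probability (R * R)%type R := distribution (uniform_prob two_pi_gt0) circle_mfun.

Lemma disc_circle_point t : disc c r (circle_point c r t).
Proof.
rewrite /disc /= edist_le_sqr ?(ltW r0)//= !(addrAC _ _ (- _)) !subrr !add0r !exprMn -mulrDr.
by rewrite cos2Dsin2 mulr1.
Qed.

Lemma circle_prob_disc : circle_prob (disc c r) = 1%E.
Proof.
rewrite /circle_prob /distribution /pushforward /=.
have -> : circle_point c r @^-1` disc c r = setT.
  by apply/seteqP; split => // t _; exact: disc_circle_point.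
exact: probability_setT.
Qed.

Local Notation mu := circle_prob.
Local Notation M := (mu \x mu)%E.
Local Notation E := (disc c r).

(** The shifted kernel is nonnegative on the disc, of diameter 2 r, so Tonelli reduces its integral
    to the circle and bounds it by ln 2. Being then integrable, it may be split from the constant,
    and ln 2 - ln (2 r) = - ln r. *)
Lemma log_energy_circle_le : (log_energy E mu <= (- ln r)%:E)%E.
Proof.
have rp := r0; have mE : measurable E by exact: closed_measurable_plane (@closed_disc _ c r).
have mEE : measurable (E `*` E) by exact: measurableX.
pose K (z : (R * R) * (R * R)) := (log_kernel z.1 z.2 + (ln (2 * r))%:E)%E.
have mK : measurable_fun setT K by apply: emeasurable_funD => //; exact: measurable_log_kernel.
have K0 z : (E `*` E) z -> (0 <= K z)%E.
  move=> [/= h1 h2]; rewrite /K log_kernelE; case: ifPn => [_|d0]; first exact: leey.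
  rewrite -EFinD lee_fin addrC subr_ge0 ler_ln ?posrE ?mulr_gt0//.
    have := edist_triangle c z.1 z.2; rewrite (edistC c z.2).
    by move: h1 h2; rewrite /disc /=; lra.
  by rewrite lt_neqAle eq_sym d0 edist_ge0.
pose L := K \_ (E `*` E).
have mL : measurable_fun setT L by apply/(measurable_restrictT _ mEE); exact: measurable_funTS.
have L0 z : (0 <= L z)%E.
  by rewrite /L patchE; case: ifPn => // /set_mem; exact: K0.
have Lcircle s t : L (circle_point c r s, circle_point c r t) =
   (log_kernel (circle_point c r s) (circle_point c r t) + (ln (2 * r))%:E)%E.
  by rewrite /L patchE mem_set//; split; exact: disc_circle_point.
have IK : (\int[M]_(z in E `*` E) K z <= (ln 2)%:E)%E.
  rewrite integral_mkcond -/L (fubini_tonelli1 L mL L0).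
  have mF := measurable_fun_fubini_tonelli_F (m2 := mu) L mL L0.
  rewrite ge0_integral_distribution//; last by move=> x; exact: integral_ge0.
  apply: (@le_trans _ _ (\int[uniform_prob two_pi_gt0]_s (cst (ln 2)%:E) s)%E).
    apply: ge0_le_integral => //.
    - by move=> s _; exact: integral_ge0.
    - exact: measurableT_comp mF measurable_circle_point.
    move=> s _; rewrite /fubini_F /= ge0_integral_distribution//; last first.
      exact: measurable_fun_pair2 mL.
    rewrite integral_uniform; last 2 first.
    - apply: (measurableT_comp _ measurable_circle_point).
      exact: measurable_fun_pair2 mL.
    - by move=> t; exact: L0.
    rewrite subr0; under eq_integral => t _ do rewrite /= Lcircle.
    have := integral_log_kernel_circle_le s.
    have p0 := two_pi_gt0.
    by rewrite lee_pdivrMl// -EFinM.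
  rewrite integral_cst// -[leRHS]mule1 lee_wpmul2l ?probability_le1//.
  by rewrite lee_fin ln_ge0// ler1n.
have iK : M.-integrable (E `*` E) K.
  apply/integrableP; split; first exact: measurable_funTS.
  under eq_integral => z /set_mem Ez do rewrite gee0_abs ?K0//.
  exact: le_lt_trans IK (ltry _).
have MEE : M (E `*` E) = 1%E.
  transitivity (mu E * mu E)%E; first exact: product_measure1E.
  by rewrite circle_prob_disc mule1.
have iC : M.-integrable (E `*` E) (cst (- ln (2 * r))%:E).
  apply: (@bounded_integrable _ _ _ M (cst (- ln (2 * r))) _ `|- ln (2 * r)|) => //.
  exact: prod_probability_finite.
have -> : log_energy E mu = (\int[M]_(z in E `*` E) (K z + cst (- ln (2 * r))%:E z))%E.
  by apply: eq_integral => z _; rewrite /K /= EFinN addeK.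
rewrite integralD//.
have -> : (\int[M]_(z in E `*` E) (cst (- ln (2 * r))%:E) z)%E = (- ln (2 * r))%:E.
  by transitivity ((- ln (2 * r))%:E * M (E `*` E))%E; [exact: integral_cst|rewrite MEE mule1].
apply: le_trans (leeD2r _ IK) _.
by rewrite -EFinD lee_fin lnM ?posrE//; lra.
Qed.

Lemma I0_disc_le : (I0 E <= (- ln r)%:E)%E.
Proof.
apply: le_trans log_energy_circle_le; apply: ereal_inf_lbound; exists mu => //=.
rewrite /supported_on -(closure_id _).1; last exact: closed_disc.
have mE : measurable E by exact: closed_measurable_plane (@closed_disc _ c r).
by rewrite probability_setC// circle_prob_disc subee.
Qed.

End CircleEnergy.

(** * Minimizers *)

Section Minimizers.
Context {R : realType}.
Implicit Types (E F : set (R * R)) (c : R * R) (r p Q : R).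

Lemma support_sum_bound_perimeter E p : convex_body E -> (perimeter E <= p%:E)%E -> support_sum_bound E p.
Proof.
by move=> bE Ep m m0; rewrite -lee_fin; apply: le_trans (perimeter_ge_sum_support bE m0) Ep.
Qed.

(** The upper bound is [bonnesen] for the disc itself with c = 0 and p = 2 pi r, where r p - pi r^2
    = pi r^2. *)
Lemma area_disc c r : 0 < r -> area (disc c r) = (pi * r ^+ 2)%:E.
Proof.
move=> r0; apply/le_anti; rewrite area_disc_ge// andbT.
have bD := convex_body_disc c r0; have [cD convD _] := bD.
have Hp := support_sum_bound_perimeter bD (perimeter_disc_le c r0).
have pi2 : 0 < (pi / 2 : R) < pi by have p1 := pi_gt0 R; apply/andP; split; lra.
have edge u : u ^+ 2 = r ^+ 2 -> disc c r (c.1 + u, c.2).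
  by move=> u2; rewrite /disc /= edist_le_sqr ?(ltW r0)//= addrAC !subrr add0r expr0n addr0 u2.
have B A : (A%:E <= area (disc c r))%E -> A <= pi * r ^+ 2.
  move=> HA; have := @bonnesen _ (disc c r) A (2 * pi * r) c.1 r 0 (pi / 2) (pi / 2) cD convD r0 _ _ _ (lexx 0) (ltW r0) pi2 pi2 HA Hp.
  rewrite subr0 !mulr0 !mul0r !addr0 => H; apply: le_trans (H _ _ _) _.
  - move=> x; rewrite /disc /= edist_le_sqr ?(ltW r0)// => h.
    have : (x.1 - c.1) ^+ 2 <= r ^+ 2 by apply: le_trans h; rewrite lerDl sqr_ge0.
    by rewrite -[_ ^+ 2]real_normK ?num_real// ler_pXn2r ?nnegrE ?(ltW r0)// => /ler_normlP[h1 h2]; apply/andP; split; lra.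
  - by exists (c.1 + - r, c.2) => //; apply: edge; rewrite sqrrN.
  - by exists (c.1 + r, c.2) => //; apply: edge.
  - by rewrite le_eqVlt; apply/orP; left; apply/eqP; ring.
case: (area (disc c r)) B => [a|/(_ (pi * r ^+ 2 + 1) (leey _))|_]; last by rewrite leNye.
  by rewrite lee_fin; apply.
by move=> h; exfalso; lra.
Qed.

Lemma sqrt_pi_gt1 : 1 < Num.sqrt pi :> R.
Proof.
rewrite -[X in X < _]sqrtr1 ltr_sqrt ?pi_gt0//; have := pi_ge2 R; lra.
Qed.

(** In these terms the disc of area 1 has radius 1 / s, perimeter 2 s and energy ln s. *)
Let s : R := Num.sqrt pi.
Let s1 : 1 < s := sqrt_pi_gt1.
Let s0 : 0 < s. Proof. exact: lt_trans ltr01 s1. Qed.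
Let s2 : s ^+ 2 = pi. Proof. by rewrite sqr_sqrtr// pi_ge0. Qed.

Lemma functional_disc_le Q c : 0 < Q ->
  (functional Q (disc c s^-1) <= (2 * s + Q ^+ 2 * ln s)%:E)%E.
Proof.
move=> Q0; have si : 0 < s^-1 by rewrite invr_gt0.
rewrite /functional EFinD; apply: leeD.
  apply: le_trans (perimeter_disc_le c si) _; rewrite lee_fin -s2.
  by rewrite expr2 mulrA -mulrA mulfV ?gt_eqF// mulr1.
have := I0_disc_le c si; rewrite lnV ?posrE// opprK => h.
by rewrite [leRHS]EFinM; apply: lee_wpmul2l => //; rewrite lee_fin sqr_ge0.
Qed.

Lemma functional_ge Q F : 0 < Q < 1 -> admissible F ->
  ((2 * s + Q ^+ 2 * ln s)%:E <= functional Q F)%E /\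
  ((functional Q F <= (2 * s + Q ^+ 2 * ln s)%:E)%E -> is_ball F).
Proof.
move=> /andP[Q0 Q1] [bF AF].
have Q20 : 0 < Q ^+ 2 by rewrite exprn_gt0.
have P0 := perimeter_ge_sum_support bF (isT : (0 < 1)%N).
have [w w0 Hw] := width_lower_bound bF.
have P0' : (0%:E <= perimeter F)%E.
  apply: le_trans P0; rewrite lee_fin big_ord1 divr1 sin_pihalf mulr1 mulr_ge0//.
  exact: le_trans (ltW w0) (Hw _).
have lower q : support_sum_bound F q -> ((Q ^+ 2 * ln (2 * pi / q))%:E <= (Q ^+ 2)%:E * I0 F)%E.
  by move=> Hq; rewrite EFinM; apply: lee_wpmul2l; [rewrite lee_fin ltW|exact: I0_ge].
case PE : (perimeter F) P0' => [p| |] // p0; last first.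
  (* With infinite perimeter the functional is +oo, because the energy term is bounded below. *)
  have [q /lower Hq] := support_sum_bound_exists bF.
  have -> : functional Q F = +oo%E.
    rewrite /functional PE addye// gt_eqF//; exact: lt_le_trans (ltNyr _) Hq.
  by split; rewrite ?leey// leye_eq.
rewrite lee_fin in p0.
have Hp : support_sum_bound F p by apply: support_sum_bound_perimeter => //; rewrite PE.
have hs0 := s0; have hs1 := s1; have hs2 := s2.
have ps : 2 * s <= p := isoperimetric_inequality bF AF Hp p0.
have pp : 0 < p by apply: lt_le_trans ps; rewrite mulr_gt0.
(* As s > 1, ln (p / (2 s)) <= p / (2 s) - 1 <= (p - 2 s) / 2, so for Q < 1 the energy recovers at
   most half of the excess perimeter. The remaining half forces p = 2 s in the equality case. *)
have key : 2 * s + Q ^+ 2 * ln s + (p - 2 * s) / 2 <= p + Q ^+ 2 * ln (2 * pi / p).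
  have -> : 2 * pi / p = s / (p / (2 * s)) by rewrite -hs2; field; rewrite !gt_eqF.
  rewrite ln_div ?posrE ?divr_gt0 ?mulr_gt0//.
  have s20 : 0 < 2 * s by rewrite mulr_gt0.
  have := ln_le_tangent ltr01 (divr_gt0 pp s20); rewrite ln1 divr1 addr0.
  set l := ln (p / _) => hl.
  have h1 : Q ^+ 2 * l <= Q ^+ 2 * (p / (2 * s) - 1) by rewrite ler_pM2l.
  have h2 : p / (2 * s) - 1 <= (p - 2 * s) / 2.
    have -> : p / (2 * s) - 1 = (p - 2 * s) / 2 / s by field; rewrite gt_eqF.
    by rewrite ler_pdivrMr// ler_peMr ?(ltW hs1)// divr_ge0// subr_ge0.
  have h3 : Q ^+ 2 * (p / (2 * s) - 1) <= p / (2 * s) - 1.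
    rewrite ler_piMl//; last by rewrite expr_le1// ltW.
    by rewrite subr_ge0 ler_pdivlMr// mul1r.
  lra.
have fge : ((p + Q ^+ 2 * ln (2 * pi / p))%:E <= functional Q F)%E.
  by rewrite /functional PE EFinD leeD2l// lower.
split.
  by apply: le_trans fge; rewrite lee_fin; lra.
move=> fle; have := le_trans fge fle; rewrite lee_fin => h.
have pE : p = 2 * s by apply/le_anti; rewrite ps andbT; lra.
by rewrite pE in Hp; apply: isoperimetric_equality.
Qed.

Lemma admissible_disc c : admissible (disc c s^-1).
Proof.
have si : 0 < s^-1 by rewrite invr_gt0.
split; first exact: convex_body_disc.
by rewrite area_disc// -s2 -exprMn mulfV ?gt_eqF// expr1n.
Qed.

Lemma radius_of_area1 c r : 0 < r -> area (disc c r) = 1%E -> r = s^-1.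
Proof.
move=> r0; rewrite area_disc// -s2 -exprMn => -[/eqP].
rewrite sqrf_eq1 => /orP[/eqP sr|/eqP sr]; last first.
  by have := mulr_gt0 s0 r0; rewrite sr; lra.
by rewrite -[RHS]mulr1 -sr mulrA mulVf ?mul1r// gt_eqF.
Qed.

Lemma minimizer_iff_ball Q E : 0 < Q < 1 -> is_minimizer Q E <-> is_ball E /\ area E = 1%E.
Proof.
move=> hQ; have /andP[Q0 _] := hQ; split.
  move=> [aE /(_ _ (admissible_disc (0, 0))) Emin]; split; last by case: aE.
  by apply: (functional_ge hQ aE).2; exact: le_trans Emin (functional_disc_le _ Q0).
move=> [[c [r [r0 ->]]] /(radius_of_area1 r0) ->].
split; first exact: admissible_disc.
move=> F /(functional_ge hQ)[+ _]; apply: le_trans; exact: functional_disc_le.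
Qed.

End Minimizers.

Theorem corollary1p3 (R : realType) :
  exists Q0 : R, 0 < Q0 /\
    forall Q : R, 0 < Q -> Q < Q0 ->
      forall E : set (R * R),
        is_minimizer Q E <-> (is_ball E /\ area E = 1%E).
Proof.
exists 1; split=> // Q Q0 Q1 E; apply: minimizer_iff_ball; exact/andP.
Qed.
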